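(* Let $n\ge 1$ and let $x_1,\dots,x_n\ge 1$ be integers. Let $T(x_1,\dots,x_n)$ be the Thompson diagram defined recursively in the context, and let $\psi$ be Jones' map from Thompson diagrams to link diagrams. Then the link represented by $\psi(T(x_1,\dots,x_n))$ is ambient isotopic to the closure of the left-associated tangle product $(\cdots((x_1\cdot x_2)\cdot x_3)\cdots)\cdot x_n$, where each $x_i$ stands for the $x_i$-crossing tangle.
   Context: **Trees and Thompson diagrams.** All trees are finite rooted planar binary trees; $\bullet$ is the one-leaf tree and $(A,B)$ is the tree whose root has left subtree $A$ and right subtree $B$. A Thompson diagram is a pair $(t,b)$ of such trees with the same number $N\ge 2$ of leaves (it represents an element of Thompson's group $F$). It is drawn in the plane with the top tree $t$ (root at the top, growing downward) above the horizontal axis, the bottom tree $b$ reflected (root at the bottom, growing upward) below it, and the $i$-th leaf of $t$ glued to the $i$-th leaf of $b$. The reflection of a Thompson diagram is $R(t,b)=(b,t)$. **The map $\psi$.** Given the planar drawing of $(t,b)$, every internal vertex becomes a crossing. At a non-root internal vertex, the over-strand joins the edge to the left child and the edge to the right child; the under-strand comes in along the edge to the parent (the trunk) and continues vertically into the region between the two children edges, where it is a loose end. At each of the two roots the over-strand joins the two children edges, and the under-strand is a new vertical strand with one loose end in the region between the children edges and the other loose end in the exterior region. Every region of the drawing (the $N-1$ bounded ones and the exterior one) now contains exactly two loose ends; join them inside that region without introducing further crossings. The result is the link diagram $\psi(t,b)$ (a knot or link diagram, with $2(N-1)$ crossings). **The diagrams $T$.** Let $C=(\bullet,(\bullet,\bullet))$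 (a three-legged ''chair''). Let $L_1=\bullet$ and $L_{k+1}=(L_k,\bullet)$ (left combs; $L_k$ has $k$ leaves). For an integer $m\ge 0$ define $T(m)$ to be the Thompson diagram with top tree $(\bullet,(C,(C,\cdots(C,\bullet)\cdots)))$ with $m$ copies of $C$ (so $(\bullet,\bullet)$ if $m=0$) and bottom tree $L_{3m+2}$. For $k\ge 1$, integers $x_1,\dots,x_k\ge 1$ and $m\ge 0$, put $D=(D_{\rm top},D_{\rm bot})=R\big(T(x_1,\dots,x_{k-1},x_k-1)\big)$ and define $T(x_1,\dots,x_k,m)$ to be the Thompson diagram whose top tree is obtained from the top tree of $T(m)$ by replacing its rightmost leaf by $D_{\rm top}$, and whose bottom tree is obtained from $D_{\rm bot}$ by replacing its leftmost leaf by the bottom tree of $T(m)$. (Geometrically, the lower right edge of $T(m)$ is glued to the upper left edge of $D$.) **Tangles.** A 4-tangle is a tangle diagram in a disc with four boundary points called N (top), E (right), S (bottom), W (left). The $1$-crossing tangle has a single crossing, in which the horizontal strand (W to E) passes over the vertical strand (N to S). For $x\ge 1$ the $x$-crossing tangle is obtained by arranging $x$ copies of the $1$-crossing tangle along a diagonal from upper left to lower right and joining, for each consecutive pair, the E end of the upper left one to the N end of the lower right one and the S end of the upper left one to the W end of the lower right one; its ends are N, W of the first copy and E, S of the last. For a 4-tangle $F$, $R(F)$ is its reflection $(x,y)\mapsto(x,-y)$ in a horizontal line of the plane of the diagram, with over-strands remaining over-strands. The product $F\cdot G$ is the 4-tangle obtained by placing $R(F)$ to the lower right of $G$ and joining the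 E end of $G$ to the N end of $R(F)$ and the S end of $G$ to the W end of $R(F)$; its ends are N, W of $G$ and E, S of $R(F)$. The closure of a 4-tangle is the link obtained by joining N to E and S to W by two arcs outside the disc without crossings. *)

(* Defs.v *)
From mathcomp Require Import all_boot all_order all_algebra.
From mathcomp Require Import boolp classical_sets set_interval functions.
From mathcomp Require Import reals topology normedtype.
Set Implicit Arguments.
Unset Strict Implicit.
Unset Printing Implicit Defensive.
Import Order.TTheory GRing.Theory Num.Theory.
Import numFieldNormedType.Exports.
Local Open Scope classical_set_scope.
Local Open Scope ring_scope.

Notation R3 R := (R * R * R)%type.

Definition homeomorphism (X Y : topologicalType) (f : X -> Y) : Prop :=
  exists g : Y -> X,
    [/\ cancel f g, cancel g f, continuous f & continuous g].

Definition ambient_isotopic (R : realType) (A B : set (R3 R)) : Prop :=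
  exists H : R -> R3 R -> R3 R,
    [/\ {within `[0, 1]%classic `*` [set: R3 R],
           continuous (fun q : R * R3 R => H q.1 q.2)},
        forall t : R, 0 <= t <= 1 -> homeomorphism (H t),
        forall p : R3 R, H 0 p = p &
        H 1 @` A = B].

(* A point of a polygonal link diagram: its position in the plane of the
   diagram, then a height.  The height only serves to tell which strand is the
   upper one at a crossing. *)
Definition vertex : Type := (int * int * int)%type.

(* The segments of a diagram, in any order.  In all the diagrams below, the
   projections of two segments meet only at common endpoints, and a crossing is
   a point of the plane carrying two vertices, of heights 1 (on the over-strand)
   and -1 (on the under-strand), each with two segments. *)
Definition diagram : Type := seq (vertex * vertex).

Definition point_of (R : realType) (v : vertex) : R3 R :=
  (v.1.1%:~R, v.1.2%:~R, v.2%:~R).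

Definition segment (R : realType) (p q : R3 R) : set (R3 R) :=
  [set r | exists2 t : R, 0 <= t <= 1 &
     r = ((1 - t) * p.1.1 + t * q.1.1,
          (1 - t) * p.1.2 + t * q.1.2,
          (1 - t) * p.2 + t * q.2)].

Definition link_of (R : realType) (D : diagram) : set (R3 R) :=
  [set r | exists2 e, e \in D & segment (point_of R e.1) (point_of R e.2) r].

Arguments link_of R D : clear implicits.

Inductive tree : Type := Leaf | Node of tree & tree.

Fixpoint leaves (t : tree) : nat :=
  if t is Node l r then (leaves l + leaves r)%N else 1%N.

Definition thompson : Type := (tree * tree)%type.

Definition is_thompson (d : thompson) : bool :=
  (leaves d.1 == leaves d.2) && (2 <= leaves d.1)%N.

Definition reflection (d : thompson) : thompson := (d.2, d.1).

(* Drawing of a tree whose leaves are numbered i, i + 1, ...: leaf j is at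
   (2 * j, 0); an internal vertex with k leaves below it has ordinate e * (k - 1)
   and its abscissa is halfway between those of the last leaf of its left subtree
   and of the first leaf of its right subtree.  The edges are straight.
   e = 1 gives the top tree and e = -1 the reflected bottom tree.  [apex z e i t]
   is the root of t, at height z if it is a crossing. *)
Definition apex (z e : int) (i : nat) (t : tree) : vertex :=
  match t with
  | Leaf => ((2 * i)%N%:Z, 0, 0)
  | Node l r => ((2 * (i + leaves l)).-1%:Z, e * (leaves t).-1%:Z, z)
  end.

(* The edges of the tree: each one leaves the over-strand at its upper end, and
   is the trunk, hence part of the under-strand, at its lower end. *)
Fixpoint edges (e : int) (i : nat) (t : tree) : diagram :=
  match t with
  | Leaf => [::]
  | Node l r =>
      [:: (apex 1 e i t, apex (-1) e i l);
          (apex 1 e i t, apex (-1) e (i + leaves l) r)]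
      ++ edges e i l ++ edges e (i + leaves l) r
  end.

(* The under-crossing points at the internal vertices, from left to right: the
   j-th one is above (or, for the bottom tree, below) the j-th bounded region,
   which lies between the leaves j and j + 1. *)
Fixpoint unders (e : int) (i : nat) (t : tree) : seq vertex :=
  match t with
  | Leaf => [::]
  | Node l r =>
      unders e i l ++ apex (-1) e i t :: unders e (i + leaves l) r
  end.

Definition polyline (v : vertex) (s : seq vertex) : diagram :=
  pairmap (fun p q => (p, q)) v s.

(* The loose ends in a bounded region are joined by a vertical segment; those in
   the exterior region are joined around the left of the drawing. *)
Definition psi (d : thompson) : diagram :=
  let: (t, b) := d in
  let n := (leaves t)%:Z in
  edges 1 0 t ++ edges (-1) 0 b ++ zip (unders 1 0 t) (unders (-1) 0 b) ++
  polyline (apex (-1) 1 0 t)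
    [:: ((apex (-1) 1 0 t).1.1, n, 0); (-1, n, 0); (-1, - n, 0);
        ((apex (-1) (-1) 0 b).1.1, - n, 0); apex (-1) (-1) 0 b].

Definition chair : tree := Node Leaf (Node Leaf Leaf).

(* The left comb with k.+1 leaves. *)
Definition left_comb (k : nat) : tree := iter k (fun t => Node t Leaf) Leaf.

Definition Tdiag1 (m : nat) : thompson :=
  (Node Leaf (iter m (Node chair) Leaf), left_comb (3 * m).+1).

Fixpoint graft_right (t u : tree) : tree :=
  if t is Node l r then Node l (graft_right r u) else u.

Fixpoint graft_left (t u : tree) : tree :=
  if t is Node l r then Node (graft_left l u) r else u.

(* [Tdiag_rec [:: x_k; ...; x_1] m] is T(x_1, ..., x_k, m). *)
Fixpoint Tdiag_rec (s : seq nat) (m : nat) : thompson :=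
  if s is x :: s' then
    let D := reflection (Tdiag_rec s' x.-1) in
    (graft_right (Tdiag1 m).1 D.1, graft_left D.2 (Tdiag1 m).2)
  else Tdiag1 m.

(* The value for the empty sequence is irrelevant. *)
Definition Tdiag (xs : seq nat) : thompson :=
  if rev xs is m :: s then Tdiag_rec s m else Tdiag1 0.

Lemma leaves_gt0 (t : tree) : (0 < leaves t)%N.
Proof. by elim: t => //= l Hl r Hr; rewrite addn_gt0 Hl. Qed.

Lemma leaves_graft_right (t u : tree) :
  (leaves (graft_right t u)).+1 = (leaves t + leaves u)%N.
Proof. by elim: t => //= l _ r IH; rewrite -addnS IH addnA. Qed.

Lemma leaves_graft_left (t u : tree) :
  (leaves (graft_left t u)).+1 = (leaves t + leaves u)%N.
Proof. by elim: t => //= l IH r _; rewrite -addSn IH addnAC. Qed.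

Lemma Tdiag1_is_thompson (m : nat) : is_thompson (Tdiag1 m).
Proof.
have E1 : leaves (Tdiag1 m).1 = (3 * m).+2.
  rewrite /= add1n; congr _.+1; elim: m => //= m ->.
  by rewrite mulnS addnS.
have E2 k : leaves (left_comb k) = k.+1.
  by elim: k => //= k ->; rewrite addn1.
by rewrite /is_thompson E1 E2 eqxx.
Qed.

Lemma Tdiag_is_thompson (xs : seq nat) : is_thompson (Tdiag xs).
Proof.
rewrite /Tdiag; case: (rev xs) => [|m s]; first exact: Tdiag1_is_thompson.
elim: s m => [|x s IH] m; first exact: Tdiag1_is_thompson.
have /andP[/eqP e1 h1] := Tdiag1_is_thompson m.
have /andP[/eqP e2 h2] := IH x.-1.
have gr := leaves_graft_right (Tdiag1 m).1 (Tdiag_rec s x.-1).2.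
have gl := leaves_graft_left (Tdiag_rec s x.-1).1 (Tdiag1 m).2.
rewrite /is_thompson [Tdiag_rec (_ :: _) _]/= /fst /snd -eqSS.
apply/andP; split; first by apply/eqP; rewrite gr gl e1 e2 addnC.
by rewrite -ltnS gr; apply: (@leq_trans (2 + 2)%N) => //; rewrite leq_add // -e2.
Qed.

(* A tangle diagram in the square [-s, s]^2, s = [radius], whose ends N, E, S, W
   are the midpoints of the sides of the square, at height 0. *)
Record tangle : Type := Tangle { radius : nat; arcs : diagram }.

Definition endN (s : nat) : vertex := (0, s%:Z, 0).
Definition endE (s : nat) : vertex := (s%:Z, 0, 0).
Definition endS (s : nat) : vertex := (0, - s%:Z, 0).
Definition endW (s : nat) : vertex := (- s%:Z, 0, 0).

Definition map_diagram (f : vertex -> vertex) (D : diagram) : diagram :=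
  [seq (f e.1, f e.2) | e <- D].

Definition translate (a b : int) (v : vertex) : vertex :=
  (v.1.1 + a, v.1.2 + b, v.2).

Definition flip (v : vertex) : vertex := (v.1.1, - v.1.2, v.2).

Definition tangleR (F : tangle) : tangle :=
  Tangle (radius F) (map_diagram flip (arcs F)).

Definition one_crossing : tangle :=
  Tangle 1 (polyline (endW 1) [:: (0, 0, 1); endE 1] ++
            polyline (endN 1) [:: (0, 0, -1); endS 1]).

(* G, with F to its lower right; the E end of G is joined to the N end of F and
   the S end of G to the W end of F; the ends are N, W of G and E, S of F. *)
Definition diag_join (G F : tangle) : tangle :=
  let a := radius G in
  let b := radius F in
  let s := (a + b + 2)%N in
  let g := translate (- b.+1%:Z) b.+1%:Z in
  let f := translate a.+1%:Z (- a.+1%:Z) in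
  Tangle s
    (map_diagram g (arcs G) ++ map_diagram f (arcs F) ++
     polyline (g (endE a)) [:: (a.+1%:Z, b.+1%:Z, 0); f (endN b)] ++
     polyline (g (endS a)) [:: (- b.+1%:Z, - a.+1%:Z, 0); f (endW b)] ++
     [:: (endN s, g (endN a)); (endW s, g (endW a));
         (f (endE b), endE s); (f (endS b), endS s)]).

(* The x-crossing tangle, for x >= 1. *)
Definition crossings (x : nat) : tangle :=
  iter x.-1 (diag_join one_crossing) one_crossing.

Definition product (F G : tangle) : tangle := diag_join G (tangleR F).

(* The left-associated product; the value for the empty sequence is
   irrelevant. *)
Definition tangle_product (xs : seq nat) : tangle :=
  if xs is x :: s then foldl (fun F y => product F (crossings y)) (crossings x) s
  else one_crossing.

Definition closure_of (F : tangle) : diagram :=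
  let s := radius F in
  arcs F ++
  polyline (endN s) [:: (s.+1%:Z, s.+1%:Z, 0); endE s] ++
  polyline (endS s) [:: (- s.+1%:Z, - s.+1%:Z, 0); endW s].

(* Main.v *)
Require Import Defs.
From mathcomp Require Import all_boot all_order all_algebra.
From mathcomp Require Import boolp classical_sets reals topology normedtype.
From HB Require Import structures.
From mathcomp Require Import set_interval functions prodnormedzmodule sequences.
From mathcomp Require Import interval_inference.
From Stdlib Require Import ZArith.
From mathcomp Require Import ring lra zify ssrZ.
Delimit Scope nat_scope with N.
Set Implicit Arguments.
Unset Strict Implicit.
Unset Printing Implicit Defensive.
Import Order.TTheory GRing.Theory Num.Theory.
Import numFieldNormedType.Exports.
Local Open Scope classical_set_scope.
Local Open Scope ring_scope.

(** The two links are related by a chain of straight motions, in which each point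
    moves on a line at constant speed. Such a motion extends to an ambient isotopy
    as soon as any two moving points are told apart by a linear form, the same one
    before and after the motion, which controls their relative displacement
    ([isotopic_straight]). For polygonal links the condition only has to be checked
    on vertices ([sep_spanned]), so that a local move, in which tangles of unknown
    content are carried along in boxes of symbolic size, becomes a finite
    computation ([script_sound]).

    First the two trees of a Thompson diagram are flattened ([psi_flattened]): all
    the crossings of the top tree go down to ordinate 1, the parts that were above
    each other in the plane being kept apart by their heights, and those of the
    bottom tree go up to ordinate -1. The flattened link of T(x_1, ..., x_n) is
    then cut by the planes through suitable leaves. Each plane meets it in four
    points only, and the pieces form a word ([flattened_start], [tower_core]): for
    each k one piece [gamma] per chair, and one piece [junction] where the
    reflected diagram of the recursion is glued, beyond which everything is
    reflected.

    Seen from the left, each piece amounts to one crossing, attached to the tangle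
    that the pieces on its right amount to ([gamma_relation], [junction_relation],
    [realizes_slabs]). The crossing of the junction replaces the chair that is
    missing because the recursion decreases x_k. Therefore the link is the closure of
    a tangle in which the crossings are added one at a time, each one to the upper
    left of all the previous ones. In the tangle product, the crossings that stem
    from one factor are first assembled; both bracketings give the same link because
    the leftmost crossing can be pulled to the left, whether it is nested or not
    ([join_relation], [join2_relation], [nested_product]). *)

(** * Isotopies *)

HB.saturate prod.

(** Makes R3 a complete space, for the sake of the fixed point theorem. *)
Lemma prod_complete (K : numFieldType) (X Y : completeNormedModType K)
    (F : set_system (X * Y)%type) :
  ProperFilter F -> cauchy F -> cvg F.
Proof.
move=> FF Fc.
have c1 : cauchy (fst @ F).
  move=> A entA; rewrite near_simpl -near2E near_map2.
  apply: (Fc [set xy | A (xy.1.1, xy.2.1)]).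
  exists (A, setT) => /=; first by split=> //; exact: entourageT.
  by move=> [[a b] [c d]] /= [Aab _]; exists ((a, c), (b, d)).
have c2 : cauchy (snd @ F).
  move=> A entA; rewrite near_simpl -near2E near_map2.
  apply: (Fc [set xy | A (xy.1.2, xy.2.2)]).
  exists (setT, A) => /=; first by split=> //; exact: entourageT.
  by move=> [[a b] [c d]] /= [_ Aab]; exists ((a, c), (b, d)).
have /cauchy_cvg/cvg_ex[x Fx] := c1.
have /cauchy_cvg/cvg_ex[y Fy] := c2.
apply/cvg_ex; exists (x, y) => A [[B C] [/= nB nC] BC].
apply: filterS BC _.
have h1 : F (fst @^-1` B) by exact: Fx.
have h2 : F (snd @^-1` C) by exact: Fy.
by apply: filterS (filterI h1 h2) => -[a b].
Qed.

HB.instance Definition _ (K : numFieldType) (X Y : completeNormedModType K) :=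
  Uniform_isComplete.Build (X * Y)%type (@prod_complete K X Y).

Section Displacement.
Variable R : realType.

(** McShane: take the infimum over a in G of the cones a.2 + k |x - a.1|. *)
Lemma lipschitz_extension (V : normedModType R) (G : set (V * R)) (k : R) :
  0 <= k ->
  (forall a b, G a -> G b -> `|b.2 - a.2| <= k * `|b.1 - a.1|) ->
  exists f : V -> R,
    (forall x y, `|f x - f y| <= k * `|x - y|) /\ forall a, G a -> f a.1 = a.2.
Proof.
move=> k0 Glip.
have [->|/set0P[a0 Ga0]] := eqVneq G set0.
  by exists (fun=> 0); split=> [x y|a //]; rewrite subrr normr0 mulr_ge0.
pose E x := [set a.2 + k * `|x - a.1| | a in G].
have Elb x : lbound (E x) (a0.2 - k * `|x - a0.1|).
  move=> _ [a Ga <-]; have /ler_normlP[h _] := Glip _ _ Ga0 Ga.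
  have h3 : k * `|a.1 - a0.1| <= k * `|x - a.1| + k * `|x - a0.1|.
    rewrite -mulrDr; apply: ler_wpM2l => //.
    by rewrite [`|x - a.1|]distrC -[a.1 - a0.1](subrKA x) ler_normD.
  by lra.
have E0 x : (E x) !=set0 by exists (a0.2 + k * `|x - a0.1|); exists a0.
have Einf x a : G a -> inf (E x) <= a.2 + k * `|x - a.1|.
  by move=> Ga; apply: ge_inf; [exists (a0.2 - k * `|x - a0.1|)|exists a].
have le_inf x y : inf (E x) - k * `|x - y| <= inf (E y).
  apply: lb_le_inf => // _ [a Ga <-]; have := Einf x a Ga.
  have : k * `|x - a.1| <= k * `|x - y| + k * `|y - a.1|.
    by rewrite -mulrDr; apply: ler_wpM2l => //; rewrite -(subrKA y) ler_normD.
  by lra.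
exists (fun x => inf (E x)); split=> [x y|a Ga].
  have := le_inf x y; have := le_inf y x; rewrite [`|y - x|]distrC => h1 h2.
  by apply/ler_normlP; split; lra.
apply/eqP; rewrite eq_le; apply/andP; split.
  by have := Einf a.1 a Ga; rewrite subrr normr0 mulr0 addr0.
apply: lb_le_inf => // _ [b Gb <-].
by have /ler_normlP[h _] := Glip _ _ Ga Gb; move: h; rewrite distrC; lra.
Qed.

Lemma lipschitz_continuous (U V : normedModType R) (f : U -> V) (k : R) :
  (forall x y, `|f x - f y| <= k * `|x - y|) -> continuous f.
Proof.
move=> fk x; apply/cvgrPdist_lt => e e0.
have [k0|k0] := leP k 0.
  near=> y; apply: le_lt_trans (fk _ _) _.
  by apply: le_lt_trans e0; rewrite mulr_le0_ge0.
near=> y; apply: le_lt_trans (fk _ _) _.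
rewrite -ltr_pdivlMl// mulrC; near: y.
by apply: cvgr_dist_lt => //; rewrite divr_gt0.
Unshelve. all: by end_near. Qed.

(** The preimage of y is the fixed point of the contraction x |-> y - u x. *)
Lemma translated_bijective (V : completeNormedModType R) (u : V -> V) (k : R) :
  0 <= k < 1 -> (forall x y, `|u x - u y| <= k * `|x - y|) ->
  homeomorphism (fun x => x + u x).
Proof.
move=> /andP[k0 k1] uk.
have surj y : exists x, x + u x = y.
  have ctr : is_contraction (totalfun (fun x => y - u x) : {fun [set: V] >-> [set: V]}).
    exists (NngNum k0); split=> //= -[x z] _ /=.
    by rewrite opprB addrC addrA subrK distrC.
  have [//||x _ /= xE] := banach_fixed_point ctr; first by exists 0.
  by exists x; rewrite {1}xE subrK.
have expand x z : (1 - k) * `|x - z| <= `|(x + u x) - (z + u z)|.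
  have -> : x + u x - (z + u z) = (x - z) - (u z - u x).
    by rewrite opprD addrACA opprB.
  apply: le_trans (lerB_dist _ _); rewrite mulrBl mul1r lerB// .
  by rewrite distrC.
pose g y := projT1 (cid (surj y)).
have gK y : g y + u (g y) = y by rewrite /g; case: cid.
exists g; split=> //.
- move=> x; apply/eqP; rewrite -subr_eq0 -normr_le0 -(@ler_pM2l _ (1 - k)) ?subr_gt0//.
  by rewrite mulr0 (le_trans (expand _ _))// gK subrr normr0.
- apply: (@lipschitz_continuous _ _ _ (1 + k)) => x y.
  rewrite opprD addrACA mulrDl mul1r; apply: le_trans (ler_normD _ _) _.
  exact: lerD.
- apply: (@lipschitz_continuous _ _ _ (1 - k)^-1) => x y.
  by rewrite ler_pdivlMl ?subr_gt0// (le_trans (expand _ _))// !gK.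
Qed.

Lemma continuous_pair (T U W : topologicalType) (f : T -> U) (g : T -> W) :
  continuous f -> continuous g -> continuous (fun x => (f x, g x)).
Proof. by move=> cf cg x; exact: cvg_pair (cf x) (cg x). Qed.

Lemma continuous_o (T U W : topologicalType) (f : T -> U) (g : U -> W) :
  continuous f -> continuous g -> continuous (fun x => g (f x)).
Proof. by move=> cf cg x; apply: (continuous_comp (cf x)); exact: cg. Qed.

Lemma continuous_fst (T U : topologicalType) : continuous (@fst T U).
Proof. by move=> [x y]; exact: cvg_fst. Qed.

Lemma continuous_snd (T U : topologicalType) : continuous (@snd T U).
Proof. by move=> [x y]; exact: cvg_snd. Qed.

Notation V := (R3 R).

(** The time is any real number and the motion takes place between 0 and 1, so
    that isotopies are concatenated by rescaling the time only. *)
Definition isotopy (H : R -> V -> V) : Prop :=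
  [/\ continuous (fun q : R * V => H q.1 q.2),
      forall t, homeomorphism (H t),
      forall t p, t <= 0 -> H t p = p &
      forall t p, 1 <= t -> H t p = H 1 p].

Definition isotopic (A B : set V) : Prop :=
  exists2 H, isotopy H & H 1 @` A = B.

Lemma isotopic_ambient (A B : set V) : isotopic A B -> ambient_isotopic A B.
Proof.
move=> [H [Hc Hh H0 H1] HAB]; exists H; split=> //.
- exact: continuous_subspaceT.
- by move=> p; apply: H0.
Qed.

Lemma homeomorphism_id (T : topologicalType) : homeomorphism (@id T).
Proof. by exists id; split => // x; exact: cvg_id. Qed.

Lemma homeomorphism_comp (S T U : topologicalType) (f : S -> T) (g : T -> U) :
  homeomorphism f -> homeomorphism g -> homeomorphism (g \o f).
Proof.
move=> [f' [ff' f'f fc f'c]] [g' [gg' g'g gc g'c]]; exists (f' \o g'); split.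
- exact: can_comp.
- exact: can_comp.
- by move=> x; apply: continuous_comp; [exact: fc|exact: gc].
- by move=> x; apply: continuous_comp; [exact: g'c|exact: f'c].
Qed.

Lemma isotopic_refl (A : set V) : isotopic A A.
Proof.
exists (fun=> id); last by rewrite image_id.
split=> //; last by move=> t; exact: homeomorphism_id.
by move=> q; exact: cvg_snd.
Qed.

Lemma isotopic_trans (A B C : set V) :
  isotopic A B -> isotopic B C -> isotopic A C.
Proof.
move=> [H [Hc Hh H0 H1] <-] [G [Gc Gh G0 G1] <-].
exists (fun t => G (2 * t - 1) \o H (2 * t)); last first.
  rewrite image_comp; congr (_ @` _); apply/funext => p /=.
  have -> : H (2 * 1) p = H 1 p by apply: H1; rewrite mulr1 ler1n.
  by have -> : 2 * 1 - 1 = 1 :> R by ring.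
split.
- have c2 : continuous (fun q : R * V => 2 * q.1).
    by move=> q; apply: cvgM; [exact: cvg_cst|exact: cvg_fst].
  have c1 : continuous (fun q : R * V => 2 * q.1 - 1).
    by move=> q; apply: cvgB; [exact: c2|exact: cvg_cst].
  have cH : continuous (fun q : R * V => H (2 * q.1) q.2).
    exact: continuous_o (continuous_pair c2 (@continuous_snd _ _)) Hc.
  exact: continuous_o (continuous_pair c1 cH) Gc.
- by move=> t; apply: homeomorphism_comp.
- move=> t p t0 /=; have -> : H (2 * t) p = p by apply: H0; lra.
  by apply: G0; lra.
- move=> t p t1 /=; have -> : H (2 * t) p = H 1 p by apply: H1; lra.
  have -> : H (2 * 1) p = H 1 p by apply: H1; lra.
  have -> : 2 * 1 - 1 = 1 :> R by ring.
  by apply: G1; lra.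
Qed.

(** Conjugate the isotopy by h. *)
Lemma isotopic_homeomorphism (h : V -> V) (A B : set V) :
  homeomorphism h -> isotopic A B -> isotopic (h @` A) (h @` B).
Proof.
move=> [g [gh hg hc gc]] [H [Hc Hh H0 H1] <-].
exists (fun t => h \o H t \o g); last first.
  by rewrite !image_comp; congr (_ @` _); apply/funext => p /=; rewrite gh.
split.
- have cg : continuous (fun q : R * V => g q.2).
    exact: continuous_o (@continuous_snd _ _) gc.
  exact: continuous_o (continuous_o (continuous_pair (@continuous_fst _ _) cg) Hc) hc.
- move=> t; apply: homeomorphism_comp; first by exists h; split.
  by apply: homeomorphism_comp => //; exists g; split.
- by move=> t p t0 /=; rewrite H0.
- by move=> t p t1 /=; rewrite H1.
Qed.

End Displacement.

(** * Straight motions *)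

Section Straight.
Variable R : realType.
Notation V := (R3 R).

Definition dot (l v : V) : R := l.1.1 * v.1.1 + l.1.2 * v.1.2 + l.2 * v.2.

Lemma norm3_le (v : V) (k : R) :
  (`|v| <= k) = [&& `|v.1.1| <= k, `|v.1.2| <= k & `|v.2| <= k].
Proof. by rewrite !prod_normE !ge_max andbA. Qed.

Lemma norm3_ge (v : V) : [/\ `|v.1.1| <= `|v|, `|v.1.2| <= `|v| & `|v.2| <= `|v|].
Proof. by have := lexx `|v|; rewrite {1}norm3_le => /and3P[]. Qed.

Lemma dot_le (l v : V) : `|l.1.1| + `|l.1.2| + `|l.2| <= 1 -> dot l v <= `|v|.
Proof.
move=> l1; have [h1 h2 h3] := norm3_ge v.
have b (x y : R) : `|y| <= `|v| -> x * y <= `|x| * `|v|.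
  by move=> yv; apply: le_trans (ler_norm _) _; rewrite normrM ler_wpM2l.
apply: le_trans (_ : (`|l.1.1| + `|l.1.2| + `|l.2|) * `|v| <= _).
  by rewrite !mulrDl !lerD// b.
by rewrite ler_piMl.
Qed.

(** The displacement of the points of X extends to a k-Lipschitz field u on the
    whole space, coordinate by coordinate, and p + c(t) u(p) is an isotopy, where
    c is the projection of the line onto [0, 1]. *)
Lemma isotopic_small (X : set (V * V)) (k : R) : 0 <= k < 1 ->
  (forall a b, X a -> X b ->
     `|(b.2 - b.1) - (a.2 - a.1)| <= k * `|b.1 - a.1|) ->
  isotopic (fst @` X) (snd @` X).
Proof.
move=> k01 Xk; have /andP[k0 k1] := k01.
have ext (pr : V -> R) : (forall v, `|pr v| <= `|v|) -> (forall u v, pr (u - v) = pr u - pr v) ->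
    exists f : V -> R, (forall x y, `|f x - f y| <= k * `|x - y|) /\
      forall a, X a -> f a.1 = pr (a.2 - a.1).
  move=> prn prB.
  have [||f [fk fE]] := @lipschitz_extension _ V [set (a.1, pr (a.2 - a.1)) | a in X] k => //.
    move=> _ _ [a Xa <-] [b Xb <-] /=; rewrite -prB.
    exact: le_trans (prn _) (Xk _ _ Xa Xb).
  exists f; split=> // a Xa; apply: (fE (a.1, pr (a.2 - a.1))); by exists a.
have [f1 [f1k f1E]] := ext (fun v => v.1.1) (fun v => let: And3 h _ _ := norm3_ge v in h) (fun _ _ => erefl).
have [f2 [f2k f2E]] := ext (fun v => v.1.2) (fun v => let: And3 _ h _ := norm3_ge v in h) (fun _ _ => erefl).
have [f3 [f3k f3E]] := ext (fun v => v.2) (fun v => let: And3 _ _ h := norm3_ge v in h) (fun _ _ => erefl).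
pose u p : V := (f1 p, f2 p, f3 p).
have uk x y : `|u x - u y| <= k * `|x - y|.
  by rewrite norm3_le /= f1k f2k f3k.
have uE a : X a -> a.1 + u a.1 = a.2.
  move=> Xa; rewrite /u f1E// f2E// f3E//.
  by case: a {Xa} => -[[a b] c] [[d e] f] /=; congr (_, _, _); rewrite /=; ring.
have uc : continuous u by exact: lipschitz_continuous uk.
pose c (t : R) : R := (`|t| - `|t - 1| + 1) / 2.
have c0 t : t <= 0 -> c t = 0.
  by move=> t0; rewrite /c ler0_norm// ler0_norm; lra.
have c1 t : 1 <= t -> c t = 1.
  by move=> t1; rewrite /c ger0_norm ?ger0_norm; lra.
have c01 t : 0 <= c t <= 1.
  have [t0|t0] := leP t 0; first by rewrite c0// lexx ler01.
  have [t1|t1] := leP 1 t; first by rewrite c1// lexx ler01.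
  by rewrite /c gtr0_norm// ltr0_norm; lra.
have cc : continuous c.
  apply: (@lipschitz_continuous _ _ _ _ 1) => x y; rewrite mul1r /c.
  have := ler_dist_dist x y.
  have := ler_dist_dist (x - 1) (y - 1).
  have -> : x - 1 - (y - 1) = x - y by ring.
  rewrite !ler_norml => /andP[? ?] /andP[? ?]; lra.
exists (fun t p => p + c t *: u p); last first.
  rewrite c1//; apply/seteqP; split=> [_ [_ [a Xa <-] <-]|_ [a Xa <-]].
    by exists a => //; rewrite scale1r uE.
  by exists a.1; [exists a|rewrite scale1r uE].
split.
- move=> q; apply: cvgD; first exact: continuous_snd.
  apply: cvgZ.
    exact: (continuous_o (@continuous_fst _ _) cc).
  exact: (continuous_o (@continuous_snd _ _) uc).
- move=> t; apply: (translated_bijective k01) => x y.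
  have /andP[ct0 ct1] := c01 t.
  rewrite -scalerBr normrZ ger0_norm//; apply: le_trans (uk x y).
  by rewrite ler_piMl.
- by move=> t p t0; rewrite c0// scale0r addr0.
- by move=> t p t1; rewrite !c1.
Qed.

(** The linear form l sees b beyond a, at both ends of the motion, by an amount
    that controls their relative displacement. Since the positions at time s are
    affine in s, the same holds at all times, and the two points never meet. *)
Definition apart (K : R) (a b : V * V) : Prop :=
  exists l : V, [/\ `|l.1.1| + `|l.1.2| + `|l.2| <= 1,
    `|(b.2 - b.1) - (a.2 - a.1)| <= K * dot l (b.1 - a.1) &
    `|(b.2 - b.1) - (a.2 - a.1)| <= K * dot l (b.2 - a.2)].

(** Cut the motion in N > K equal steps. In each of them the distance of two
    points is at least the value of l on their difference, hence at least N / K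
    times their relative displacement. *)
Lemma isotopic_straight (X : set (V * V)) (K : R) : 0 < K ->
  (forall a b, X a -> X b -> apart K a b) -> isotopic (fst @` X) (snd @` X).
Proof.
move=> K0 XK.
pose F (s : R) (a : V * V) : V := a.1 + s *: (a.2 - a.1).
pose N := (Num.truncn K).+1.
have KN : K < N%:R by rewrite /N; exact: truncnS_gt.
have N0 : 0 < N%:R :> R by rewrite ltr0n.
have step (i : nat) : (i <= N)%N ->
    isotopic (fst @` X) (F (i%:R / N%:R) @` X).
  elim: i => [_|i IH iN].
    have -> : F (0%:R / N%:R) = fst.
      by apply/funext => a; rewrite /F mul0r scale0r addr0.
    exact: isotopic_refl.
  apply: isotopic_trans (IH (ltnW iN)) _.
  pose Y := [set (F (i%:R / N%:R) a, F (i.+1%:R / N%:R) a) | a in X].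
  have YE : fst @` Y = F (i%:R / N%:R) @` X /\ snd @` Y = F (i.+1%:R / N%:R) @` X.
    by rewrite /Y !image_comp.
  case: YE => <- <-; apply: (@isotopic_small Y (K / N%:R)).
    by rewrite divr_ge0 ?(ltW K0)//= ltr_pdivrMr// mul1r.
  move=> _ _ [a Xa <-] [b Xb <-] /=.
  have [l [l1 h0 h1]] := XK a b Xa Xb.
  set s := i%:R / N%:R.
  have s01 : 0 <= s <= 1.
    by rewrite /s divr_ge0//= ler_pdivrMr// mul1r ler_nat ltnW.
  have FE c : F (i.+1%:R / N%:R) c - F s c = N%:R^-1 *: (c.2 - c.1).
    rewrite /F /s opprD addrACA subrr add0r -scalerBl -mulrBl -natr1.
    by rewrite [_ + 1]addrC addrK mul1r.
  rewrite !FE -scalerBr normrZ ger0_norm ?invr_ge0// mulrAC mulrC.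
  rewrite ler_wpM2r ?invr_ge0//.
  (* At time s, the value of l is a convex combination of the values at both ends. *)
  have dF : dot l (F s b - F s a) = (1 - s) * dot l (b.1 - a.1) + s * dot l (b.2 - a.2).
    by rewrite /dot /F /= /GRing.scale /=; ring.
  apply: le_trans (_ : K * dot l (F s b - F s a) <= _); last first.
    by rewrite ler_wpM2l ?(ltW K0)// dot_le.
  rewrite dF.
  set D := `|_| in h0 h1 *; have /andP[s0 s1] := s01.
  have -> : D = (1 - s) * D + s * D by ring.
  have -> : K * ((1 - s) * dot l (b.1 - a.1) + s * dot l (b.2 - a.2)) =
     (1 - s) * (K * dot l (b.1 - a.1)) + s * (K * dot l (b.2 - a.2)) by ring.
  by apply: lerD; rewrite ler_wpM2l// subr_ge0.
have := step N (leqnn N); rewrite divff ?gt_eqF//.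
suff -> : F 1 = snd by [].
by apply/funext => a; rewrite /F scale1r addrC subrK.
Qed.

End Straight.

(** * Certificates for straight motions *)

Section Calculus.
Variable R : realType.
Notation V := (R3 R).
Implicit Types (l p q : V) (g h : V * V) (X Y : set (V * V)).

(** A motion is a set of pairs (initial position, final position). In [good], the
    constant is uniform over all pairs of moving points; [sep] is the part of that
    requirement that concerns points of two distinct pieces. *)
Definition good X := exists2 K : R, 0 < K & forall g h, X g -> X h -> apart K g h.
Definition sep X Y := exists2 K : R, 0 < K & forall g h, X g -> Y h -> apart K g h.

(** [apart] without the normalisation of l, which is the form in which linear
    combinations are easy. *)
Definition pc l (K : R) g h : Prop :=
  `|(h.2 - h.1) - (g.2 - g.1)| <= K * dot l (h.1 - g.1) /\
  `|(h.2 - h.1) - (g.2 - g.1)| <= K * dot l (h.2 - g.2).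

Lemma dotB l p q : dot l (p - q) = dot l p - dot l q.
Proof. by rewrite /dot /=; ring. Qed.

Lemma pc_ge0 l (K : R) g h : 0 < K -> pc l K g h ->
  0 <= dot l (h.1 - g.1) /\ 0 <= dot l (h.2 - g.2).
Proof.
move=> K0 [h1 h2]; split.
  by rewrite -(pmulr_rge0 _ K0) (le_trans _ h1).
by rewrite -(pmulr_rge0 _ K0) (le_trans _ h2).
Qed.

Lemma pc_le l (K K' : R) g h : 0 < K -> K <= K' -> pc l K g h -> pc l K' g h.
Proof.
move=> K0 KK gh; have [h1 h2] := pc_ge0 K0 gh; case: gh => g1 g2.
by split; [apply: le_trans g1 _|apply: le_trans g2 _]; apply: ler_wpM2r.
Qed.

Lemma pc_apart l (K : R) g h : 0 < K -> pc l K g h ->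
  apart (K * (1 + (`|l.1.1| + `|l.1.2| + `|l.2|))) g h.
Proof.
move=> K0 [h1 h2]; set n := _ + `|l.2|.
have n0 : 0 <= n by rewrite /n !addr_ge0.
have M0 : 0 < 1 + n by lra.
pose i := (1 + n)^-1.
have i0 : 0 <= i by rewrite invr_ge0 ltW.
exists (i * l.1.1, i * l.1.2, i * l.2).
have dE v : dot (i * l.1.1, i * l.1.2, i * l.2) v = i * dot l v.
  by rewrite /dot /=; ring.
split=> /=.
- by rewrite !normrM (ger0_norm i0) -!mulrDr -/n mulrC ler_pdivrMr// mul1r; lra.
- by rewrite dE -mulrA [X in _ <= K * X]mulrA divff ?gt_eqF// mul1r.
- by rewrite dE -mulrA [X in _ <= K * X]mulrA divff ?gt_eqF// mul1r.
Qed.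

Lemma apart_sym (K : R) g h : apart K g h -> apart K h g.
Proof.
move=> [l [l1 h1 h2]]; exists (- l); split; rewrite /= ?normrN//.
  by rewrite distrC (_ : dot _ _ = dot l (h.1 - g.1))// /dot /=; ring.
by rewrite distrC (_ : dot _ _ = dot l (h.2 - g.2))// /dot /=; ring.
Qed.

Lemma apart_le (K K' : R) g h : 0 < K -> K <= K' -> apart K g h -> apart K' g h.
Proof.
move=> K0 KK [l [l1 h1 h2]]; exists l; split=> //.
  by have [] := @pc_le l K K' g h K0 KK (conj h1 h2).
by have [] := @pc_le l K K' g h K0 KK (conj h1 h2).
Qed.

Lemma sep_pc X Y l (K : R) : 0 < K ->
  (forall g h, X g -> Y h -> pc l K g h) -> sep X Y.
Proof.
move=> K0 H; eexists; last by move=> g h Xg Yh; apply: pc_apart K0 (H _ _ Xg Yh).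
by rewrite mulr_gt0// ltr_pwDl// !addr_ge0.
Qed.

Lemma sep_sym X Y : sep X Y -> sep Y X.
Proof. by move=> [K K0 H]; exists K => // g h Yg Xh; apply/apart_sym/H. Qed.

Lemma sepUl X X' Y : sep X Y -> sep X' Y -> sep (X `|` X') Y.
Proof.
move=> [K K0 H] [K' K'0 H']; exists (K + K'); first exact: addr_gt0.
move=> g h [Xg|Xg] Yh.
  by apply: apart_le (H _ _ Xg Yh) => //; rewrite lerDl ltW.
by apply: apart_le (H' _ _ Xg Yh) => //; rewrite lerDr ltW.
Qed.

Lemma sepUr X Y Y' : sep X Y -> sep X Y' -> sep X (Y `|` Y').
Proof. by move=> /sep_sym h /sep_sym h'; apply/sep_sym/sepUl. Qed.

Lemma goodU X Y : good X -> good Y -> sep X Y -> good (X `|` Y).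
Proof.
move=> [K K0 H] [K' K'0 H'] [L L0 S]; exists (K + K' + L).
  by rewrite !addr_gt0.
have le1 : K <= K + K' + L by lra.
have le2 : K' <= K + K' + L by lra.
have le3 : L <= K + K' + L by lra.
move=> g h [Xg|Yg] [Xh|Yh].
- exact: apart_le (H _ _ Xg Xh).
- exact: apart_le (S _ _ Xg Yh).
- exact/apart_sym/(apart_le L0 le3 (S _ _ Xh Yg)).
- exact: apart_le (H' _ _ Yg Yh).
Qed.

Lemma good0 : good set0. Proof. by exists 1. Qed.
Lemma sep0l X : sep set0 X. Proof. by exists 1. Qed.

(** A straight motion run backwards is a straight motion, so that both directions
    come for free and no inverse of an isotopy has to be constructed. *)
Definition equivalent (A B : set V) : Prop := isotopic A B /\ isotopic B A.

Lemma equivalent_refl (A : set V) : equivalent A A.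
Proof. by split; exact: isotopic_refl. Qed.

Lemma equivalent_sym (A B : set V) : equivalent A B -> equivalent B A.
Proof. by case. Qed.

Lemma equivalent_trans (A B C : set V) :
  equivalent A B -> equivalent B C -> equivalent A C.
Proof.
by move=> [ab ba] [bc cb]; split; [exact: isotopic_trans bc|exact: isotopic_trans ba].
Qed.

Lemma equivalent_homeomorphism (h : V -> V) (A B : set V) :
  homeomorphism h -> equivalent A B -> equivalent (h @` A) (h @` B).
Proof. by move=> hh [ab ba]; split; exact: isotopic_homeomorphism. Qed.

Lemma equivalent_good X : good X -> equivalent (fst @` X) (snd @` X).
Proof.
move=> [K K0 H]; split; first exact: isotopic_straight K0 H.
pose Y := (fun g => (g.2, g.1)) @` X.
have -> : fst @` X = snd @` Y by rewrite /Y image_comp.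
have -> : snd @` X = fst @` Y by rewrite /Y image_comp.
apply: (isotopic_straight K0) => _ _ [g Xg <-] [h Xh <-] /=.
have [l [l1 h1 h2]] := H g h Xg Xh; exists l.
have -> : h.1 - h.2 - (g.1 - g.2) = - (h.2 - h.1 - (g.2 - g.1)).
  by rewrite -[h.1 - h.2]opprB -[g.1 - g.2]opprB opprK [RHS]opprB addrC.
by rewrite normrN.
Qed.

(** Serves to carry along tangles and other sets of unknown shape. *)
Definition rigid (A : set V) (v : V) : set (V * V) := [set (p, p + v) | p in A].

Lemma rigid_fst (A : set V) v : fst @` rigid A v = A.
Proof. by rewrite /rigid image_comp image_id. Qed.

Lemma rigid_snd (A : set V) v : snd @` rigid A v = (fun p => p + v) @` A.
Proof. by rewrite /rigid image_comp. Qed.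

Lemma sep_rigid_same (A B : set V) v : sep (rigid A v) (rigid B v).
Proof.
apply: (@sep_pc _ _ 0 1 ltr01) => _ _ [p Ap <-] [q Bq <-]; rewrite /pc /=.
have -> : q + v - q - (p + v - p) = 0 by rewrite ![_ + v]addrC !addrK subrr.
by split; rewrite normr0 /dot /= !mul0r !addr0 mulr0.
Qed.

Lemma good_rigid (A : set V) v : good (rigid A v).
Proof. exact: sep_rigid_same. Qed.

Definition comb (t : R) (p q : V) : V :=
  ((1 - t) * p.1.1 + t * q.1.1, (1 - t) * p.1.2 + t * q.1.2,
   (1 - t) * p.2 + t * q.2).
Definition hcomb t g h : V * V := (comb t g.1 h.1, comb t g.2 h.2).

Lemma pc_sym l (K : R) g h : pc l K g h -> pc (- l) K h g.
Proof.
move=> [h1 h2]; split; rewrite distrC.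
  by rewrite (_ : dot _ _ = dot l (h.1 - g.1))// /dot /=; ring.
by rewrite (_ : dot _ _ = dot l (h.2 - g.2))// /dot /=; ring.
Qed.

Lemma pc_comb l (K t : R) g h y : 0 <= t <= 1 -> pc l K g y -> pc l K h y ->
  pc l K (hcomb t g h) y.
Proof.
move=> /andP[t0 t1] [g1 g2] [h1 h2].
rewrite /pc; set N := `|y.2 - y.1 - _|.
have Nle : N <= (1 - t) * `|y.2 - y.1 - (g.2 - g.1)| + t * `|y.2 - y.1 - (h.2 - h.1)|.
  rewrite -[1 - t]ger0_norm ?subr_ge0// -{2}[t]ger0_norm// -!normrZ.
  apply: le_trans (ler_normD _ _); rewrite /N le_eqVlt; apply/orP; left; apply/eqP.
  congr `| _ |; move: g h y {g1 g2 h1 h2 N} => [[[a b] c] [[d e] f]] [[[a' b'] c'] [[d' e'] f']] [[[a'' b''] c''] [[d'' e''] f'']].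
  by congr (_, _, _); rewrite /= /GRing.scale /=; ring.
have E i : dot l (i - comb t g.1 h.1) = (1 - t) * dot l (i - g.1) + t * dot l (i - h.1).
  by rewrite /dot /=; ring.
have E' i : dot l (i - comb t g.2 h.2) = (1 - t) * dot l (i - g.2) + t * dot l (i - h.2).
  by rewrite /dot /=; ring.
have t1' : 0 <= 1 - t by rewrite subr_ge0.
have fin A B C D : A <= K * C -> B <= K * D -> (1 - t) * A + t * B <= K * ((1 - t) * C + t * D).
  move=> AC BD; rewrite mulrDr ![K * _]mulrCA.
  by apply: lerD; apply: ler_wpM2l.
by split; apply: le_trans Nle _ => /=; rewrite ?E ?E'; apply: fin.
Qed.

(** A segment whose ends move on straight lines. *)
Definition hseg g h : set (V * V) := [set hcomb t g h | t in [set t | 0 <= t <= 1]].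

Lemma hseg_fst g h : fst @` hseg g h = segment g.1 h.1.
Proof.
rewrite /hseg image_comp; apply/seteqP; split=> [_ [t t01 <-]|_ [t t01 ->]].
  by exists t.
by exists t.
Qed.

Lemma hseg_snd g h : snd @` hseg g h = segment g.2 h.2.
Proof.
rewrite /hseg image_comp; apply/seteqP; split=> [_ [t t01 <-]|_ [t t01 ->]].
  by exists t.
by exists t.
Qed.

(** The condition that is actually checked on pairs of vertices: l separates them
    strictly at both ends of the motion, or they do not move relative to each
    other, as when they coincide. *)
Definition ok l g h : Prop :=
  (0 < dot l (h.1 - g.1) /\ 0 < dot l (h.2 - g.2)) \/
  [/\ h.2 - h.1 = g.2 - g.1, 0 <= dot l (h.1 - g.1) & 0 <= dot l (h.2 - g.2)].

Lemma ok_pc l g h : ok l g h -> exists2 K : R, 0 < K & pc l K g h.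
Proof.
case=> [[d1 d2]|[e d1 d2]]; last first.
  by exists 1 => //; rewrite /pc e subrr normr0 !mul1r.
set D := `|(h.2 - h.1) - (g.2 - g.1)|.
have a1 : 0 <= D / dot l (h.1 - g.1) by rewrite divr_ge0 ?normr_ge0// ltW.
have a2 : 0 <= D / dot l (h.2 - g.2) by rewrite divr_ge0 ?normr_ge0// ltW.
exists (1 + D / dot l (h.1 - g.1) + D / dot l (h.2 - g.2)); first lra.
split; rewrite -/D -ler_pdivrMr//; lra.
Qed.

Lemma uniformK (T : Type) (s : seq T) (P : T -> R -> Prop) :
  (forall x K K', 0 < K -> K <= K' -> P x K -> P x K') ->
  (forall x, List.In x s -> exists2 K, 0 < K & P x K) ->
  exists2 K, 0 < K & forall x, List.In x s -> P x K.
Proof.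
move=> mono; elim: s => [|x s IH] H; first by exists 1.
have [K K0 PK] := H x (or_introl erefl).
have [K' K'0 PK'] := IH (fun y ys => H y (or_intror ys)).
exists (K + K'); first exact: addr_gt0.
move=> y [<-|ys]; first by apply: mono PK => //; rewrite lerDl ltW.
by apply: mono (PK' y ys) => //; rewrite lerDr ltW.
Qed.

(** For fixed l, K and y, the condition [pc] is convex in the moving point; this is
    what is used of the fact that X lies in the convex hull of vs. *)
Definition spanned (vs : seq (V * V)) X : Prop := forall l (K : R) y,
  (forall g, List.In g vs -> pc l K g y) -> forall g, X g -> pc l K g y.

Lemma spanned_hseg g h : spanned [:: g; h] (hseg g h).
Proof.
by move=> l K y H _ [t t01 <-]; apply: pc_comb => //; apply: H; [left|right; left].
Qed.

Lemma sep_spanned vs X ws Y l : spanned vs X -> spanned ws Y ->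
  (forall g h, List.In g vs -> List.In h ws -> ok l g h) -> sep X Y.
Proof.
move=> sX sY H.
have [K K0 HK] : exists2 K : R, 0 < K & forall g, List.In g vs ->
    forall h, List.In h ws -> pc l K g h.
  apply: (uniformK (P := fun g K => forall h, List.In h ws -> pc l K g h)).
    by move=> g K K' K0 KK gh h /gh; exact: pc_le.
  move=> g gv; apply: (uniformK (P := fun h K => pc l K g h)).
    by move=> h K K' K0 KK; exact: pc_le.
  by move=> h hw; apply/ok_pc/H.
apply: (sep_pc K0) => g h Xg Yh; apply: (sX l K h _ g Xg) => g' g'v.
rewrite -[l]opprK; apply: pc_sym; apply: (sY (- l) K g' _ h Yh) => h' h'w.
exact/pc_sym/HK.
Qed.

(** On one moving segment, the points are ordered by l. *)
Lemma good_hseg l g h : ok l g h -> good (hseg g h).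
Proof.
move=> /ok_pc[K K0 [p1 p2]].
have up s t : 0 <= s -> s <= t -> t <= 1 -> pc l K (hcomb s g h) (hcomb t g h).
  move=> s0 st t1; have st0 : 0 <= t - s by rewrite subr_ge0.
  have E (a b : V) : comb t a b - comb s a b = (t - s) *: (b - a).
    by congr (_, _, _); rewrite /= /GRing.scale /=; ring.
  have dE v : dot l ((t - s) *: v) = (t - s) * dot l v.
    by rewrite /dot /= /GRing.scale /=; ring.
  rewrite /pc /=.
  have -> : comb t g.2 h.2 - comb t g.1 h.1 - (comb s g.2 h.2 - comb s g.1 h.1) =
     (t - s) *: (h.2 - h.1 - (g.2 - g.1)).
    by congr (_, _, _); rewrite /= /GRing.scale /=; ring.
  by rewrite !E !dE normrZ ger0_norm// ![K * _]mulrCA; split; apply: ler_wpM2l.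
eexists; last first.
  move=> _ _ [s /andP[s0 s1] <-] [t /andP[t0 t1] <-].
  have [st|ts] := leP s t; first exact: pc_apart K0 (up _ _ s0 st t1).
  exact/apart_sym/(pc_apart K0 (up _ _ t0 (ltW ts) s1)).
by rewrite mulr_gt0// ltr_pwDl// !addr_ge0.
Qed.

(** Everything on one side of a plane may be translated along with the plane. *)
Lemma sep_rigid_spanned vs X (A : set V) l v (c : R) :
  spanned vs X -> (forall p, A p -> dot l p <= c) ->
  (forall g, List.In g vs ->
     (c < dot l g.1 /\ c + dot l v < dot l g.2) \/
     [/\ g.2 - g.1 = v, c <= dot l g.1 & c + dot l v <= dot l g.2]) ->
  sep (rigid A v) X.
Proof.
move=> sX Ac H.
have [K K0 HK] : exists2 K : R, 0 < K & forall g, List.In g vs ->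
    forall p, A p -> pc l K (p, p + v) g.
  apply: (uniformK (P := fun g K => forall p, A p -> pc l K (p, p + v) g)).
    by move=> g K K' K0 KK gh h /gh; exact: pc_le.
  move=> g /H[[d1 d2]|[e d1 d2]]; last first.
    exists 1 => // p /Ac Ap; rewrite /pc /= e [p + v]addrC addrK subrr normr0 !mul1r !dotB.
    have -> : dot l (v + p) = dot l v + dot l p by rewrite /dot /=; ring.
    by split; lra.
  set D := `|g.2 - g.1 - v|.
  have d1' : 0 < dot l g.1 - c by rewrite subr_gt0.
  have d2' : 0 < dot l g.2 - (c + dot l v) by rewrite subr_gt0.
  have a1 : 0 <= D / (dot l g.1 - c) by rewrite divr_ge0 ?normr_ge0// ltW.
  have a2 : 0 <= D / (dot l g.2 - (c + dot l v)) by rewrite divr_ge0 ?normr_ge0// ltW.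
  (* One term is needed before the motion, one after it, and 1 makes the sum positive. *)
  exists (1 + D / (dot l g.1 - c) + D / (dot l g.2 - (c + dot l v))); first lra.
  move=> p /Ac Ap; rewrite /pc /= [p + v]addrC addrK -/D !dotB.
  have -> : dot l (v + p) = dot l v + dot l p by rewrite /dot /=; ring.
  have K0 : 0 <= 1 + D / (dot l g.1 - c) + D / (dot l g.2 - (c + dot l v)) by lra.
  split.
    apply: le_trans (_ : (1 + D / (dot l g.1 - c) + D / (dot l g.2 - (c + dot l v))) * (dot l g.1 - c) <= _).
      by rewrite -ler_pdivrMr//; lra.
    by apply: ler_wpM2l => //; lra.
  apply: le_trans (_ : (1 + D / (dot l g.1 - c) + D / (dot l g.2 - (c + dot l v))) * (dot l g.2 - (c + dot l v)) <= _).
    by rewrite -ler_pdivrMr//; lra.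
  by apply: ler_wpM2l => //; lra.
apply: (@sep_pc _ _ l K K0) => _ h [p Ap <-] Xh.
rewrite -[l]opprK; apply: pc_sym; apply: (sX (- l) K _ _ h Xh) => h' h'w.
exact/pc_sym/HK.
Qed.

End Calculus.

(** * A decision procedure for the certificates *)

(** The triple (k, i, j) stands for the real number (k + i a + j b) / 48, where a
    and b are parameters, at least 1: the radii of the tangles that are carried
    along. The coordinates met below are multiples of 1/48. *)
Definition lform : Type := (Z * Z * Z)%type.
Definition fadd (f g : lform) : lform :=
  (Z.add f.1.1 g.1.1, Z.add f.1.2 g.1.2, Z.add f.2 g.2).
Definition fsub (f g : lform) : lform :=
  (Z.sub f.1.1 g.1.1, Z.sub f.1.2 g.1.2, Z.sub f.2 g.2).
Definition fscale (k : Z) (f : lform) : lform :=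
  (Z.mul k f.1.1, Z.mul k f.1.2, Z.mul k f.2).
(** Sufficient for being positive for all a, b >= 1. *)
Definition fpos (f : lform) : bool :=
  [&& Z.ltb 0 (Z.add f.1.1 (Z.add f.1.2 f.2)), Z.leb 0 f.1.2 & Z.leb 0 f.2].
Definition fnneg (f : lform) : bool :=
  [&& Z.leb 0 (Z.add f.1.1 (Z.add f.1.2 f.2)), Z.leb 0 f.1.2 & Z.leb 0 f.2].
Definition fconst (k : Z) : lform := (k, Z0, Z0).

Definition fpt : Type := (lform * lform * lform)%type.
Definition psub (p q : fpt) : fpt :=
  (fsub p.1.1 q.1.1, fsub p.1.2 q.1.2, fsub p.2 q.2).
Definition padd (p q : fpt) : fpt :=
  (fadd p.1.1 q.1.1, fadd p.1.2 q.1.2, fadd p.2 q.2).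
Definition pscale (k : Z) (p : fpt) : fpt :=
  (fscale k p.1.1, fscale k p.1.2, fscale k p.2).
Definition fdot (l : Z * Z * Z) (p : fpt) : lform :=
  fadd (fscale l.1.1 p.1.1) (fadd (fscale l.1.2 p.1.2) (fscale l.2 p.2)).

(** A vertex at the beginning and at the end of a motion. *)
Definition hvert : Type := (fpt * fpt)%type.

Definition okb (l : Z * Z * Z) (g h : hvert) : bool :=
  let d1 := psub h.1 g.1 in let d2 := psub h.2 g.2 in
  let e1 := fdot l d1 in let e2 := fdot l d2 in
  (fpos e1 && fpos e2) || [&& d1 == d2, fnneg e1 & fnneg e2].

(** One of the linear forms in ls separates the convex hulls of c and d. *)
Definition sepb (ls : seq (Z * Z * Z)) (c d : seq hvert) : bool :=
  has (fun l => all (fun g => all (okb l g) d) c) ls ||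
  has (fun l => all (fun h => all (okb l h) c) d) ls.

Definition steps (T : Type) (s : seq T) : seq (T * T) := zip s (behead s).

(** A tangle of radius r, of which only the box that contains it is known. *)
Definition box : Type := (fpt * lform)%type.

Definition corner (r : lform) (k : bool * bool * bool) : fpt :=
  (if k.1.1 then r else fscale (-1) r, if k.1.2 then r else fscale (-1) r,
   fconst (if k.2 then 48 else -48)).

Definition cube : seq (bool * bool * bool) :=
  [:: (false, false, false); (false, false, true);
      (false, true, false); (false, true, true);
      (true, false, false); (true, false, true);
      (true, true, false); (true, true, true)].

Definition box_corners (b : fpt * fpt * lform) : seq hvert :=
  [seq (padd b.1.1 (corner b.2 k), padd b.1.2 (corner b.2 k)) | k <- cube].

Definition edge_cell (e : hvert * hvert) : seq hvert := [:: e.1; e.2].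

(** A straight motion of polygonal strands and of boxes. Everything beyond the
    vertical plane at abscissa [wall] is translated with that plane. *)
Record stage := Stage { wall : lform * lform; boxes : seq (fpt * fpt * lform);
  moves : seq (seq hvert) }.

Definition stage_edges (s : stage) : seq (hvert * hvert) :=
  flatten [seq steps m | m <- moves s].

Definition stage_cells (s : stage) : seq (seq hvert) :=
  [seq edge_cell e | e <- stage_edges s] ++ [seq box_corners b | b <- boxes s].

(** The vertex stays to the right of the plane at abscissa xl, on the left of which
    nothing moves. *)
Definition left_ok (xl : lform) (g : hvert) : bool :=
  let a := fsub g.1.1.1 xl in let b := fsub g.2.1.1 xl in
  (fpos a && fpos b) || [&& g.1 == g.2, fnneg a & fnneg b].

Definition right_ok (w : lform * lform) (g : hvert) : bool :=
  let a := fsub w.1 g.1.1.1 in let b := fsub w.2 g.2.1.1 in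
  (fpos a && fpos b) ||
  [&& psub g.2 g.1 == (fsub w.2 w.1, fconst 0, fconst 0), fnneg a & fnneg b].

Definition stage_ok (ls : seq (Z * Z * Z)) (xl : lform) (s : stage) : bool :=
  [&& all (fun c => all (fun g => left_ok xl g && right_ok (wall s) g) c) (stage_cells s),
      all (fun e => sepb ls [:: e.1] [:: e.2]) (stage_edges s),
      all (fun b => fpos b.2) (boxes s),
      pairwise (sepb ls) (stage_cells s),
      fpos (fsub (wall s).1 xl) & fpos (fsub (wall s).2 xl)].

Section Soundness.
Variables (R : realType) (a b : R).
Hypotheses (a1 : 1 <= a) (b1 : 1 <= b).
Notation V := (R3 R).

Definition zr (z : Z) : R := (int_of_Z z)%:~R.

Lemma zrD x y : zr (Z.add x y) = zr x + zr y.
Proof. by rewrite /zr -intrD -rmorphD. Qed.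
Lemma zrM x y : zr (Z.mul x y) = zr x * zr y.
Proof. by rewrite /zr -intrM -rmorphM. Qed.
Lemma zrB x y : zr (Z.sub x y) = zr x - zr y.
Proof. by rewrite /zr -intrB -rmorphB. Qed.
Lemma zr_ge0 x : Z.leb 0 x -> 0 <= zr x.
Proof. by move=> h; rewrite /zr ler0z; lia. Qed.
Lemma zr_gt0 x : Z.ltb 0 x -> 0 < zr x.
Proof. by move=> h; rewrite /zr ltr0z; lia. Qed.

Definition ev (f : lform) : R := (zr f.1.1 + zr f.1.2 * a + zr f.2 * b) / 48.
Definition evp (p : fpt) : V := (ev p.1.1, ev p.1.2, ev p.2).
Definition evh (g : hvert) : V * V := (evp g.1, evp g.2).
Definition evl (l : Z * Z * Z) : V := (zr l.1.1, zr l.1.2, zr l.2).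

Lemma evD f g : ev (fadd f g) = ev f + ev g.
Proof. by rewrite /ev /= !zrD; ring. Qed.
Lemma evB f g : ev (fsub f g) = ev f - ev g.
Proof. by rewrite /ev /= !zrB; ring. Qed.
Lemma evZ k f : ev (fscale k f) = zr k * ev f.
Proof. by rewrite /ev /= !zrM; ring. Qed.
Lemma evpB p q : evp (psub p q) = evp p - evp q.
Proof. by rewrite /evp /= !evB. Qed.
Lemma evpD p q : evp (padd p q) = evp p + evp q.
Proof. by rewrite /evp /= !evD. Qed.
Lemma ev_dot l p : ev (fdot l p) = dot (evl l) (evp p).
Proof. by rewrite /fdot !evD !evZ /dot /= addrA. Qed.

Lemma ev_gt0 f : fpos f -> 0 < ev f.
Proof.
move=> /and3P[/zr_gt0 + /zr_ge0 h2 /zr_ge0 h3]; rewrite !zrD => h1.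
rewrite /ev divr_gt0//.
have : zr f.1.2 <= zr f.1.2 * a by rewrite ler_peMr.
have : zr f.2 <= zr f.2 * b by rewrite ler_peMr.
by lra.
Qed.

Lemma ev_ge0 f : fnneg f -> 0 <= ev f.
Proof.
move=> /and3P[/zr_ge0 + /zr_ge0 h2 /zr_ge0 h3]; rewrite !zrD => h1.
rewrite /ev divr_ge0//.
have : zr f.1.2 <= zr f.1.2 * a by rewrite ler_peMr.
have : zr f.2 <= zr f.2 * b by rewrite ler_peMr.
by lra.
Qed.

Lemma ev_const k : ev (fconst k) = zr k / 48.
Proof. by rewrite /ev /= /zr /= !mul0r !addr0. Qed.

Lemma okbP l g h : okb l g h -> ok (evl l) (evh g) (evh h).
Proof.
move=> /orP[/andP[/ev_gt0 h1 /ev_gt0 h2]|/and3P[/eqP e /ev_ge0 h1 /ev_ge0 h2]].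
  by left; rewrite /= -!evpB -!ev_dot.
right; rewrite /= -!evpB -!ev_dot; split=> //.
have : evp (psub h.1 g.1) = evp (psub h.2 g.2) by rewrite e.
rewrite !evpB => {}e; have -> : evp h.2 = evp h.1 - evp g.1 + evp g.2 by rewrite e subrK.
by rewrite addrAC [_ - evp g.1]addrC addrK addrC.
Qed.

Lemma all_In (T : Type) (p : pred T) (s : seq T) x : all p s -> List.In x s -> p x.
Proof. by elim: s => //= y s IH /andP[py ps] [<- //|]; exact: IH. Qed.

Lemma In_map (T U : Type) (f : T -> U) (s : seq T) y :
  List.In y (map f s) -> exists2 x, List.In x s & y = f x.
Proof.
elim: s => //= x s IH [<-|/IH[z zs ->]]; first by exists x => //; left.
by exists z => //; right.
Qed.

Lemma sepbP ls c d X Y : sepb ls c d ->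
  spanned (map evh c) X -> spanned (map evh d) Y -> sep X Y.
Proof.
move=> /orP[] /hasP[l _ H] sX sY.
  apply: (@sep_spanned _ _ _ _ _ (evl l) sX sY) => g' h'.
  move=> g'c h'd; have [g gc ->] := In_map g'c; have [h hd ->] := In_map h'd.
  by apply: okbP; apply: all_In hd; apply: (all_In H gc).
apply/sep_sym/(@sep_spanned _ _ _ _ _ (evl l) sY sX) => g' h'.
move=> g'c h'd; have [g gc ->] := In_map g'c; have [h hd ->] := In_map h'd.
by apply: okbP; apply: all_In hd; apply: (all_In H gc).
Qed.

Lemma sepb_self ls g h : sepb ls [:: g] [:: h] -> good (hseg (evh g) (evh h)).
Proof.
have flip (m : V) g' h' : ok m g' h' -> ok (- m) h' g'.
  have E p q : dot (- m) (p - q) = dot m (q - p) by rewrite /dot /=; ring.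
  by case=> [[d1 d2]|[e d1 d2]]; [left|right]; rewrite !E.
move=> /orP[] /hasP[l _]; rewrite /= !andbT => /okbP k.
  exact: good_hseg k.
by apply: (@good_hseg _ (- evl l)); apply: flip.
Qed.

Definition in_box (r : R) (A : set V) : Prop :=
  forall p, A p -> [/\ - r <= p.1.1 <= r, - r <= p.1.2 <= r & -1 <= p.2 <= 1].

Lemma spanned_box c d r A : 0 < ev r -> in_box (ev r) A ->
  spanned (map evh (box_corners (c, d, r)))
    (rigid ((fun q => q + evp c) @` A) (evp d - evp c)).
Proof.
move=> r0 Ar l K y H _ [_ [q Aq <-] <-].
have [qx qy qz] := Ar _ Aq.
have t01 (x s : R) : 0 < s -> - s <= x <= s -> 0 <= (x + s) / (2 * s) <= 1.
  move=> s0 /andP[xs sx]; rewrite divr_ge0 ?ler_pdivrMr//=; lra.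
pose tx := (q.1.1 + ev r) / (2 * ev r); have tx1 := t01 _ _ r0 qx.
pose ty := (q.1.2 + ev r) / (2 * ev r); have ty1 := t01 _ _ r0 qy.
pose tz := (q.2 + 1) / (2 * 1); have tz1 := t01 _ _ (@ltr01 R) qz.
pose k x y z := evh (padd c (corner r (x, y, z)), padd d (corner r (x, y, z))).
have Hk x z w : pc l K (k x z w) y.
  by apply: H; rewrite /k; case: x z w => [] [] [] /=; tauto.
have -> : (q + evp c, q + evp c + (evp d - evp c)) =
  hcomb tx (hcomb ty (hcomb tz (k false false false) (k false false true))
                     (hcomb tz (k false true false) (k false true true)))
           (hcomb ty (hcomb tz (k true false false) (k true false true))
                     (hcomb tz (k true true false) (k true true true))).
  have e1 : zr (-1) = - 1 by [].
  have e2 : zr 48 / 48 = 1 by rewrite divff// pnatr_eq0.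
  have e3 : zr (-48) / 48 = - 1 by rewrite (_ : zr (-48) = - 48)// mulNr divff// pnatr_eq0.
  have cc (t v : R) : (1 - t) * v + t * v = v by rewrite -mulrDl subrK mul1r.
  have lin (x s e : R) : 0 < s ->
      (1 - (x + s) / (2 * s)) * (e + -1 * s) + (x + s) / (2 * s) * (e + s) = x + e.
    by move=> s0; field; rewrite gt_eqF.
  rewrite /hcomb /comb /k /evh /evp /= !evD !evZ !ev_const e1 e2 e3 !cc !lin//.
  have lz e : (1 - tz) * (e - 1) + tz * (e + 1) = q.2 + e.
    by rewrite /tz; field.
  rewrite !lz; case: q Aq {qx qy qz tx ty tz tx1 ty1 tz1 lz H k Hk} => [[q1 q2] q3] _.
  by congr ((_, _, _), (_, _, _)) => /=; ring.
move: k Hk => k Hk.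
by apply: pc_comb => //; apply: pc_comb => //; apply: pc_comb.
Qed.

End Soundness.

Section Soundness.
Variables (R : realType) (a b : R).
Hypotheses (a1 : 1 <= a) (b1 : 1 <= b).
Notation V := (R3 R).
Local Notation ev := (ev a b).
Local Notation evp := (evp a b).
Local Notation evh := (evh a b).

Definition moved (v : V) (A : set V) : set V := (fun p => p + v) @` A.

(** The union of the edges in E, once values are given to the parameters. *)
Definition flink (E : seq (fpt * fpt)) : set V :=
  foldr (fun e A => segment (evp e.1) (evp e.2) `|` A) set0 E.

Definition place (cs : seq (set V)) (ps : seq fpt) : set V :=
  foldr (fun cp A => moved (evp cp.2) cp.1 `|` A) set0 (zip cs ps).

Definition fits (cs : seq (set V)) (bs : seq box) : Prop :=
  size cs = size bs /\ forall x, List.In x (zip cs bs) -> in_box (ev x.2.2) x.1.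

Definition union (T : Type) (s : seq (T * set (V * V))) : set (V * V) :=
  foldr (fun x A => x.2 `|` A) set0 s.

Lemma good_union ls (s : seq (seq hvert * set (V * V))) :
  (forall x, List.In x s -> spanned (map evh x.1) x.2 /\ good x.2) ->
  pairwise (sepb ls) (map fst s) -> good (union s).
Proof.
elim: s => [_ _|x s IH H /=]; first exact: good0.
move=> /andP[xs ps]; have [sx gx] := H x (or_introl erefl).
have Hs y : List.In y s -> spanned (map evh y.1) y.2 /\ good y.2 by move=> ys; apply: H; right.
apply: goodU => //; first exact: IH.
elim: s xs Hs {IH ps H} => [_ _|y s IH /= /andP[xy xs] Hs]; first exact/sep_sym/sep0l.
apply: sepUr; last by apply: IH => // z zs; apply: Hs; right.
by apply: (sepbP a1 b1 xy sx); have [] := Hs y (or_introl erefl).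
Qed.

Definition edge_pieces (E : seq (hvert * hvert)) : seq (seq hvert * set (V * V)) :=
  [seq (edge_cell e, hseg (evh e.1) (evh e.2)) | e <- E].

Definition box_pieces (cs : seq (set V)) (bs : seq (fpt * fpt * lform)) :
    seq (seq hvert * set (V * V)) :=
  [seq (box_corners cb.2,
        rigid (moved (evp cb.2.1.1) cb.1) (evp cb.2.1.2 - evp cb.2.1.1)) | cb <- zip cs bs].

Lemma union_cat (T : Type) (s t : seq (T * set (V * V))) :
  union (s ++ t) = union s `|` union t.
Proof. by elim: s => [|x s IH] /=; rewrite ?set0U// IH setUA. Qed.

Lemma edge_pieces_fst E : fst @` union (edge_pieces E) = flink [seq (e.1.1, e.2.1) | e <- E].
Proof. by elim: E => [|e E IH] /=; rewrite ?image_set0// image_setU hseg_fst IH. Qed.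

Lemma edge_pieces_snd E : snd @` union (edge_pieces E) = flink [seq (e.1.2, e.2.2) | e <- E].
Proof. by elim: E => [|e E IH] /=; rewrite ?image_set0// image_setU hseg_snd IH. Qed.

Lemma moved_moved u v A : moved u (moved v A) = moved (v + u) A.
Proof. by rewrite /moved image_comp; congr (_ @` _); apply/funext => p /=; rewrite addrA. Qed.

Lemma box_pieces_fst cs bs :
  fst @` union (box_pieces cs bs) = place cs [seq b.1.1 | b <- bs].
Proof.
rewrite /place; elim: cs bs => [|c cs IH] [|x bs] /=; rewrite ?image_set0//.
by rewrite image_setU rigid_fst IH.
Qed.

Lemma box_pieces_snd cs bs :
  snd @` union (box_pieces cs bs) = place cs [seq b.1.2 | b <- bs].
Proof.
rewrite /place; elim: cs bs => [|c cs IH] [|x bs] /=; rewrite ?image_set0//.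
by rewrite image_setU rigid_snd IH -/(moved _ _) moved_moved addrC subrK.
Qed.

(** What is not mentioned in the certificates: Kl, which does not move, Kr, attached
    to the wall, and the contents cs of the boxes. *)
Definition ctx (Kl Kr : set V) (cs : seq (set V)) (w : lform) (ps : seq fpt)
    (E : seq (fpt * fpt)) : set V :=
  Kl `|` (moved (ev w, 0, 0) Kr `|` (flink E `|` place cs ps)).

(** The union of the cells, of the translated half-spaces and of the boxes is a
    [good] motion, since any two of them are separated by a linear form. *)
Lemma stage_sound ls xl s Kl Kr cs :
  (forall p, Kl p -> p.1.1 <= ev xl) -> (forall p, Kr p -> 0 <= p.1.1) ->
  fits cs [seq (b.1.1, b.2) | b <- boxes s] -> stage_ok ls xl s ->
  equivalent
    (ctx Kl Kr cs (wall s).1 [seq b.1.1 | b <- boxes s] [seq (e.1.1, e.2.1) | e <- stage_edges s])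
    (ctx Kl Kr cs (wall s).2 [seq b.1.2 | b <- boxes s] [seq (e.1.2, e.2.2) | e <- stage_edges s]).
Proof.
move=> Klx Krx [csz csb] /and5P[walls selfs rad pw /andP[w1 w2]].
(* Kl and Kr lie beyond two planes with normal eL, and M is the motion in between. *)
set M := union (edge_pieces (stage_edges s) ++ box_pieces cs (boxes s)).
have szE : size cs = size (boxes s) by rewrite csz size_map.
have cells : map fst (edge_pieces (stage_edges s) ++ box_pieces cs (boxes s)) = stage_cells s.
  rewrite map_cat /stage_cells /edge_pieces /box_pieces -!map_comp; congr (_ ++ _).
  by rewrite -{2}(unzip2_zip (eq_leq (esym szE))) -map_comp.
have pieces x : List.In x (edge_pieces (stage_edges s) ++ box_pieces cs (boxes s)) ->
    [/\ List.In x.1 (stage_cells s), spanned (map evh x.1) x.2 & good x.2].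
  move=> xin; have xc : List.In x.1 (stage_cells s).
    by rewrite -cells; apply: List.in_map.
  suff : spanned (map evh x.1) x.2 /\ good x.2 by case.
  have [|] := (List.in_app_or _ _ _ xin) => {xin xc}.
    move=> xin; have [e ein ->] := In_map xin; split; first exact: spanned_hseg.
    by have /= := all_In selfs ein; exact: sepb_self.
  move=> xin; have [[c bx] cin ->] := In_map xin; split; last exact: good_rigid.
  have bin : List.In bx (boxes s).
    by rewrite -(unzip2_zip (eq_leq (esym szE))); apply: (List.in_map snd _ _ cin).
  have r0 := ev_gt0 a1 b1 (all_In rad bin).
  case: bx cin bin r0 => [[c0 c1] r] cin bin r0 /=; apply: spanned_box => //.
  apply: (csb (c, (c0, r))).
  elim: (cs) (boxes s) cin => [|d ds IH] [|b' bs] //= [[-> ->]|/IH]; first by left.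
  by move=> h; right.
have gM : good M.
  by apply: (@good_union ls); [move=> x /pieces[]|rewrite cells].
pose eL : V := (1, 0, 0).
have dotE (p : V) : dot eL p = p.1.1 by rewrite /dot /= mul1r !mul0r !addr0.
pose dw : V := (ev (wall s).2 - ev (wall s).1, 0, 0).
have sepM (A : set V) l v c :
   (forall p, A p -> dot l p <= c) ->
   (forall g, (exists2 cl, List.In cl (stage_cells s) & List.In g cl) ->
     (c < dot l (evp g.1) /\ c + dot l v < dot l (evp g.2)) \/
     [/\ evp g.2 - evp g.1 = v, c <= dot l (evp g.1) & c + dot l v <= dot l (evp g.2)]) ->
   sep (rigid A v) M.
  move=> Ac H; rewrite /M.
  elim: (_ ++ _) pieces => [_|x xs IH P] /=; first exact/sep_sym/sep0l.
  have [xc sx _] := P x (or_introl erefl).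
  apply: sepUr; last by apply: IH => y ys; apply: P; right.
  apply: (sep_rigid_spanned sx Ac) => g' g'x; have [g gx ->] := In_map g'x.
  by apply: H; exists x.1.
have sL : sep (rigid Kl 0) M.
  apply: (@sepM _ eL 0 (ev xl)) => [p Kp|g [c cin gc]].
    by rewrite dotE; exact: Klx.
  have /andP[gl _] := all_In (all_In walls cin) gc.
  rewrite !dotE /= !addr0.
  move: gl => /orP[/andP[/(ev_gt0 a1 b1) + /(ev_gt0 a1 b1)]|/and3P[/eqP e /(ev_ge0 a1 b1) + /(ev_ge0 a1 b1)]].
    by rewrite !evB => h1 h2; left; split; rewrite /=; lra.
  by rewrite !evB => h1 h2; right; split; rewrite /= ?e ?subrr//; move: h1 h2; rewrite e /=; lra.
have sR : sep (rigid (moved (ev (wall s).1, 0, 0) Kr) dw) M.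
  apply: (@sepM _ (- eL) dw (- ev (wall s).1)) => [_ [p Kp <-]|g [c cin gc]].
    have -> : dot (- eL) (p + (ev (wall s).1, 0, 0)) = - p.1.1 - ev (wall s).1.
      by rewrite /dot /=; ring.
    by have := Krx _ Kp; lra.
  have /andP[_ gr] := all_In (all_In walls cin) gc.
  have dotN (p : V) : dot (- eL) p = - p.1.1 by rewrite /dot /=; ring.
  rewrite !dotN /=.
  move: gr => /orP[/andP[/(ev_gt0 a1 b1) + /(ev_gt0 a1 b1)]|/and3P[/eqP e /(ev_ge0 a1 b1) + /(ev_ge0 a1 b1)]].
    by rewrite !evB => h1 h2; left; split; rewrite /=; lra.
  rewrite !evB => h1 h2; right; split; rewrite /=; [|lra|lra].
  by rewrite -evpB e /evp /dw /= evB !ev_const /zr /= !mul0r.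
have sLR : sep (rigid Kl 0) (rigid (moved (ev (wall s).1, 0, 0) Kr) dw).
  have K1 : 0 < ev (wall s).1 - ev xl by rewrite -evB; exact: ev_gt0.
  have K2 : 0 < ev (wall s).2 - ev xl by rewrite -evB; exact: ev_gt0.
  set k1 := ev (wall s).1 - _ in K1; set k2 := ev (wall s).2 - _ in K2.
  (* k1 and k2 are the distances of the two planes before and after the motion. *)
  have i1 : 0 < `|dw| / k1 + 1 by rewrite ltr_wpDl// divr_ge0 ?normr_ge0// ltW.
  have i2 : 0 <= `|dw| / k2 by rewrite divr_ge0 ?normr_ge0// ltW.
  apply: (@sep_pc _ _ _ eL (`|dw| / k1 + 1 + `|dw| / k2)); first lra.
  have K0 : 0 <= `|dw| / k1 + 1 + `|dw| / k2 by lra.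
  move=> _ _ [p /Klx px <-] [_ [q /Krx qx <-] <-] /=.
  rewrite /pc !dotE /= addr0 subrr subr0 [_ + dw]addrC addrK; split.
    apply: le_trans (_ : (`|dw| / k1 + 1 + `|dw| / k2) * k1 <= _).
      by rewrite -ler_pdivrMr//; lra.
    by apply: ler_wpM2l => //; rewrite /k1; lra.
  apply: le_trans (_ : (`|dw| / k1 + 1 + `|dw| / k2) * k2 <= _).
    by rewrite -ler_pdivrMr//; lra.
  by apply: ler_wpM2l => //; rewrite /k2; lra.
have gX : good (rigid Kl 0 `|` (rigid (moved (ev (wall s).1, 0, 0) Kr) dw `|` M)).
  apply: goodU; first exact: good_rigid.
    by apply: goodU => //; exact: good_rigid.
  exact: sepUr.
have := equivalent_good gX.
rewrite !image_setU !rigid_fst !rigid_snd -!/(moved _ _) /M union_cat !image_setU.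
rewrite edge_pieces_fst edge_pieces_snd box_pieces_fst box_pieces_snd moved_moved.
have -> : (ev (wall s).1, 0, 0) + dw = (ev (wall s).2, 0, 0).
  by congr (_, _, _); rewrite /= ?addr0// addrC subrK.
have -> : moved 0 Kl = Kl.
  by rewrite /moved (_ : (fun p => p + 0) = id) ?image_id//; apply/funext => p; rewrite addr0.
by [].
Qed.

End Soundness.

Definition emap (f : fpt -> fpt) (E : seq (fpt * fpt)) : seq (fpt * fpt) :=
  [seq (f e.1, f e.2) | e <- E].

Definition same_edges (E F : seq (fpt * fpt)) : bool :=
  all (fun e => (e \in F) || ((e.2, e.1) \in F)) E &&
  all (fun e => (e \in E) || ((e.2, e.1) \in E)) F.

Definition edges_of (ss : seq (seq fpt)) : seq (fpt * fpt) := flatten (map (@steps _) ss).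

(** The drawing between two stages. *)
Record frame := Frame { fwall : lform; fboxes : seq box; fstrands : seq (seq fpt) }.

Definition source (s : stage) : frame :=
  Frame (wall s).1 [seq (b.1.1, b.2) | b <- boxes s] [seq map fst m | m <- moves s].
Definition target (s : stage) : frame :=
  Frame (wall s).2 [seq (b.1.2, b.2) | b <- boxes s] [seq map snd m | m <- moves s].

(** The proper fractions of denominator at most 16. *)
Definition ratios : seq (Z * Z) :=
  [seq (Z.of_nat pq.2, Z.of_nat pq.1) | pq <- [seq (q, p.+1) | q <- iota 2 15, p <- iota 0 q.-1]].

Definition between (p m q : fpt) : bool :=
  has (fun r => pscale r.2 (psub m p) == pscale r.1 (psub q p)) ratios.

(** Removes the vertices that lie on the segment between their neighbours: the
    strands are not subdivided in the same way by all the stages of a script. *)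
Definition straighten (s : seq fpt) : seq fpt :=
  foldr (fun p acc => if acc is m :: q :: r then
                        if between p m q then p :: q :: r else p :: acc
                      else p :: acc) [::] s.

Definition same_frame (f g : frame) : bool :=
  [&& fwall f == fwall g, fboxes f == fboxes g &
      map straighten (fstrands f) == map straighten (fstrands g)].

Fixpoint script_ok (ls : seq (Z * Z * Z)) (xl : lform) (f : frame)
    (ss : seq stage) (g : frame) : bool :=
  if ss is s :: ss' then
    [&& same_frame f (source s), stage_ok ls xl s & script_ok ls xl (target s) ss' g]
  else same_frame f g.

Section Scripts.
Variables (R : realType) (a b : R).
Hypotheses (a1 : 1 <= a) (b1 : 1 <= b).
Notation V := (R3 R).
Local Notation ev := (ev a b).
Local Notation evp := (evp a b).
Local Notation flink := (flink a b).
Local Notation context := (ctx a b).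

Definition frame_edges (f : frame) : seq (fpt * fpt) := flatten (map (@steps _) (fstrands f)).

Definition frame_set (Kl Kr : set V) (cs : seq (set V)) (f : frame) : set V :=
  context Kl Kr cs (fwall f) [seq x.1 | x <- fboxes f] (frame_edges f).

Lemma flinkP E r : flink E r <-> exists2 e, e \in E & segment (evp e.1) (evp e.2) r.
Proof.
elim: E => [|e E IH] /=; first by split=> // -[].
split=> [[er|/IH[f fE fr]]|[f]].
- by exists e => //; rewrite mem_head.
- by exists f => //; rewrite inE fE orbT.
- by rewrite inE => /orP[/eqP -> fr|fE fr]; [left|right; apply/IH; exists f].
Qed.

Lemma segment_sym (p q : V) : segment p q = segment q p.
Proof.
suff H (p' q' : V) : segment p' q' `<=` segment q' p' by apply/seteqP; split; exact: H.
move=> _ [t /andP[t0 t1] ->]; exists (1 - t); first by apply/andP; split; lra.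
by congr (_, _, _); ring.
Qed.

Lemma flink_same E F : same_edges E F -> flink E = flink F.
Proof.
suff H E' F' : all (fun e => (e \in F') || ((e.2, e.1) \in F')) E' -> flink E' `<=` flink F'.
  by move=> /andP[EF FE]; apply/seteqP; split; exact: H.
move=> /allP EF r /flinkP[e /EF /orP[eF er|eF er]]; apply/flinkP; first by exists e.
by exists (e.2, e.1) => //=; rewrite segment_sym.
Qed.

Lemma segment_split (t : R) (p q : V) : 0 <= t <= 1 ->
  segment p q = segment p (comb t p q) `|` segment (comb t p q) q.
Proof.
move=> /andP[t0 t1].
have cE s : comb s p q = ((1 - s) * p.1.1 + s * q.1.1, (1 - s) * p.1.2 + s * q.1.2,
   (1 - s) * p.2 + s * q.2) by [].
have c1 (s : R) : comb s p (comb t p q) = comb (s * t) p q.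
  by congr (_, _, _); rewrite /=; ring.
have c2 (s : R) : comb s (comb t p q) q = comb (t + s * (1 - t)) p q.
  by congr (_, _, _); rewrite /=; ring.
apply/seteqP; split=> [_ [s /andP[s0 s1] ->]|_ [[s /andP[s0 s1] ->]|[s /andP[s0 s1] ->]]].
- have [st|ts] := leP s t.
    have [t00|tn0] := eqVneq t 0.
      have s00 : s = 0 by apply/eqP; rewrite eq_le s0 -t00 st.
      by left; exists 0; rewrite ?lexx ?ler01// -!/(comb _ _ _) c1 s00 mul0r.
    have tp : 0 < t by rewrite lt_neqAle eq_sym tn0.
    left; exists (s / t).
      by apply/andP; split; [apply: divr_ge0; lra|rewrite ler_pdivrMr//; lra].
    by rewrite -!/(comb _ _ _) c1 divfK.
  have ut : 0 < 1 - t by lra.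
  right; exists ((s - t) / (1 - t)).
    by apply/andP; split; [apply: divr_ge0; lra|rewrite ler_pdivrMr//; lra].
  by rewrite -!/(comb _ _ _) c2 divfK ?gt_eqF// addrC subrK.
- exists (s * t); first by rewrite mulr_ge0//= mulr_ile1.
  by rewrite -!/(comb _ _ _) c1.
- exists (t + s * (1 - t)); last by rewrite -!/(comb _ _ _) c2.
  have : s * (1 - t) <= 1 - t by rewrite ler_piMl// subr_ge0.
  have : 0 <= s * (1 - t) by rewrite mulr_ge0// subr_ge0.
  by move=> *; apply/andP; split; lra.
Qed.

Lemma between_segment p m q : between p m q ->
  segment (evp p) (evp q) = segment (evp p) (evp m) `|` segment (evp m) (evp q).
Proof.
move=> /hasP[[i j] ij /= /eqP e].
have ij0 : 0 < zr R i /\ zr R i <= zr R j /\ 0 < zr R j.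
  have : all (fun r => Z.ltb 0 r.1 && Z.leb r.1 r.2) ratios by [].
  move=> /allP/(_ _ ij)/= /andP[i0 ji].
  have h1 : 0 < zr R i by exact: zr_gt0.
  have h2 : zr R i <= zr R j.
    by rewrite -subr_ge0 -zrB; apply: zr_ge0; lia.
  by split=> //; split=> //; exact: lt_le_trans h2.
have [i0 [le_ij j0]] := ij0.
have -> : evp m = comb (zr R i / zr R j) (evp p) (evp q).
  have eE (k : fpt -> lform) : k (pscale j (psub m p)) = fscale j (fsub (k m) (k p)) ->
      k (pscale i (psub q p)) = fscale i (fsub (k q) (k p)) ->
      ev (k m) = (1 - zr R i / zr R j) * ev (k p) + zr R i / zr R j * ev (k q).
    move=> k1 k2; have : ev (k (pscale j (psub m p))) = ev (k (pscale i (psub q p))) by rewrite e.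
    rewrite k1 k2 !evZ !evB => h.
    apply: (mulfI (lt0r_neq0 j0)).
    have -> : zr R j * ev (k m) = zr R j * (ev (k m) - ev (k p)) + zr R j * ev (k p) by ring.
    by rewrite h; field; rewrite gt_eqF.
  rewrite {1}/evp /comb /=.
  by rewrite (eE (fun p => p.1.1))// (eE (fun p => p.1.2))// (eE snd).
apply: segment_split; apply/andP; split; first by rewrite divr_ge0// ltW.
by rewrite ler_pdivrMr// mul1r.
Qed.

Lemma straighten_cons p s : exists r, straighten (p :: s) = p :: r.
Proof. by rewrite /=; case: (straighten s) => [|m [|q r]]; [exists [::]|exists [:: m]|case: ifP => _; eexists]. Qed.

Lemma flink_straighten s : flink (steps (straighten s)) = flink (steps s).
Proof.
elim: s => // p s IH.
have step1 x y r : flink (steps (x :: y :: r)) =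
   segment (evp x) (evp y) `|` flink (steps (y :: r)) by [].
case: s IH => [//|m s] IH; rewrite step1 -IH.
have [r rE] := straighten_cons m s.
have -> : straighten (p :: m :: s) =
    if straighten (m :: s) is m' :: q :: r then
      if between p m' q then p :: q :: r else p :: straighten (m :: s)
    else p :: straighten (m :: s) by [].
rewrite rE; case: r {rE IH} => [|q r]; first by rewrite -step1.
by case: ifP => [/between_segment e|_]; rewrite !step1// e setUA.
Qed.

Lemma flink_cat E F : flink (E ++ F) = flink E `|` flink F.
Proof. by elim: E => [|e E IH] /=; rewrite ?set0U// IH setUA. Qed.

Lemma flink_flatten_straighten ss :
  flink (flatten (map (@steps _) (map straighten ss))) = flink (flatten (map (@steps _) ss)).
Proof.
by elim: ss => //= s ss IH; rewrite !flink_cat IH flink_straighten.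
Qed.

Lemma same_frame_set Kl Kr cs f g : same_frame f g ->
  frame_set Kl Kr cs f = frame_set Kl Kr cs g.
Proof.
move=> /and3P[/eqP e1 /eqP e2 /eqP e3]; rewrite /frame_set /ctx e1 e2 /frame_edges.
by rewrite -flink_flatten_straighten e3 flink_flatten_straighten.
Qed.

Lemma steps_map (T U : Type) (f : T -> U) s :
  steps (map f s) = [seq (f e.1, f e.2) | e <- steps s].
Proof.
elim: s => // x [//|y s] IH; rewrite /steps /= in IH *.
by congr (_ :: _); exact: IH.
Qed.

Lemma source_edges s : frame_edges (source s) = [seq (e.1.1, e.2.1) | e <- stage_edges s].
Proof.
rewrite /frame_edges /stage_edges /source /= map_flatten -!map_comp.
by congr flatten; apply: eq_map => m /=; rewrite steps_map.
Qed.

Lemma target_edges s : frame_edges (target s) = [seq (e.1.2, e.2.2) | e <- stage_edges s].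
Proof.
rewrite /frame_edges /stage_edges /target /= map_flatten -!map_comp.
by congr flatten; apply: eq_map => m /=; rewrite steps_map.
Qed.

(** A script whose certificates check proves an equivalence that holds in any
    context. *)
Lemma script_sound ls xl ss f g Kl Kr cs :
  (forall p, Kl p -> p.1.1 <= ev xl) -> (forall p, Kr p -> 0 <= p.1.1) ->
  fits a b cs (fboxes f) -> script_ok ls xl f ss g ->
  equivalent (frame_set Kl Kr cs f) (frame_set Kl Kr cs g).
Proof.
move=> Klx Krx; elim: ss f => [|s ss IH] f cf.
  by move=> /same_frame_set ->; exact: equivalent_refl.
move=> /and3P[fs ok_s oks].
have cs1 : fits a b cs [seq (x.1.1, x.2) | x <- boxes s].
  by case/and3P: fs => _ /eqP e _; move: cf; rewrite e.
have := stage_sound a1 b1 Klx Krx cs1 ok_s.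
have -> : [seq x.1.1 | x <- boxes s] = [seq x.1 | x <- fboxes (source s)].
  by rewrite /source /= -map_comp.
have -> : [seq x.1.2 | x <- boxes s] = [seq x.1 | x <- fboxes (target s)].
  by rewrite /target /= -map_comp.
rewrite -source_edges -target_edges (same_frame_set _ _ _ fs) => st.
apply: (equivalent_trans st); apply: (IH (target s)) => //.
case: cs1 => sz H; split; first by rewrite sz !size_map.
move=> [c x] /=; rewrite /target /= => cin.
suff [y cy ->] : exists2 y, List.In (c, y) (zip cs [seq (b.1.1, b.2) | b <- boxes s]) & x.2 = y.2.
  exact: (H _ cy).
elim: (cs) (boxes s) cin {H sz} => [|d ds IHd] [|b' bs] //= [[<- <-]|/IHd[y h ->]].
  by exists (b'.1.1, b'.2) => //; left.
by exists y => //; right.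
Qed.

End Scripts.

(** * The local moves *)

Local Open Scope Z_scope.

Definition pt (x y z : Z) : fpt := (fconst x, fconst y, fconst z).
(** A wall beyond everything else, for when there is nothing to translate. *)
Definition far : lform := (48000, 4800, 4800).
Definition stay (x y z : Z) : hvert := (pt x y z, pt x y z).
Definition go (x y z x' y' z' : Z) : hvert := (pt x y z, pt x' y' z').
Definition keep (p : fpt) : hvert := (p, p).

(** The linear forms that separate the pieces in all the scripts below. *)
Definition covectors : seq (Z * Z * Z) :=
  [:: (8, 0, -1); (0, 8, 1); (1, -3, 3); (3, 3, 2); (0, 0, 1); (0, 3, -1); (0, 1, 0); (1, 0, 0); (2, -3, -1); (2, -3, 0);
  (1, 3, 2); (2, -3, 1); (8, 0, 1); (1, 2, 0)].

(** Coordinates are in units of 1/48. The left side of the picture is always cut by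
    the plane x = 0 in the four points of [pad] below; in a strand, each vertex is
    given with its initial and its final position. In the first script, a loop of
    the strand that starts at the origin is lifted, taken off and shrunk; then the
    strand in front is lifted, and everything is compressed to half the width. *)
Definition gamma_script : seq stage :=
  let s1 := [:: stay 0 48 0; stay 96 48 0; stay 336 48 0; stay 336 0 (-48); stay 336
    (-48) 48; stay 384 (-48) 48] in
  let s2 := [:: stay 0 0 144; stay 96 0 0; stay 144 48 96; stay 240 48 96; stay 240 0
    (-48); stay 240 (-48) 48; stay 288 (-48) 48; stay 336 (-48) 96; stay 384 0 0] in
  let s3 := [:: stay 0 (-48) 0; stay 96 (-48) 0; stay 384 (-48) 0] in
  [:: Stage (fconst 384, fconst 384) [::] [:: s1; s2; [:: stay 0 0 0; stay 96 (-48) 48;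
      stay 144 (-48) 96; go 192 0 0 192 0 240; go 240 48 144 240 48 288; go 288 0 0 288 0
      288; go 240 (-48) 96 240 (-48) 288; stay 192 (-48) 48; stay 144 (-48) 48; stay 144
      0 (-48); stay 144 48 48; stay 336 48 48; stay 384 48 0]; s3];
      Stage (fconst 384, fconst 384) [::] [:: s1; s2; [:: stay 0 0 0; stay 96 (-48) 48;
      stay 144 (-48) 96; go 192 0 240 168 (-24) 240; go 240 48 288 192 0 288; go 288 0
      288 216 (-24) 288; go 240 (-48) 288 192 (-48) 240; stay 192 (-48) 48; stay 144
      (-48) 48; stay 144 0 (-48); stay 144 48 48; stay 336 48 48; stay 384 48 0]; s3];
      Stage (fconst 384, fconst 384) [::] [:: s1; s2; [:: stay 0 0 0; stay 96 (-48) 48;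
      stay 144 (-48) 96; go 168 (-24) 240 168 (-48) 96; go 192 0 288 192 (-48) 96; go 216
      (-24) 288 216 (-48) 96; go 192 (-48) 240 216 (-48) 72; go 192 (-48) 48 216 (-48)
      48; go 144 (-48) 48 192 (-24) 24; go 144 0 (-48) 192 0 (-48); stay 144 48 48; stay
      336 48 48; stay 384 48 0]; s3];
      Stage (fconst 384, fconst 384) [::] [:: s1; s2; [:: stay 0 0 0; stay 96 (-48) 48;
      stay 144 (-48) 96; go 216 (-48) 96 168 (-24) 96; go 216 (-48) 48 192 0 96; go 192
      (-24) 24 192 24 72; go 192 0 (-48) 192 48 48; go 144 48 48 240 48 48; stay 336 48
      48; stay 384 48 0]; s3];
      Stage (fconst 384, fconst 384) [::] [:: s1; [:: stay 0 0 144; go 96 0 0 96 0 192;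
      go 144 48 96 144 0 240; go 240 48 96 192 0 240; go 240 0 (-48) 240 0 240; go 240
      (-48) 48 264 0 240; go 288 (-48) 48 288 0 240; go 336 (-48) 96 336 0 192; stay 384
      0 0]; [:: stay 0 0 0; stay 96 (-48) 48; stay 144 (-48) 96; stay 192 0 96; stay 192
      48 48; stay 336 48 48; stay 384 48 0]; s3];
      Stage (fconst 384, fconst 192) [::] [:: [:: stay 0 48 0; go 96 48 0 24 36 (-24); go
      336 48 0 48 24 (-48); go 336 0 (-48) 96 0 0; go 336 (-48) 48 144 (-24) 24; go 384
      (-48) 48 192 (-48) 48]; [:: stay 0 0 144; go 96 0 192 48 0 144; go 144 0 240 96 0
      144; go 240 0 240 120 0 108; go 288 0 240 144 0 72; go 336 0 192 168 0 36; go 384 0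
      0 192 0 0]; [:: stay 0 0 0; go 96 (-48) 48 24 12 24; go 144 (-48) 96 48 24 48; go
      192 0 96 72 36 24; go 192 48 48 96 48 0; go 336 48 48 144 48 0; go 384 48 0 192 48
      0]; [:: stay 0 (-48) 0; stay 96 (-48) 0; go 384 (-48) 0 192 (-48) 0]]].

Definition junction_script : seq stage :=
  [:: Stage (fconst 192, fconst 192) [::] [:: [:: stay 0 48 0; stay 96 48 0; stay 192 48
      0]; [:: stay 0 0 144; go 96 0 0 48 0 144; go 144 48 96 96 0 144; stay 192 0 0]; [::
      stay 0 0 0; go 96 (-48) 48 48 (-24) 48; go 144 (-48) 48 96 (-48) 0; stay 192 (-48)
      0]; [:: stay 0 (-48) 0; go 96 (-48) 0 24 (-36) (-24); go 144 (-48) 0 48 (-24)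
      (-48); go 144 0 (-48) 96 0 0; go 144 48 48 144 24 24; stay 192 48 48]]].

Definition start_script : seq stage :=
  [:: Stage (fconst 96, fconst 96) [::] [:: [:: stay 96 48 0; go 48 48 48 48 48 96; go 0
      0 0 0 0 192; go 48 (-48) 96 48 0 192; stay 96 0 0]; [:: stay 96 (-48) 48; stay 48
      (-48) 48; stay 48 0 (-48); stay 48 48 0; stay (-48) 48 0; stay (-48) (-48) 0; stay
      96 (-48) 0]];
      Stage (fconst 96, fconst 96) [::] [:: [:: stay 96 48 0; go 48 48 96 0 48 0; go 0 0
      192 (-48) 48 96; go 48 0 192 0 0 144; stay 96 0 0]; [:: stay 96 (-48) 48; go 48
      (-48) 48 48 (-24) 24; go 48 0 (-48) 0 0 0; go 48 48 0 (-24) (-12) 0; go (-48) 48 0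
      (-48) (-24) 0; go (-48) (-48) 0 0 (-48) 0; stay 96 (-48) 0]]].

Definition junction_end_script : seq stage :=
  [:: Stage (far, far) [::] [:: [:: stay 0 48 0; stay 96 48 0; stay 144 48 0; stay 144 0
      (-48); stay 144 (-48) 0; stay 96 (-48) 0; stay 0 (-48) 0]; [:: stay 0 0 0; stay 96
      (-48) 48; stay 144 (-48) 48; go 192 0 0 240 0 0; go 144 48 48 240 24 144; go 96 0 0
      192 0 144; stay 0 0 144]];
      Stage (far, far) [::] [:: [:: stay 0 48 0; go 96 48 0 96 96 0; go 120 48 0 192 96
      0; go 144 48 0 192 48 0; go 144 0 (-48) 192 0 (-48); go 144 (-48) 0 192 (-48) 0; go
      120 (-48) 0 192 (-96) 0; go 96 (-48) 0 96 (-96) 0; stay 0 (-48) 0]; [:: stay 0 0 0;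
      go 96 (-48) 48 144 0 0; go 144 (-48) 48 192 0 48; stay 240 0 0; go 240 24 144 288 0
      144; stay 192 0 144; stay 0 0 144]]].

Definition gamma_end_script : seq stage :=
  let s1 := [:: stay 0 48 0; stay 96 48 0; stay 336 48 0; stay 336 0 (-48); stay 336
    (-48) 0; stay 96 (-48) 0; stay 0 (-48) 0] in
  [:: Stage (far, far) [::] [:: s1; [:: stay 0 0 144; stay 96 0 0; stay 144 48 96; stay
      240 48 96; stay 240 0 (-48); stay 240 (-48) 48; stay 336 (-48) 48; stay 384 0 0;
      stay 336 48 48; stay 144 48 48; stay 144 0 (-48); stay 144 (-48) 48; stay 192 (-48)
      48; go 240 (-48) 96 240 (-48) 288; go 288 0 0 288 0 288; go 240 48 144 240 48 288;
      go 192 0 0 192 0 240; stay 144 (-48) 96; stay 96 (-48) 48; stay 0 0 0]];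
      Stage (far, far) [::] [:: s1; [:: stay 0 0 144; stay 96 0 0; stay 144 48 96; stay
      240 48 96; stay 240 0 (-48); stay 240 (-48) 48; stay 336 (-48) 48; stay 384 0 0;
      stay 336 48 48; stay 144 48 48; stay 144 0 (-48); stay 144 (-48) 48; stay 192 (-48)
      48; go 240 (-48) 288 192 (-48) 240; go 288 0 288 216 (-24) 288; go 240 48 288 192 0
      288; go 192 0 240 168 (-24) 240; stay 144 (-48) 96; stay 96 (-48) 48; stay 0 0 0]];
      Stage (far, far) [::] [:: s1; [:: stay 0 0 144; stay 96 0 0; stay 144 48 96; stay
      240 48 96; stay 240 0 (-48); stay 240 (-48) 48; stay 336 (-48) 48; stay 384 0 0;
      stay 336 48 48; stay 144 48 48; go 144 0 (-48) 192 0 (-48); go 144 (-48) 48 192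
      (-24) 24; go 192 (-48) 48 216 (-48) 48; go 192 (-48) 240 216 (-48) 72; go 216 (-24)
      288 216 (-48) 96; go 192 0 288 192 (-48) 96; go 168 (-24) 240 168 (-48) 96; stay
      144 (-48) 96; stay 96 (-48) 48; stay 0 0 0]];
      Stage (far, far) [::] [:: s1; [:: stay 0 0 144; stay 96 0 0; stay 144 48 96; stay
      240 48 96; stay 240 0 (-48); stay 240 (-48) 48; stay 336 (-48) 48; stay 384 0 0;
      stay 336 48 48; stay 240 48 48; go 144 48 48 192 48 48; go 192 0 (-48) 192 24 72;
      go 192 (-24) 24 192 0 96; go 216 (-48) 48 168 (-24) 96; go 216 (-48) 96 156 (-36)
      96; stay 144 (-48) 96; stay 96 (-48) 48; stay 0 0 0]];
      Stage (far, far) [::] [:: s1; [:: stay 0 0 144; go 96 0 0 96 0 192; go 144 48 96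
      144 0 240; go 240 48 96 240 0 240; go 240 0 (-48) 264 0 240; go 240 (-48) 48 288 0
      240; go 336 (-48) 48 336 0 192; stay 384 0 0; stay 336 48 48; stay 192 48 48; stay
      192 0 96; stay 144 (-48) 96; stay 96 (-48) 48; stay 0 0 0]];
      Stage (far, far) [::] [:: [:: stay 0 48 0; go 96 48 0 96 96 0; go 216 48 0 192 96
      0; go 336 48 0 192 48 0; go 336 0 (-48) 192 0 (-48); go 336 (-48) 0 192 (-48) 0; go
      216 (-48) 0 192 (-96) 0; go 96 (-48) 0 96 (-96) 0; stay 0 (-48) 0]; [:: stay 0 0
      144; go 96 0 192 96 0 144; go 144 0 240 144 0 144; go 288 0 240 240 0 144; go 336 0
      192 288 0 144; go 384 0 0 240 0 0; go 336 48 48 216 0 24; go 192 48 48 192 0 48; go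
      192 0 96 144 0 0; go 144 (-48) 96 96 0 0; go 96 (-48) 48 48 0 0; stay 0 0 0]]].

Definition closure_script : seq stage :=
  let s1 := [:: keep ((144,48,0),(0,-48,0),(0,0,0)); keep ((96,0,0),(-48,-48,0),(0,0,0));
    keep ((144,0,0),(0,0,0),(0,0,0))] in
  [:: Stage (far, far) [:: (((144,48,0),(0,0,0),(0,0,0)), ((144,48,0),(0,0,0),(0,0,0)),
      (0,48,0))] [:: [:: keep ((144,48,0),(0,48,0),(0,0,0));
      (((192,96,0),(48,48,0),(0,0,0)), ((192,96,0),(48,48,0),(192,0,0))); keep
      ((144,96,0),(0,0,0),(0,0,0))]; s1];
      Stage (far, far) [:: (((144,48,0),(0,0,0),(0,0,0)), ((144,48,0),(0,0,0),(0,0,0)),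
      (0,48,0))] [:: [:: keep ((144,48,0),(0,48,0),(0,0,0));
      (((168,72,0),(24,48,0),(96,0,0)), ((144,48,0),(48,48,0),(0,0,0)));
      (((192,96,0),(48,48,0),(192,0,0)), ((192,48,0),(48,48,0),(192,0,0)));
      (((168,96,0),(24,24,0),(96,0,0)), ((192,96,0),(0,0,0),(144,0,0))); keep
      ((144,96,0),(0,0,0),(0,0,0))]; s1];
      Stage (far, far) [:: (((144,48,0),(0,0,0),(0,0,0)), ((144,48,0),(0,0,0),(0,0,0)),
      (0,48,0))] [:: [:: keep ((144,48,0),(0,48,0),(0,0,0)); keep
      ((144,48,0),(48,48,0),(0,0,0)); (((192,48,0),(48,48,0),(192,0,0)),
      ((48,0,0),(48,48,0),(144,0,0))); keep ((192,96,0),(0,0,0),(144,0,0)); keep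
      ((144,96,0),(0,0,0),(0,0,0))]; s1];
      Stage (far, far) [:: (((144,48,0),(0,0,0),(0,0,0)), ((144,48,0),(0,0,0),(0,0,0)),
      (0,48,0))] [:: [:: keep ((144,48,0),(0,48,0),(0,0,0)); keep
      ((144,48,0),(48,48,0),(0,0,0)); (((96,24,0),(48,48,0),(72,0,0)),
      ((96,0,0),(48,48,0),(0,0,0))); keep ((48,0,0),(48,48,0),(144,0,0)); keep
      ((192,96,0),(0,0,0),(144,0,0)); keep ((144,96,0),(0,0,0),(0,0,0))]; [:: keep
      ((144,48,0),(0,-48,0),(0,0,0)); keep ((96,0,0),(-48,-48,0),(0,0,0));
      (((112,0,0),(-32,-32,0),(0,0,0)), ((0,0,0),(-48,0,0),(0,0,0)));
      (((128,0,0),(-16,-16,0),(0,0,0)), ((0,0,0),(0,0,0),(0,0,0))); keep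
      ((144,0,0),(0,0,0),(0,0,0))]];
      Stage (far, far) [:: (((144,48,0),(0,0,0),(0,0,0)), ((144,48,0),(0,0,0),(0,0,0)),
      (0,48,0))] [:: [:: keep ((144,48,0),(0,48,0),(0,0,0)); keep
      ((144,48,0),(48,48,0),(0,0,0)); keep ((96,0,0),(48,48,0),(0,0,0));
      (((80,0,0),(48,48,0),(48,0,0)), ((0,0,0),(48,0,0),(0,0,0)));
      (((64,0,0),(48,48,0),(96,0,0)), ((-48,0,0),(48,0,0),(96,0,0)));
      (((48,0,0),(48,48,0),(144,0,0)), ((0,0,0),(0,0,0),(144,0,0)));
      (((96,32,0),(32,32,0),(144,0,0)), ((48,24,0),(0,0,0),(144,0,0)));
      (((144,64,0),(16,16,0),(144,0,0)), ((96,48,0),(0,0,0),(144,0,0))); keep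
      ((192,96,0),(0,0,0),(144,0,0)); keep ((144,96,0),(0,0,0),(0,0,0))]; [:: keep
      ((144,48,0),(0,-48,0),(0,0,0)); (((120,24,0),(-24,-48,0),(0,0,0)),
      ((144,48,0),(-48,-48,0),(0,0,0))); (((96,0,0),(-48,-48,0),(0,0,0)),
      ((96,0,0),(-48,-48,0),(0,0,0))); keep ((0,0,0),(-48,0,0),(0,0,0));
      (((0,0,0),(-24,0,0),(0,0,0)), ((-48,0,0),(-24,0,0),(0,0,0))); keep
      ((0,0,0),(0,0,0),(0,0,0)); keep ((144,0,0),(0,0,0),(0,0,0))]]].

Definition join_script : seq stage :=
  let s1 := [:: keep ((0,0,0),(0,0,0),(144,0,0)); keep ((480,96,0),(0,0,0),(144,0,0));
    keep ((432,96,0),(0,0,0),(0,0,0)); keep ((384,96,0),(-96,0,0),(0,0,0))] in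
  [:: Stage (far, far) [:: (((384,48,0),(-96,0,0),(0,0,0)),
      ((384,48,0),(-96,0,0),(0,0,0)), (0,48,0))] [:: [:: keep ((0,0,0),(48,0,0),(0,0,0));
      keep ((96,0,0),(192,48,0),(0,0,0)); (((288,48,0),(192,48,0),(0,0,0)),
      ((192,0,0),(192,48,0),(0,0,0))); (((288,48,0),(144,48,0),(0,0,0)),
      ((216,0,0),(144,48,0),(0,0,0))); keep ((240,0,0),(96,48,0),(0,0,0)); keep
      ((240,0,0),(48,48,0),(-48,0,0)); keep ((240,0,0),(0,48,0),(0,0,0)); keep
      ((240,0,0),(-96,0,0),(0,0,0)); keep ((384,0,0),(-96,0,0),(0,0,0))]; [:: keep
      ((0,0,0),(0,0,0),(0,0,0)); keep ((144,0,0),(0,0,0),(0,0,0)); keep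
      ((192,0,0),(48,48,0),(0,0,0)); keep ((240,0,0),(48,48,0),(48,0,0)); keep
      ((288,0,0),(48,48,0),(0,0,0)); (((336,24,0),(48,48,0),(0,0,0)),
      ((336,0,0),(48,48,0),(0,0,0))); keep ((384,48,0),(48,48,0),(0,0,0)); keep
      ((384,48,0),(-96,48,0),(0,0,0))]; [:: keep ((0,0,0),(-48,0,0),(0,0,0)); keep
      ((96,0,0),(-192,-48,0),(0,0,0)); (((288,48,0),(-192,-48,0),(0,0,0)),
      ((240,24,0),(-192,-48,0),(0,0,0))); (((288,48,0),(-144,-48,0),(0,0,0)),
      ((384,48,0),(-192,-48,0),(0,0,0))); keep ((384,48,0),(-96,-48,0),(0,0,0))]; s1];
      Stage (far, far) [:: (((384,48,0),(-96,0,0),(0,0,0)),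
      ((384,48,0),(-96,0,0),(0,0,0)), (0,48,0))] [:: [:: keep ((0,0,0),(48,0,0),(0,0,0));
      (((96,0,0),(192,48,0),(0,0,0)), ((12,0,0),(42,0,0),(-12,0,0)));
      (((192,0,0),(192,48,0),(0,0,0)), ((24,0,0),(36,0,0),(-24,0,0)));
      (((240,0,0),(96,48,0),(0,0,0)), ((36,0,0),(30,0,0),(-36,0,0)));
      (((240,0,0),(48,48,0),(-48,0,0)), ((48,0,0),(24,0,0),(-48,0,0)));
      (((240,0,0),(0,48,0),(0,0,0)), ((96,0,0),(0,0,0),(0,0,0))); keep
      ((240,0,0),(-96,0,0),(0,0,0)); keep ((384,0,0),(-96,0,0),(0,0,0))]; [:: keep
      ((0,0,0),(0,0,0),(0,0,0)); (((144,0,0),(0,0,0),(0,0,0)),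
      ((24,0,0),(12,0,0),(24,0,0))); (((192,0,0),(48,48,0),(0,0,0)),
      ((36,0,0),(18,0,0),(36,0,0))); (((240,0,0),(48,48,0),(48,0,0)),
      ((48,0,0),(24,0,0),(48,0,0))); (((288,0,0),(48,48,0),(0,0,0)),
      ((96,0,0),(48,0,0),(0,0,0))); (((336,0,0),(48,48,0),(0,0,0)),
      ((192,0,0),(48,48,0),(0,0,0))); keep ((384,48,0),(48,48,0),(0,0,0)); keep
      ((384,48,0),(-96,48,0),(0,0,0))]; [:: keep ((0,0,0),(-48,0,0),(0,0,0)); keep
      ((96,0,0),(-192,-48,0),(0,0,0)); keep ((384,48,0),(-192,-48,0),(0,0,0)); keep
      ((384,48,0),(-96,-48,0),(0,0,0))]; s1];
      Stage (far, far) [:: (((384,48,0),(-96,0,0),(0,0,0)), ((240,48,0),(0,0,0),(0,0,0)),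
      (0,48,0))] [:: [:: keep ((0,0,0),(48,0,0),(0,0,0)); keep
      ((48,0,0),(24,0,0),(-48,0,0)); keep ((96,0,0),(0,0,0),(0,0,0));
      (((240,0,0),(-96,0,0),(0,0,0)), ((144,0,0),(0,0,0),(0,0,0)));
      (((384,0,0),(-96,0,0),(0,0,0)), ((240,0,0),(0,0,0),(0,0,0)))]; [:: keep
      ((0,0,0),(0,0,0),(0,0,0)); keep ((48,0,0),(24,0,0),(48,0,0)); keep
      ((96,0,0),(48,0,0),(0,0,0)); keep ((192,0,0),(48,48,0),(0,0,0));
      (((384,48,0),(48,48,0),(0,0,0)), ((240,48,0),(48,48,0),(0,0,0)));
      (((384,48,0),(-96,48,0),(0,0,0)), ((240,48,0),(0,48,0),(0,0,0)))]; [:: keep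
      ((0,0,0),(-48,0,0),(0,0,0)); (((48,0,0),(-120,-24,0),(0,0,0)),
      ((96,0,0),(-48,0,0),(0,0,0))); (((96,0,0),(-192,-48,0),(0,0,0)),
      ((192,0,0),(-48,-48,0),(0,0,0))); (((384,48,0),(-192,-48,0),(0,0,0)),
      ((240,48,0),(-48,-48,0),(0,0,0))); (((384,48,0),(-96,-48,0),(0,0,0)),
      ((240,48,0),(0,-48,0),(0,0,0)))]; [:: keep ((0,0,0),(0,0,0),(144,0,0));
      (((240,48,0),(0,0,0),(144,0,0)), ((96,0,0),(0,0,0),(144,0,0)));
      (((480,96,0),(0,0,0),(144,0,0)), ((288,96,0),(0,0,0),(144,0,0)));
      (((432,96,0),(0,0,0),(0,0,0)), ((264,96,0),(0,0,0),(72,0,0)));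
      (((384,96,0),(-96,0,0),(0,0,0)), ((240,96,0),(0,0,0),(0,0,0)))]]].

Definition join2_script : seq stage :=
  let s1 := [:: keep ((0,0,0),(0,0,0),(0,0,0)); keep ((144,0,0),(0,0,0),(0,0,0)); keep
    ((192,0,0),(48,0,48),(0,0,0)); keep ((240,0,0),(96,48,48),(0,0,0)); keep
    ((288,0,0),(96,48,48),(48,0,0)); keep ((336,0,0),(96,48,48),(0,0,0)); keep
    ((432,48,0),(96,48,48),(0,0,0)); keep ((432,48,0),(-48,48,48),(0,0,0))] in
  let s2 := [:: keep ((432,96,0),(-48,0,48),(0,0,0)); keep
    ((480,96,0),(48,0,48),(0,0,0)); keep ((576,96,48),(48,0,48),(0,0,0)); keep
    ((576,96,48),(-192,-48,48),(0,0,0))] in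
  let s3 := [:: keep ((0,0,0),(0,0,0),(144,0,0)); keep ((672,96,96),(0,0,0),(144,0,0));
    keep ((624,96,96),(0,0,0),(0,0,0)); keep ((576,96,96),(-192,-48,0),(0,0,0))] in
  let s4 := [:: keep ((0,0,0),(-48,0,0),(0,0,0)); keep ((96,0,0),(-288,-48,-48),(0,0,0));
    keep ((336,48,24),(-288,-48,-48),(0,0,0)); keep ((576,96,48),(-288,-48,-48),(0,0,0));
    keep ((576,96,48),(-192,-48,-48),(0,0,0))] in
  let s5 := [:: keep ((432,48,0),(-48,-48,48),(0,0,0)); keep
    ((432,48,0),(-96,-48,48),(0,0,0)); keep ((432,48,0),(-192,-48,0),(0,0,0)); keep
    ((576,96,0),(-192,-48,0),(0,0,0))] in
  [:: Stage (far, far) [:: (((432,48,0),(-48,0,48),(0,0,0)),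
      ((432,48,0),(-48,0,48),(0,0,0)), (0,48,0)); (((576,96,48),(-192,-48,0),(0,0,0)),
      ((576,96,48),(-192,-48,0),(0,0,0)), (0,0,48))] [:: [:: keep
      ((0,0,0),(48,0,0),(0,0,0)); keep ((96,0,0),(288,48,48),(0,0,0));
      (((384,48,48),(288,48,48),(0,0,0)), ((240,0,0),(288,48,48),(0,0,0)));
      (((384,48,48),(240,48,48),(0,0,0)), ((256,0,0),(240,48,48),(0,0,0)));
      (((336,48,0),(192,48,48),(0,0,0)), ((272,0,0),(192,48,48),(0,0,0))); keep
      ((288,0,0),(144,48,48),(0,0,0)); keep ((288,0,0),(96,48,48),(-48,0,0)); keep
      ((288,0,0),(48,48,48),(0,0,0)); keep ((288,0,0),(-48,0,48),(0,0,0)); keep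
      ((432,0,0),(-48,0,48),(0,0,0))]; s1; s2; [:: keep
      ((432,48,0),(-48,-48,48),(0,0,0)); keep ((336,48,0),(-96,-48,48),(0,0,0)); keep
      ((336,48,0),(-192,-48,0),(0,0,0)); keep ((576,96,0),(-192,-48,0),(0,0,0))]; s3; [::
      keep ((0,0,0),(-48,0,0),(0,0,0)); keep ((96,0,0),(-288,-48,-48),(0,0,0));
      (((384,48,48),(-288,-48,-48),(0,0,0)), ((336,48,24),(-288,-48,-48),(0,0,0)));
      (((384,48,48),(-240,-48,-48),(0,0,0)), ((576,96,48),(-288,-48,-48),(0,0,0))); keep
      ((576,96,48),(-192,-48,-48),(0,0,0))]];
      Stage (far, far) [:: (((432,48,0),(-48,0,48),(0,0,0)),
      ((432,48,0),(-48,0,48),(0,0,0)), (0,48,0)); (((576,96,48),(-192,-48,0),(0,0,0)),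
      ((576,96,48),(-192,-48,0),(0,0,0)), (0,0,48))] [:: [:: keep
      ((0,0,0),(48,0,0),(0,0,0)); keep ((96,0,0),(288,48,48),(0,0,0)); keep
      ((240,0,0),(288,48,48),(0,0,0)); keep ((256,0,0),(240,48,48),(0,0,0)); keep
      ((272,0,0),(192,48,48),(0,0,0)); keep ((288,0,0),(144,48,48),(0,0,0)); keep
      ((288,0,0),(96,48,48),(-48,0,0)); keep ((288,0,0),(48,48,48),(0,0,0)); keep
      ((288,0,0),(-48,0,48),(0,0,0)); keep ((432,0,0),(-48,0,48),(0,0,0))]; s1; s2; [::
      keep ((432,48,0),(-48,-48,48),(0,0,0)); (((336,48,0),(-96,-48,48),(0,0,0)),
      ((432,48,0),(-96,-48,48),(0,0,0))); (((336,48,0),(-192,-48,0),(0,0,0)),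
      ((432,48,0),(-192,-48,0),(0,0,0))); keep ((576,96,0),(-192,-48,0),(0,0,0))]; s3;
      s4];
      Stage (far, far) [:: (((432,48,0),(-48,0,48),(0,0,0)),
      ((432,48,0),(-48,0,48),(0,0,0)), (0,48,0)); (((576,96,48),(-192,-48,0),(0,0,0)),
      ((576,96,48),(-192,-48,0),(0,0,0)), (0,0,48))] [:: [:: keep
      ((0,0,0),(48,0,0),(0,0,0)); (((96,0,0),(288,48,48),(0,0,0)),
      ((24,0,0),(288,48,48),(0,0,0))); (((240,0,0),(288,48,48),(0,0,0)),
      ((48,0,0),(288,48,48),(0,0,0))); (((288,0,0),(144,48,48),(0,0,0)),
      ((72,0,0),(144,48,48),(0,0,0))); (((288,0,0),(96,48,48),(-48,0,0)),
      ((72,0,0),(96,48,48),(-48,0,0))); (((288,0,0),(48,48,48),(0,0,0)),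
      ((96,0,0),(48,48,48),(0,0,0))); (((288,0,0),(-48,0,48),(0,0,0)),
      ((240,0,0),(-48,0,48),(0,0,0))); keep ((432,0,0),(-48,0,48),(0,0,0))]; [:: keep
      ((0,0,0),(0,0,0),(0,0,0)); (((144,0,0),(0,0,0),(0,0,0)),
      ((36,0,0),(0,0,0),(0,0,0))); (((192,0,0),(48,0,48),(0,0,0)),
      ((48,0,0),(48,0,48),(0,0,0))); (((240,0,0),(96,48,48),(0,0,0)),
      ((60,0,0),(96,48,48),(0,0,0))); (((288,0,0),(96,48,48),(48,0,0)),
      ((72,0,0),(96,48,48),(48,0,0))); (((336,0,0),(96,48,48),(0,0,0)),
      ((96,0,0),(96,48,48),(0,0,0))); (((384,24,0),(96,48,48),(0,0,0)),
      ((192,0,0),(96,48,48),(0,0,0))); keep ((432,48,0),(96,48,48),(0,0,0)); keep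
      ((432,48,0),(-48,48,48),(0,0,0))]; s2; s5; s3; s4];
      Stage (far, far) [:: (((432,48,0),(-48,0,48),(0,0,0)),
      ((432,48,0),(-48,0,48),(0,0,0)), (0,48,0)); (((576,96,48),(-192,-48,0),(0,0,0)),
      ((576,96,48),(-192,-48,0),(0,0,0)), (0,0,48))] [:: [:: keep
      ((0,0,0),(48,0,0),(0,0,0)); (((24,0,0),(288,48,48),(0,0,0)),
      ((6,0,0),(45,0,0),(-6,0,0))); (((48,0,0),(288,48,48),(0,0,0)),
      ((24,0,0),(36,0,0),(-24,0,0))); (((72,0,0),(144,48,48),(0,0,0)),
      ((36,0,0),(30,0,0),(-36,0,0))); (((72,0,0),(96,48,48),(-48,0,0)),
      ((48,0,0),(24,0,0),(-48,0,0))); (((96,0,0),(48,48,48),(0,0,0)),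
      ((96,0,0),(0,0,0),(0,0,0))); (((240,0,0),(-48,0,48),(0,0,0)),
      ((240,0,0),(-48,0,0),(0,0,0))); keep ((432,0,0),(-48,0,48),(0,0,0))]; [:: keep
      ((0,0,0),(0,0,0),(0,0,0)); (((36,0,0),(0,0,0),(0,0,0)),
      ((12,0,0),(6,0,0),(12,0,0))); (((48,0,0),(48,0,48),(0,0,0)),
      ((24,0,0),(12,0,0),(24,0,0))); (((60,0,0),(96,48,48),(0,0,0)),
      ((36,0,0),(18,0,0),(36,0,0))); (((72,0,0),(96,48,48),(48,0,0)),
      ((48,0,0),(24,0,0),(48,0,0))); (((96,0,0),(96,48,48),(0,0,0)),
      ((96,0,0),(48,0,0),(0,0,0))); keep ((192,0,0),(96,48,48),(0,0,0)); keep
      ((432,48,0),(96,48,48),(0,0,0)); keep ((432,48,0),(-48,48,48),(0,0,0))]; s2; s5;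
      s3; s4];
      Stage (far, far) [:: (((432,48,0),(-48,0,48),(0,0,0)),
      ((288,48,0),(48,0,48),(0,0,0)), (0,48,0)); (((576,96,48),(-192,-48,0),(0,0,0)),
      ((384,96,48),(-48,-48,0),(0,0,0)), (0,0,48))] [:: [:: keep
      ((0,0,0),(48,0,0),(0,0,0)); keep ((48,0,0),(24,0,0),(-48,0,0)); keep
      ((96,0,0),(0,0,0),(0,0,0)); (((240,0,0),(-48,0,0),(0,0,0)),
      ((240,0,0),(0,0,0),(0,0,0))); (((432,0,0),(-48,0,48),(0,0,0)),
      ((288,0,0),(48,0,48),(0,0,0)))]; [:: keep ((0,0,0),(0,0,0),(0,0,0)); keep
      ((48,0,0),(24,0,0),(48,0,0)); keep ((96,0,0),(48,0,0),(0,0,0));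
      (((192,0,0),(96,48,48),(0,0,0)), ((192,0,0),(144,48,48),(0,0,0)));
      (((432,48,0),(96,48,48),(0,0,0)), ((288,48,0),(144,48,48),(0,0,0)));
      (((432,48,0),(24,48,48),(0,0,0)), ((288,48,0),(96,48,48),(0,0,0)));
      (((432,48,0),(-48,48,48),(0,0,0)), ((288,48,0),(48,48,48),(0,0,0)))]; [::
      (((432,96,0),(-48,0,48),(0,0,0)), ((288,96,0),(48,0,48),(0,0,0)));
      (((480,96,0),(48,0,48),(0,0,0)), ((336,96,24),(48,0,48),(0,0,0)));
      (((576,96,48),(48,0,48),(0,0,0)), ((384,96,48),(48,0,48),(0,0,0)));
      (((576,96,48),(-192,-48,48),(0,0,0)), ((384,96,48),(-48,-48,48),(0,0,0)))]; [::
      (((432,48,0),(-48,-48,48),(0,0,0)), ((288,48,0),(48,-48,48),(0,0,0)));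
      (((432,48,0),(-96,-48,48),(0,0,0)), ((288,48,0),(0,-48,24),(0,0,0)));
      (((432,48,0),(-192,-48,0),(0,0,0)), ((288,48,0),(-48,-48,0),(0,0,0)));
      (((576,96,0),(-192,-48,0),(0,0,0)), ((384,96,0),(-48,-48,0),(0,0,0)))]; [:: keep
      ((0,0,0),(0,0,0),(144,0,0)); (((336,48,48),(0,0,0),(144,0,0)),
      ((96,0,0),(0,0,0),(144,0,0))); (((672,96,96),(0,0,0),(144,0,0)),
      ((480,96,96),(0,0,0),(144,0,0))); (((624,96,96),(0,0,0),(0,0,0)),
      ((432,96,96),(0,0,0),(0,0,0))); (((576,96,96),(-192,-48,0),(0,0,0)),
      ((384,96,96),(-48,-48,0),(0,0,0)))]; [:: keep ((0,0,0),(-48,0,0),(0,0,0));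
      (((48,0,0),(-168,-24,-24),(0,0,0)), ((96,0,0),(-48,0,0),(0,0,0)));
      (((96,0,0),(-288,-48,-48),(0,0,0)), ((192,0,0),(-144,-48,-48),(0,0,0)));
      (((336,48,24),(-288,-48,-48),(0,0,0)), ((336,48,48),(-144,-48,-48),(0,0,0)));
      (((576,96,48),(-288,-48,-48),(0,0,0)), ((384,96,48),(-144,-48,-48),(0,0,0)));
      (((576,96,48),(-192,-48,-48),(0,0,0)), ((384,96,48),(-48,-48,-48),(0,0,0)))]];
      Stage (far, far) [:: (((288,48,0),(48,0,48),(0,0,0)),
      ((288,48,0),(48,0,48),(0,0,0)), (0,48,0)); (((384,96,48),(-48,-48,0),(0,0,0)),
      ((384,96,48),(-48,-48,0),(0,0,0)), (0,0,48))] [:: [:: keep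
      ((0,0,0),(48,0,0),(0,0,0)); keep ((48,0,0),(24,0,0),(-48,0,0)); keep
      ((96,0,0),(0,0,0),(0,0,0)); keep ((240,0,0),(0,0,0),(0,0,0)); keep
      ((288,0,0),(48,0,48),(0,0,0))]; [:: keep ((0,0,0),(0,0,0),(0,0,0)); keep
      ((48,0,0),(24,0,0),(48,0,0)); keep ((96,0,0),(48,0,0),(0,0,0)); keep
      ((192,0,0),(144,48,48),(0,0,0)); (((288,48,0),(144,48,48),(0,0,0)),
      ((336,48,48),(144,48,48),(0,0,0))); (((288,48,0),(96,48,48),(0,0,0)),
      ((336,48,48),(96,48,48),(0,0,0))); keep ((288,48,0),(48,48,48),(0,0,0))]; [:: keep
      ((288,96,0),(48,0,48),(0,0,0)); keep ((336,96,24),(48,0,48),(0,0,0)); keep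
      ((384,96,48),(48,0,48),(0,0,0)); keep ((384,96,48),(-48,-48,48),(0,0,0))]; [:: keep
      ((288,48,0),(48,-48,48),(0,0,0)); keep ((288,48,0),(0,-48,24),(0,0,0)); keep
      ((288,48,0),(-48,-48,0),(0,0,0)); keep ((384,96,0),(-48,-48,0),(0,0,0))]; [:: keep
      ((0,0,0),(0,0,0),(144,0,0)); keep ((96,0,0),(0,0,0),(144,0,0)); keep
      ((480,96,96),(0,0,0),(144,0,0)); keep ((432,96,96),(0,0,0),(0,0,0)); keep
      ((384,96,96),(-48,-48,0),(0,0,0))]; [:: keep ((0,0,0),(-48,0,0),(0,0,0)); keep
      ((96,0,0),(-48,0,0),(0,0,0)); keep ((192,0,0),(-144,-48,-48),(0,0,0)); keep
      ((336,48,48),(-144,-48,-48),(0,0,0)); (((384,96,48),(-144,-48,-48),(0,0,0)),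
      ((336,48,48),(-96,-48,-48),(0,0,0))); keep ((384,96,48),(-48,-48,-48),(0,0,0))]]].

Local Close Scope Z_scope.

Local Open Scope Z_scope.
(** * Slabs *)

Definition fmove (d : Z) (p : fpt) : fpt := padd (pt d 0 0) p.
Definition fflip (p : fpt) : fpt := (p.1.1, fscale (-1) p.1.2, p.2).
(** In its standard position a cut of the diagram consists of the four points
    N = (1, 0), E = (0, 3), W = (0, 0) and S = (-1, 0), given by their second and
    third coordinates; the strand E runs in front of all the others.
    [pad] leads from the standard position to the cuts of the flattened diagram,
    [cross] is a crossing of the strands N and W, the second one in front, and
    [caps] joins N to E and W to S. *)
Definition pad_edges : seq (fpt * fpt) := edges_of
  [:: [:: pt 0 48 0; pt 96 48 0]; [:: pt 0 0 144; pt 96 0 0];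
      [:: pt 0 0 0; pt 96 (-48) 48]; [:: pt 0 (-48) 0; pt 96 (-48) 0]].

Definition cross_edges : seq (fpt * fpt) := edges_of
  [:: [:: pt 0 48 0; pt 48 24 (-48); pt 96 0 0]; [:: pt 0 0 144; pt 96 0 144];
      [:: pt 0 0 0; pt 48 24 48; pt 96 48 0]; [:: pt 0 (-48) 0; pt 96 (-48) 0]].

Definition caps_edges : seq (fpt * fpt) := edges_of
  [:: [:: pt 0 48 0; pt (-48) 48 96; pt 0 0 144];
      [:: pt 0 0 0; pt (-48) (-24) 0; pt 0 (-48) 0]].

Definition of_vertex (v : vertex) : fpt :=
  pt (48 * Z_of_int v.1.1) (48 * Z_of_int v.1.2) (48 * Z_of_int v.2).
Definition of_diagram (D : diagram) : seq (fpt * fpt) :=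
  [seq (of_vertex e.1, of_vertex e.2) | e <- D].
Local Close Scope Z_scope.

Definition chain (vs : seq vertex) : diagram := zip vs (behead vs).

(** The flattened diagram of a chair in the top tree, of the crossing from which it
    hangs, and of three carets of the bottom comb. *)
Definition gamma : diagram :=
  chain [:: (0, 1, 0); (5, 1, 0); (5, 0, -1); (5, -1, 1); (6, -1, 1)] ++
  chain [:: (0, 0, 0); (1, 1, 2); (3, 1, 2); (3, 0, -1); (3, -1, 1); (4, -1, 1);
            (5, -1, 2); (6, 0, 0)] ++
  chain [:: (0, -1, 1); (1, -1, 2); (2, 0, 0); (3, 1, 3); (4, 0, 0); (3, -1, 2);
            (2, -1, 1); (1, -1, 1); (1, 0, -1); (1, 1, 1); (5, 1, 1); (6, 1, 0)] ++
  chain [:: (0, -1, 0); (6, -1, 0)].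

(** What lies between the two trees where the top and the bottom exchange their
    roles. *)
Definition junction : diagram :=
  chain [:: (0, 0, 0); (1, 1, 2); (2, 0, 0)] ++ chain [:: (0, 1, 0); (2, 1, 0)] ++
  chain [:: (0, -1, 1); (1, -1, 1); (2, -1, 0)] ++
  chain [:: (0, -1, 0); (1, -1, 0); (1, 0, -1); (1, 1, 1); (2, 1, 1)].

Definition start : diagram :=
  chain [:: (2, 1, 0); (1, 1, 1); (0, 0, 0); (1, -1, 2); (2, 0, 0)] ++
  chain [:: (2, -1, 1); (1, -1, 1); (1, 0, -1); (1, 1, 0); (-1, 1, 0); (-1, 0, 0); (-1, -1, 0);
            (2, -1, 0)].

Definition gamma_end : diagram :=
  chain [:: (0, 1, 0); (5, 1, 0); (5, 0, -1); (5, -1, 0); (0, -1, 0)] ++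
  chain [:: (0, 0, 0); (1, 1, 2); (3, 1, 2); (3, 0, -1); (3, -1, 1); (5, -1, 1);
            (6, 0, 0); (5, 1, 1); (1, 1, 1); (1, 0, -1); (1, -1, 1); (2, -1, 1);
            (3, -1, 2); (4, 0, 0); (3, 1, 3); (2, 0, 0); (1, -1, 2); (0, -1, 1)].

Definition junction_end : diagram :=
  chain [:: (0, 1, 0); (1, 1, 0); (1, 0, -1); (1, -1, 0); (0, -1, 0)] ++
  chain [:: (0, 0, 0); (1, 1, 1); (2, 0, 0); (1, -1, 1); (0, -1, 1)].

(** Four strands from a standard cut to the ends of a tangle of radius s in the box
    centred at (3 + s, 0, 0). The strand to the end E passes in front of the box. *)
Definition collar (s : nat) : diagram :=
  chain [:: (0, 1, 0); (2, s.+1%:Z, 0); ((3 + s)%N%:Z, s.+1%:Z, 0); ((3 + s)%N%:Z, s%:Z, 0)] ++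
  chain [:: (0, -1, 0); (2, - s.+1%:Z, 0); ((3 + s)%N%:Z, - s.+1%:Z, 0); ((3 + s)%N%:Z, - s%:Z, 0)] ++
  chain [:: (0, 0, 0); (3, 0, 0)] ++
  chain [:: (0, 0, 3); ((4 + 2 * s)%N%:Z, 0, 3); ((3 + 2 * s)%N%:Z, 0, 0)].

Section Relations.
Variable R : realType.
Notation V := (R3 R).
Local Notation flink1 := (flink (1 : R) 1).
Local Notation evp1 := (evp (1 : R) 1).
Local Notation link := (link_of R).

Definition xshift (d : R) (A : set V) : set V := moved (d, 0, 0) A.
Definition yflip (p : V) : V := (p.1.1, - p.1.2, p.2).
Definition mirror (A : set V) : set V := yflip @` A.

Definition leftward (A : set V) := forall p, A p -> p.1.1 <= 0.
Definition rightward (A : set V) := forall p, A p -> 0 <= p.1.1.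

Lemma evp_c x y z : evp1 (pt x y z) = (zr R x / 48, zr R y / 48, zr R z / 48).
Proof. by rewrite -!(ev_const 1 1). Qed.

Lemma evp_of_vertex v : evp1 (of_vertex v) = point_of R v.
Proof.
rewrite /of_vertex evp_c !zrM /point_of.
have h k : zr R 48 * zr R (Z_of_int k) / 48 = k%:~R.
  by rewrite /zr Z_of_intK mulrAC divff ?mul1r// pnatr_eq0.
by rewrite !h.
Qed.

Lemma link_of_diagram D : link D = flink1 (of_diagram D).
Proof.
apply/seteqP; split=> r.
  move=> [e eD er]; apply/flinkP; exists (of_vertex e.1, of_vertex e.2).
    by apply/mapP; exists e.
  by rewrite /= !evp_of_vertex.
move=> /flinkP[_ /mapP[e eD ->]] /=; rewrite !evp_of_vertex => er; by exists e.
Qed.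

Lemma link_cat D E : link (D ++ E) = link D `|` link E.
Proof. by rewrite !link_of_diagram /of_diagram map_cat flink_cat. Qed.

Lemma image_segment (f : V -> V) (p q : V) :
  (forall t, f (comb t p q) = comb t (f p) (f q)) -> f @` segment p q = segment (f p) (f q).
Proof.
move=> fE; apply/seteqP; split=> [_ [_ [t t01 ->] <-]|_ [t t01 ->]].
  by exists t => //; exact: fE.
by exists (comb t p q); [exists t|rewrite fE].
Qed.

Lemma flink_image (f : V -> V) (g : fpt -> fpt) E :
  (forall t p q, f (comb t p q) = comb t (f p) (f q)) ->
  (forall p, f (evp1 p) = evp1 (g p)) -> f @` flink1 E = flink1 (emap g E).
Proof.
move=> fc fg; elim: E => [|e E IH] /=; first by rewrite image_set0.
by rewrite image_setU image_segment// !fg IH.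
Qed.

Lemma shift_comb (v : V) t p q : comb t p q + v = comb t (p + v) (q + v).
Proof. by congr (_, _, _) => /=; ring. Qed.

Lemma flip_comb t p q : yflip (comb t p q) = comb t (yflip p) (yflip q).
Proof. by congr (_, _, _) => /=; ring. Qed.

Lemma xshift_flink (d : Z) E : xshift (zr R d / 48) (flink1 E) = flink1 (emap (fmove d) E).
Proof.
apply: flink_image => [t p q|p]; first exact: shift_comb.
by rewrite /fmove evpD addrC; congr (_ + _); rewrite /evp /= !ev_const /zr /= !mul0r.
Qed.

Lemma mirror_flink E : mirror (flink1 E) = flink1 (emap fflip E).
Proof.
apply: flink_image => [t p q|p]; first exact: flip_comb.
by congr (_, _, _); rewrite /= evZ /zr /= mulN1r.
Qed.

Lemma script_relation xl ss f g E F (Kl Kr : set V) :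
  (forall p, Kl p -> p.1.1 <= ev (1 : R) 1 xl) -> rightward Kr ->
  fboxes f = [::] -> fboxes g = [::] ->
  same_edges (frame_edges f) E -> same_edges (frame_edges g) F ->
  script_ok covectors xl f ss g ->
  equivalent (Kl `|` (flink1 E `|` xshift (ev (1 : R) 1 (fwall f)) Kr))
             (Kl `|` (flink1 F `|` xshift (ev (1 : R) 1 (fwall g)) Kr)).
Proof.
move=> Klx Krx fb gb fE gF ok.
have cs0 : fits (1 : R) 1 [::] (fboxes f) by rewrite fb; split.
have := script_sound (lexx 1) (lexx 1) Klx Krx cs0 ok.
rewrite /frame_set /ctx fb gb /place /= !setU0.
by rewrite (flink_same _ _ fE) (flink_same _ _ gF) ![moved _ _ `|` _]setUC.
Qed.

Definition pad : set V := flink1 pad_edges.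
Definition cross : set V := flink1 cross_edges.
Definition caps : set V := flink1 caps_edges.

Lemma mirrorU A B : mirror (A `|` B) = mirror A `|` mirror B.
Proof. exact: image_setU. Qed.
Lemma xshiftU d A B : xshift d (A `|` B) = xshift d A `|` xshift d B.
Proof. exact: image_setU. Qed.
Lemma xshift_xshift d e A : xshift d (xshift e A) = xshift (d + e) A.
Proof. by rewrite /xshift moved_moved; congr moved; congr (_, _, _); rewrite /= ?addr0// addrC. Qed.
Lemma yflipK : involutive yflip.
Proof. by move=> [[x y] z]; rewrite /yflip /= opprK. Qed.
Lemma mirrorK : involutive mirror.
Proof. by move=> A; rewrite /mirror image_comp (_ : _ \o _ = id) ?image_id//; apply/funext => p; exact: yflipK. Qed.
Lemma mirror_xshift d A : mirror (xshift d A) = xshift d (mirror A).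
Proof. by rewrite /mirror /xshift /moved !image_comp; congr (_ @` _); apply/funext => p; congr (_, _, _); rewrite /= !addr0. Qed.

Lemma ev_unit (k : Z) (w : R) : zr R k = w * 48 -> ev (1 : R) 1 (fconst k) = w.
Proof. by move=> e; rewrite ev_const e mulfK// pnatr_eq0. Qed.

Lemma slab_cat E F (d : R) (k : Z) X : zr R k = d * 48 ->
  flink1 E `|` xshift d (flink1 F `|` X) = flink1 (E ++ emap (fmove k) F) `|` xshift d X.
Proof.
move=> kd; have {1 2}-> : d = zr R k / 48 by rewrite kd mulfK// pnatr_eq0.
by rewrite xshiftU xshift_flink flink_cat setUA.
Qed.

(** A chair contributes one crossing. *)
Lemma gamma_relation Kl Kr : leftward Kl -> rightward Kr ->
  equivalent (Kl `|` (pad `|` xshift 2 (link gamma `|` xshift 6 Kr)))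
             (Kl `|` (cross `|` xshift 2 (pad `|` xshift 2 Kr))).
Proof.
move=> Kll Krr; have e2 : zr R 96 = 2 * 48 by rewrite -natrM.
rewrite /pad /cross link_of_diagram !(slab_cat _ _ _ e2) !xshift_xshift.
pose F := Frame (fconst 384) [::]
  [:: [:: pt 0 48 0; pt 96 48 0; pt 336 48 0; pt 336 0 (-48); pt 336 (-48) 48; pt 384 (-48) 48];
      [:: pt 0 0 144; pt 96 0 0; pt 144 48 96; pt 240 48 96; pt 240 0 (-48); pt 240 (-48) 48;
          pt 288 (-48) 48; pt 336 (-48) 96; pt 384 0 0];
      [:: pt 0 0 0; pt 96 (-48) 48; pt 144 (-48) 96; pt 192 0 0; pt 240 48 144; pt 288 0 0;
          pt 240 (-48) 96; pt 192 (-48) 48; pt 144 (-48) 48; pt 144 0 (-48); pt 144 48 48;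
          pt 336 48 48; pt 384 48 0];
      [:: pt 0 (-48) 0; pt 96 (-48) 0; pt 384 (-48) 0]].
pose G := Frame (fconst 192) [::]
  [:: [:: pt 0 48 0; pt 48 24 (-48); pt 96 0 0; pt 192 (-48) 48];
      [:: pt 0 0 144; pt 96 0 144; pt 192 0 0];
      [:: pt 0 0 0; pt 48 24 48; pt 96 48 0; pt 192 48 0];
      [:: pt 0 (-48) 0; pt 96 (-48) 0; pt 192 (-48) 0]].
have := @script_relation (fconst 0) gamma_script F G
  (pad_edges ++ emap (fmove 96) (of_diagram gamma))
  (cross_edges ++ emap (fmove 96) pad_edges) Kl Kr.
have -> : ev (1 : R) 1 (fwall F) = 2 + 6 by rewrite -natrD; apply: ev_unit; rewrite -natrM.
have -> : ev (1 : R) 1 (fwall G) = 2 + 2 by rewrite -natrD; apply: ev_unit; rewrite -natrM.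
apply=> //.
- by move=> p /Kll; rewrite ev_const /zr /= mul0r.
all: by vm_compute.
Qed.

(** A junction contributes one crossing too, and reflects all that follows. *)
Lemma junction_relation Kl Kr : leftward Kl -> rightward Kr ->
  equivalent (Kl `|` (pad `|` xshift 2 (link junction `|` xshift 2 Kr)))
             (Kl `|` (mirror cross `|` xshift 2 (mirror pad `|` xshift 2 Kr))).
Proof.
move=> Kll Krr; have e2 : zr R 96 = 2 * 48 by rewrite -natrM.
rewrite /pad /cross link_of_diagram !mirror_flink !(slab_cat _ _ _ e2) !xshift_xshift.
pose F := Frame (fconst 192) [::]
  [:: [:: pt 0 48 0; pt 96 48 0; pt 192 48 0]; [:: pt 0 0 144; pt 96 0 0; pt 144 48 96; pt 192 0 0];
      [:: pt 0 0 0; pt 96 (-48) 48; pt 144 (-48) 48; pt 192 (-48) 0];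
      [:: pt 0 (-48) 0; pt 96 (-48) 0; pt 144 (-48) 0; pt 144 0 (-48); pt 144 48 48; pt 192 48 48]].
pose G := Frame (fconst 192) [::]
  [:: [:: pt 0 48 0; pt 96 48 0; pt 192 48 0]; [:: pt 0 0 144; pt 96 0 144; pt 192 0 0];
      [:: pt 0 0 0; pt 48 (-24) 48; pt 96 (-48) 0; pt 192 (-48) 0];
      [:: pt 0 (-48) 0; pt 48 (-24) (-48); pt 96 0 0; pt 192 48 48]].
have := @script_relation (fconst 0) junction_script F G
  (pad_edges ++ emap (fmove 96) (of_diagram junction))
  (emap fflip cross_edges ++ emap (fmove 96) (emap fflip pad_edges)) Kl Kr.
have -> : ev (1 : R) 1 (fwall F) = 2 + 2 by rewrite -natrD; apply: ev_unit; rewrite -natrM.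
apply=> //.
- by move=> p /Kll; rewrite ev_const /zr /= mul0r.
all: by vm_compute.
Qed.

(** The two root carets only close up the diagram on the left. *)
Lemma start_relation Kr : rightward Kr ->
  equivalent (link start `|` xshift 2 Kr) (caps `|` (pad `|` xshift 2 Kr)).
Proof.
move=> Krr; rewrite /pad /caps link_of_diagram setUA -flink_cat.
pose F := Frame (fconst 96) [::]
  [:: [:: pt 96 48 0; pt 48 48 48; pt 0 0 0; pt 48 (-48) 96; pt 96 0 0];
      [:: pt 96 (-48) 48; pt 48 (-48) 48; pt 48 0 (-48); pt 48 48 0; pt (-48) 48 0;
          pt (-48) 0 0; pt (-48) (-48) 0; pt 96 (-48) 0]].
pose G := Frame (fconst 96) [::]
  [:: [:: pt 96 48 0; pt 0 48 0; pt (-48) 48 96; pt 0 0 144; pt 96 0 0];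
      [:: pt 96 (-48) 48; pt 0 0 0; pt (-48) (-24) 0; pt 0 (-48) 0; pt 96 (-48) 0]].
have := @script_relation (fconst (-96)) start_script F G
  (of_diagram start) (caps_edges ++ pad_edges) set0 Kr.
have -> : ev (1 : R) 1 (fwall F) = 2 by apply: ev_unit; rewrite -natrM.
rewrite !set0U; apply=> //.
all: by vm_compute.
Qed.

Lemma collar_end E F (ss : seq stage) (Kl : set V) f g : leftward Kl ->
  fboxes f = [::] -> fboxes g = [::] ->
  same_edges (frame_edges f) E -> same_edges (frame_edges g) F ->
  script_ok covectors (fconst 0) f ss g ->
  equivalent (Kl `|` flink1 E) (Kl `|` flink1 F).
Proof.
move=> Kll fb gb fE gF ok.
have Klx p : Kl p -> p.1.1 <= ev (1 : R) 1 (fconst 0).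
  by move=> /Kll; rewrite ev_const /zr /= mul0r.
have := @script_relation _ _ _ _ E F Kl set0 Klx _ fb gb fE gF ok.
by rewrite /xshift /moved !image_set0 !setU0; apply.
Qed.

(** The one-crossing tangle in its collar: the innermost slab, whether a chair or a
    junction, contributes a single crossing and closes up the diagram on the right. *)
Definition lone : set V := link (collar 1) `|` xshift 4 (link (arcs one_crossing)).

Lemma loneE : lone = flink1 (of_diagram (collar 1) ++
   emap (fmove 192) (of_diagram (arcs one_crossing))).
Proof.
have -> : lone = link (collar 1) `|` xshift 4 (link (arcs one_crossing) `|` set0) by rewrite setU0.
have e4 : zr R 192 = 4 * 48 by rewrite -natrM.
by rewrite !link_of_diagram (slab_cat _ _ _ e4) /xshift /moved image_set0 setU0.
Qed.

Lemma mirror_lone : mirror lone = lone.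
Proof. by rewrite loneE mirror_flink; apply: flink_same; vm_compute. Qed.

Lemma gamma_end_relation Kl : leftward Kl ->
  equivalent (Kl `|` (pad `|` xshift 2 (link gamma_end))) (Kl `|` lone).
Proof.
move=> Kll; rewrite -[link gamma_end]setU0.
have e2 : zr R 96 = 2 * 48 by rewrite -natrM.
rewrite loneE /pad !link_of_diagram (slab_cat _ _ _ e2) /xshift /moved image_set0 setU0.
pose F := Frame far [::]
  [:: [:: pt 0 48 0; pt 96 48 0; pt 336 48 0; pt 336 0 (-48); pt 336 (-48) 0; pt 96 (-48) 0;
          pt 0 (-48) 0];
      [:: pt 0 0 144; pt 96 0 0; pt 144 48 96; pt 240 48 96; pt 240 0 (-48); pt 240 (-48) 48;
          pt 336 (-48) 48; pt 384 0 0; pt 336 48 48; pt 144 48 48; pt 144 0 (-48);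
          pt 144 (-48) 48; pt 192 (-48) 48; pt 240 (-48) 96; pt 288 0 0; pt 240 48 144;
          pt 192 0 0; pt 144 (-48) 96; pt 96 (-48) 48; pt 0 0 0]].
pose G := Frame far [::]
  [:: [:: pt 0 48 0; pt 96 96 0; pt 192 96 0; pt 192 48 0; pt 192 0 (-48); pt 192 (-48) 0;
          pt 192 (-96) 0; pt 96 (-96) 0; pt 0 (-48) 0];
      [:: pt 0 0 144; pt 288 0 144; pt 240 0 0; pt 192 0 48; pt 144 0 0; pt 0 0 0]].
by apply: (@collar_end _ _ gamma_end_script _ F G) => //; vm_compute.
Qed.

Lemma junction_end_relation Kl : leftward Kl ->
  equivalent (Kl `|` (pad `|` xshift 2 (link junction_end))) (Kl `|` lone).
Proof.
move=> Kll; rewrite -[link junction_end]setU0.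
have e2 : zr R 96 = 2 * 48 by rewrite -natrM.
rewrite loneE /pad !link_of_diagram (slab_cat _ _ _ e2) /xshift /moved image_set0 setU0.
pose F := Frame far [::]
  [:: [:: pt 0 48 0; pt 96 48 0; pt 144 48 0; pt 144 0 (-48); pt 144 (-48) 0; pt 96 (-48) 0;
          pt 0 (-48) 0];
      [:: pt 0 0 0; pt 96 (-48) 48; pt 144 (-48) 48; pt 192 0 0; pt 144 48 48; pt 96 0 0; pt 0 0 144]].
pose G := Frame far [::]
  [:: [:: pt 0 48 0; pt 96 96 0; pt 192 96 0; pt 192 48 0; pt 192 0 (-48); pt 192 (-48) 0;
          pt 192 (-96) 0; pt 96 (-96) 0; pt 0 (-48) 0];
      [:: pt 0 0 0; pt 144 0 0; pt 192 0 48; pt 240 0 0; pt 288 0 144; pt 0 0 144]].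
by apply: (@collar_end _ _ junction_end_script _ F G) => //; vm_compute.
Qed.

End Relations.

(** * Tangles with symbolic radii *)

Definition join_frame (a b : nat) : diagram :=
  let s := (a + b + 2)%N in
  let g := translate (- b.+1%:Z) b.+1%:Z in
  let f := translate a.+1%:Z (- a.+1%:Z) in
  chain [:: g (endE a); (a.+1%:Z, b.+1%:Z, 0); f (endN b)] ++
  chain [:: g (endS a); (- b.+1%:Z, - a.+1%:Z, 0); f (endW b)] ++
  [:: (endN s, g (endN a)); (endW s, g (endW a));
      (f (endE b), endE s); (f (endS b), endS s)].

Definition closure_frame (s : nat) : diagram :=
  chain [:: endN s; (s.+1%:Z, s.+1%:Z, 0); endE s] ++
  chain [:: endS s; (- s.+1%:Z, - s.+1%:Z, 0); endW s].

Local Open Scope Z_scope.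
Definition lf (k i j : Z) : lform := (48 * k, 48 * i, 48 * j).
Definition lsucc (f : lform) : lform := fadd f (fconst 48).
Definition lneg (f : lform) : lform := fscale (-1) f.
Definition l0 : lform := fconst 0.
Definition level (x y : lform) : fpt := (x, y, l0).

(** [collar], [join_frame] and [closure_frame] for radii that are linear forms. *)
Definition collar_sym (s : lform) : seq (fpt * fpt) := edges_of
  [:: [:: pt 0 48 0; level (fconst 96) (lsucc s); level (fadd (fconst 144) s) (lsucc s);
          level (fadd (fconst 144) s) s];
      [:: pt 0 (-48) 0; level (fconst 96) (lneg (lsucc s));
          level (fadd (fconst 144) s) (lneg (lsucc s)); level (fadd (fconst 144) s) (lneg s)];
      [:: pt 0 0 0; pt 144 0 0];
      [:: pt 0 0 144; (fadd (fconst 192) (fscale 2 s), l0, fconst 144);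
          level (fadd (fconst 144) (fscale 2 s)) l0]].

Definition join_sym (a b : lform) : seq (fpt * fpt) :=
  let s := fadd (fadd a b) (fconst 96) in
  let g := fun x y => level (fsub x (lsucc b)) (fadd y (lsucc b)) in
  let f := fun x y => level (fadd x (lsucc a)) (fsub y (lsucc a)) in
  edges_of [:: [:: g a l0; level (lsucc a) (lsucc b); f l0 b];
     [:: g l0 (lneg a); level (lneg (lsucc b)) (lneg (lsucc a)); f (lneg b) l0];
     [:: level l0 s; g l0 a]; [:: level (lneg s) l0; g (lneg a) l0];
     [:: f b l0; level s l0]; [:: f l0 (lneg b); level l0 (lneg s)]].

Definition closure_sym (s : lform) : seq (fpt * fpt) := edges_of
  [:: [:: level l0 s; level (lsucc s) (lsucc s); level s l0];
      [:: level l0 (lneg s); level (lneg (lsucc s)) (lneg (lsucc s)); level (lneg s) l0]].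
Local Close Scope Z_scope.

Section Tangles.
Variable R : realType.
Notation V := (R3 R).
Local Notation link := (link_of R).

Lemma link_cons e D : link (e :: D) = segment (point_of R e.1) (point_of R e.2) `|` link D.
Proof.
apply/seteqP; split=> r.
  by move=> [f]; rewrite inE => /orP[/eqP -> fr|fD fr]; [left|right; exists f].
by case=> [er|[f fD fr]]; [exists e; rewrite ?mem_head|exists f; rewrite // inE fD orbT].
Qed.

Lemma link_nil : link [::] = set0.
Proof. by apply/seteqP; split=> // r []. Qed.

Lemma link_image (f : V -> V) (g : vertex -> vertex) D :
  (forall t p q, f (comb t p q) = comb t (f p) (f q)) ->
  (forall v, f (point_of R v) = point_of R (g v)) ->
  f @` link D = link (map_diagram g D).
Proof.
move=> fc fg; elim: D => [|e D IH]; first by rewrite link_nil image_set0.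
by rewrite /map_diagram /= !link_cons image_setU image_segment// !fg IH.
Qed.

Lemma link_translate (x y : int) D :
  link (map_diagram (translate x y) D) = moved (x%:~R, y%:~R, 0) (link D).
Proof.
symmetry; apply: link_image => [t p q|v]; first exact: shift_comb.
by congr (_, _, _); rewrite /= ?addr0// intrD.
Qed.

Lemma link_flip D : link (map_diagram flip D) = mirror (link D).
Proof.
symmetry; apply: link_image => [t p q|v]; first exact: flip_comb.
by congr (_, _, _); rewrite /= intrN.
Qed.

Definition tlink (T : tangle) : set V := link (arcs T).

Lemma join_link G F : tlink (diag_join G F) =
  moved (- (Defs.radius F).+1%:R, (Defs.radius F).+1%:R, 0) (tlink G) `|`
  moved ((Defs.radius G).+1%:R, - (Defs.radius G).+1%:R, 0) (tlink F) `|`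
  link (join_frame (Defs.radius G) (Defs.radius F)).
Proof.
have -> : tlink (diag_join G F) = link
   (map_diagram (translate (- (Defs.radius F).+1%:Z) (Defs.radius F).+1%:Z) (arcs G) ++
    map_diagram (translate (Defs.radius G).+1%:Z (- (Defs.radius G).+1%:Z)) (arcs F) ++
    join_frame (Defs.radius G) (Defs.radius F)) by [].
by rewrite !link_cat !link_translate !intrN -!pmulrn setUA.
Qed.

Lemma closure_link T : link (closure_of T) = tlink T `|` link (closure_frame (Defs.radius T)).
Proof. by rewrite /tlink -link_cat. Qed.

Variables (x y : R).
Local Notation ev := (ev x y).
Local Notation evpxy := (evp x y).

Lemma ev1 f : ev (lsucc f) = ev f + 1.
Proof. by rewrite evD ev_const divff// pnatr_eq0. Qed.
Lemma evN f : ev (lneg f) = - ev f.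
Proof. by rewrite evZ /zr /= mulN1r. Qed.
Lemma ev_l0 : ev l0 = 0.
Proof. by rewrite ev_const /zr /= mul0r. Qed.
Lemma ev_k (k : Z) (w : R) : zr R k = w * 48 -> ev (fconst k) = w.
Proof. by move=> e; rewrite ev_const e mulfK// pnatr_eq0. Qed.

Definition evE := (evD, evB, evZ, evN, ev1, ev_l0).

Lemma flink_sym E D :
  [seq (evpxy e.1, evpxy e.2) | e <- E] = [seq (point_of R e.1, point_of R e.2) | e <- D] ->
  flink x y E = link D.
Proof.
elim: E D => [|e E IH] [|d D] //=; first by rewrite link_nil.
move=> h; rewrite link_cons (IH D (congr1 behead h)).
have e1 : evpxy e.1 = point_of R d.1 := congr1 (fun s : seq (V * V) => (head (0, 0) s).1) h.
have e2 : evpxy e.2 = point_of R d.2 := congr1 (fun s : seq (V * V) => (head (0, 0) s).2) h.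
by rewrite e1 e2.
Qed.

Lemma cons_eq (T : Type) (u v : T) s t : u = v -> s = t -> u :: s = v :: t.
Proof. by move=> -> ->. Qed.
Lemma pair_eq (T U : Type) (u v : T) (s t : U) : u = v -> s = t -> (u, s) = (v, t).
Proof. by move=> -> ->. Qed.
Local Ltac coords := repeat (apply: cons_eq || apply: pair_eq) => //; ring.

Lemma collar_symE s f : ev f = s%:R -> flink x y (collar_sym f) = link (collar s).
Proof.
move=> fs; apply: flink_sym; rewrite /= /level /evp /point_of /=.
have -> : ev (fconst 96) = 2 by apply: ev_k; rewrite -natrM.
have -> : ev (fconst 48) = 1 by apply: ev_k; rewrite mul1r.
have -> : ev (fconst (-48)) = -1 by apply: ev_k; rewrite mulN1r.
rewrite !evE fs.
have -> : ev (fconst 144) = 3 by apply: ev_k; rewrite -natrM.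
have -> : ev (fconst 192) = 4 by apply: ev_k; rewrite -natrM.
have -> : zr R 2 = 2 by [].
by coords.
Qed.

Lemma join_symE a b f g : ev f = a%:R -> ev g = b%:R ->
  flink x y (join_sym f g) = link (join_frame a b).
Proof.
move=> fa gb; apply: flink_sym; rewrite /= /level /evp /point_of /= !evE fa gb.
have -> : ev (fconst 96) = 2 by apply: ev_k; rewrite -natrM.
by coords.
Qed.

Lemma closure_symE s f : ev f = s%:R -> flink x y (closure_sym f) = link (closure_frame s).
Proof.
move=> fs; apply: flink_sym; rewrite /= /level /evp /point_of /= !evE fs.
by coords.
Qed.

End Tangles.

(** * Collared tangles *)

Definition tidy (f : frame) : frame :=
  Frame (fwall f) (fboxes f) (map straighten (fstrands f)).
Definition first_frame (ss : seq stage) : frame :=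
  tidy (source (head (Stage (far, far) [::] [::]) ss)).
Definition last_frame (ss : seq stage) : frame :=
  tidy (target (last (Stage (far, far) [::] [::]) ss)).

Definition constant_point (p : fpt) : bool :=
  p == (fconst p.1.1.1.1, fconst p.1.2.1.1, fconst p.2.1.1).

(** The tangles met here stay between heights -1 and 1. *)
Definition inside (s : nat) (v : vertex) : bool :=
  [&& - s%:Z <= v.1.1, v.1.1 <= s%:Z, - s%:Z <= v.1.2, v.1.2 <= s%:Z, -1 <= v.2 & v.2 <= 1].

Definition bounded_tangle (T : tangle) : bool :=
  (1 <= Defs.radius T)%N &&
  all (fun e => inside (Defs.radius T) e.1 && inside (Defs.radius T) e.2) (arcs T).

Lemma bounded_crossing : bounded_tangle one_crossing.
Proof. by []. Qed.

Lemma bounded_join G F : bounded_tangle G -> bounded_tangle F -> bounded_tangle (diag_join G F).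
Proof.
move=> /andP[g1 /allP bG] /andP[f1 /allP bF]; apply/andP; split; first by rewrite /=; lia.
rewrite !all_cat !all_map; apply/and3P; split.
- apply/allP => e /bG; rewrite /inside /=; lia.
- apply/allP => e /bF; rewrite /inside /=; lia.
- rewrite /inside /=; lia.
Qed.

Lemma bounded_flip T : bounded_tangle T -> bounded_tangle (tangleR T).
Proof.
move=> /andP[t1 /allP bT]; apply/andP; split=> //; rewrite all_map.
by apply/allP => e /bT; rewrite /inside /=; lia.
Qed.

Lemma bounded_crossings m : bounded_tangle (crossings m).
Proof. by rewrite /crossings; elim: m.-1 => //= k; exact: bounded_join bounded_crossing. Qed.

Section TangleMoves.
Variable R : realType.
Notation V := (R3 R).
Local Notation link := (link_of R).
Local Notation tlink := (@tlink R).

Definition collared (s : nat) (A : set V) : set V :=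
  link (collar s) `|` xshift (3 + s)%:R A.

Lemma tangle_in_box T : bounded_tangle T -> in_box (Defs.radius T)%:R (tlink T).
Proof.
move=> /andP[_ /allP bT] p [e /bT /andP[in1 in2] [t /andP[t0 t1] ->]] /=.
have conv (m : nat) (i j : int) : - m%:Z <= i -> i <= m%:Z -> - m%:Z <= j -> j <= m%:Z ->
    (- m%:R : R) <= (1 - t) * i%:~R + t * j%:~R <= m%:R.
  rewrite -!(ler_int R) intrN -!pmulrn => i1 i2 j1 j2.
  have t' : 0 <= 1 - t by lra.
  have := ler_wpM2l t' i1; have := ler_wpM2l t' i2.
  have := ler_wpM2l t0 j1; have := ler_wpM2l t0 j2.
  by move=> *; apply/andP; split; lra.
have /and5P[x1 x2 y1 y2 /andP[z1 z2]] := in1.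
have /and5P[x3 x4 y3 y4 /andP[z3 z4]] := in2.
by split; [exact: conv|exact: conv|exact: (conv 1%N)].
Qed.

Section SymbolicRadii.
Variables (x y : R).
Local Notation flinkxy := (flink x y).
Local Notation evpxy := (evp x y).
Local Notation ev := (ev x y).

Lemma evp_const p : constant_point p -> evpxy p = evp 1 1 p.
Proof. by move=> /eqP ->; rewrite /evp /= !ev_const. Qed.

Lemma flink_const E : all (fun e => constant_point e.1 && constant_point e.2) E ->
  flink 1 1 E = flinkxy E.
Proof. by elim: E => //= e E IH /andP[/andP[c1 c2] cE]; rewrite IH// !evp_const. Qed.

Lemma link_flink D : link D = flinkxy (of_diagram D).
Proof.
rewrite link_of_diagram; apply: flink_const; elim: D => //= e D ->.
by rewrite andbT /constant_point !eqxx.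
Qed.

Lemma moved_flink p E : moved (evpxy p) (flinkxy E) = flinkxy (emap (padd p) E).
Proof.
elim: E => [|e E IH] /=; first by rewrite /moved image_set0.
rewrite /moved image_setU image_segment; last by move=> t; exact: shift_comb.
by rewrite -/(moved _ _) IH !evpD ![evpxy p + _]addrC.
Qed.

Lemma zr_opp (k : Z) : zr R (Z.opp k) = - zr R k.
Proof. by rewrite /zr rmorphN intrN. Qed.

Lemma zrE : (zr R 0 = 0) * (zr R 1 = 1) * (zr R 2 = 2%:R) * (zr R 3 = 3%:R) * (zr R 4 = 4%:R) *
  (zr R 5 = 5%:R) * (zr R 6 = 6%:R) * (zr R 7 = 7%:R) * (zr R 8 = 8%:R) * (zr R 9 = 9%:R) *
  (zr R 12 = 12%:R) * (zr R (-1) = - 1%:R) * (zr R (-2) = - 2%:R) * (zr R (-4) = - 4%:R).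
Proof. by do ?split; rewrite ?(zr_opp 1) ?(zr_opp 2) ?(zr_opp 4). Qed.

Lemma ev_lf k i j : ev (lf k i j) = zr R k + zr R i * x + zr R j * y.
Proof.
have -> : ev (lf k i j) =
  (zr R (Z.mul 48 k) + zr R (Z.mul 48 i) * x + zr R (Z.mul 48 j) * y) / 48 by [].
rewrite !zrM (_ : zr R 48 = 48)// -!mulrA -!mulrDr mulrAC divff ?mul1r//.
Qed.

End SymbolicRadii.

Lemma xshift_moved d u v w A : xshift d (moved (u, v, w) A) = moved (d + u, v, w) A :> set V.
Proof. by rewrite /xshift moved_moved; congr moved; congr (_, _, _); rewrite /= ?addr0// addrC. Qed.

Lemma movedU v A B : moved v (A `|` B) = moved v A `|` moved v B :> set V.
Proof. exact: image_setU. Qed.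

Lemma moved_eq (v w : V) A : v.1.1 = w.1.1 -> v.1.2 = w.1.2 -> v.2 = w.2 ->
  moved v A = moved w A.
Proof. by case: v w => [[v1 v2] v3] [[w1 w2] w3] /= -> -> ->. Qed.

(** The isotopy described by a script without anything on its right. *)
Lemma content_relation x y (x1 : 1 <= x) (y1 : 1 <= y) xl ss Kl cs E F (A B : set V) :
  (forall p, Kl p -> p.1.1 <= ev x y xl) -> fits x y cs (fboxes (first_frame ss)) ->
  A = flink x y E `|` place x y cs (map fst (fboxes (first_frame ss))) ->
  B = flink x y F `|` place x y cs (map fst (fboxes (last_frame ss))) ->
  [&& same_edges (frame_edges (first_frame ss)) E, same_edges (frame_edges (last_frame ss)) F &
  script_ok covectors xl (first_frame ss) ss (last_frame ss)] ->
  equivalent (Kl `|` A) (Kl `|` B).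
Proof.
move=> Klx cf -> -> /and3P[fE gF ok].
have := script_sound x1 y1 Klx (Kr := set0) (fun _ => False_ind _) cf ok.
rewrite /frame_set /ctx /moved !image_set0 !set0U.
by rewrite (flink_same x y fE) (flink_same x y gF).
Qed.

(** Swing the arc that joins N to E in front of the tangle, and the other one to the
    left. *)
Lemma closure_relation T : bounded_tangle T ->
  equivalent (xshift (3 + Defs.radius T)%:R (link (closure_of T)))
             (@caps R `|` collared (Defs.radius T) (tlink T)).
Proof.
move=> bT; set s := Defs.radius T; set x : R := s%:R.
have x1 : 1 <= x by rewrite /x ler1n; case/andP: bT.
have es : ev x 1 (lf 0 1 0) = s%:R.
  by rewrite ev_lf /zr /= mul0r mul1r add0r addr0.
pose p := level (lf 3 1 0) l0.
have ec : evp x 1 p = ((3 + s)%:R, 0, 0).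
  by congr (_, _, _); rewrite ?ev_l0// ev_lf /zr /= mul0r mul1r addr0 natrD.
rewrite -[xshift _ _]set0U -[@caps R `|` _]set0U.
apply: (@content_relation x 1 x1 (lexx 1) (fconst (-96)) closure_script set0 [:: tlink T]
  (emap (padd p) (closure_sym (lf 0 1 0))) (caps_edges ++ collar_sym (lf 0 1 0)));
  [by []| | | |by vm_compute].
- by split=> // -[c bx] [<-|//]; rewrite es; exact: tangle_in_box.
- rewrite closure_link xshiftU -(moved_flink _ _ p) (closure_symE es) ec setUC.
  by rewrite /xshift -ec /place /= setU0.
- rewrite flink_cat (collar_symE es) /collared setUA -(@flink_const x 1)//.
  by congr (_ `|` _); rewrite /xshift -ec /place /= setU0.
Qed.

(** The leftmost crossing can be pulled out of the collar, because the strand to E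
    passes in front. *)
Lemma join_relation T Kl : bounded_tangle T -> leftward Kl ->
  equivalent
    (Kl `|` collared (Defs.radius (diag_join one_crossing T)) (tlink (diag_join one_crossing T)))
    (Kl `|` (@cross R `|` xshift 2 (collared (Defs.radius T) (tlink T)))).
Proof.
move=> bT Kll; set b := Defs.radius T; set x : R := b%:R.
have x1 : 1 <= x by rewrite /x ler1n; case/andP: bT.
have eb : ev x 1 (lf 0 1 0) = b%:R.
  by rewrite ev_lf /zr /= mul0r mul1r add0r addr0.
have e1 : ev x 1 (fconst 48) = 1%:R by apply: ev_k; rewrite mul1r.
have er : ev x 1 (lf 3 1 0) = (1 + b + 2)%:R.
  by rewrite ev_lf !zrE !natrD -/x; ring.
pose p := level (lf 5 0 0) (lf 1 1 0); pose q := level (lf 6 1 0) l0.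
have ep : evp x 1 p = ((3 + (1 + b + 2))%:R + - b.+1%:R, b.+1%:R, 0).
  by congr (_, _, _); rewrite ?ev_l0// ev_lf !zrE -?natr1 ?natrD -/x; ring.
pose u := level (lf 8 1 0) (lf (-2) 0 0); pose v := level (lf 5 1 0) l0.
have eu : evp x 1 u = ((3 + (1 + b + 2))%:R + 2%:R, - 2%:R, 0).
  by congr (_, _, _); rewrite ?ev_l0// ev_lf !zrE ?natrD -/x; ring.
have ev : evp x 1 v = (2 + (3 + b)%:R, 0, 0).
  by congr (_, _, _); rewrite ?ev_l0// ev_lf !zrE ?natrD -/x; ring.
have e2 : evp x 1 (pt 96 0 0) = (2, 0, 0).
  by congr (_, _, _); [apply: ev_k; rewrite -natrM|exact: ev_l0|exact: ev_l0].
have eq : evp x 1 q = ((3 + (1 + b + 2))%:R, 0, 0).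
  by congr (_, _, _); rewrite ?ev_l0// ev_lf !zrE -?natr1 ?natrD -/x; ring.
apply: (@content_relation x 1 x1 (lexx 1) (fconst 0) join_script Kl [:: tlink T]
  (collar_sym (lf 3 1 0) ++ emap (padd p) (of_diagram (arcs one_crossing)) ++
   emap (padd q) (join_sym (fconst 48) (lf 0 1 0)))
  (cross_edges ++ emap (fmove 96) (collar_sym (lf 0 1 0)))); [| | | |by vm_compute].
- by move=> z /Kll; rewrite ev_const /zr /= mul0r.
- by split=> // -[c bx] [<-|//]; rewrite eb; exact: tangle_in_box.
- rewrite /collared join_link !xshiftU !xshift_moved.
  rewrite (flink_cat _ _ (collar_sym _)) (flink_cat _ _ (emap (padd p) _)) (collar_symE er).
  rewrite -(moved_flink _ _ p) -link_flink -(moved_flink _ _ q) (join_symE e1 eb) ep eq.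
  rewrite [place _ _ _ _](_ : _ = moved (evp x 1 u) (tlink T)).
    by rewrite eu -!setUA; congr (_ `|` (_ `|` _)); rewrite setUC.
  by rewrite /place /= setU0.
- rewrite /collared !xshiftU (flink_cat _ _ cross_edges) xshift_moved -setUA.
  rewrite /cross -(@flink_const x 1)//; congr (_ `|` (_ `|` _)).
    by rewrite -(moved_flink _ _ (pt 96 0 0)) (collar_symE eb) e2.
  by rewrite -ev /place /= setU0.
Qed.

(** The same for a crossing which is nested one level deeper. This is what makes the
    juxtaposition of tangles associative, up to isotopy. *)
Lemma join2_relation G T Kl : bounded_tangle G -> bounded_tangle T -> leftward Kl ->
  equivalent
    (Kl `|` collared (Defs.radius (diag_join (diag_join one_crossing G) T))
              (tlink (diag_join (diag_join one_crossing G) T)))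
    (Kl `|` (@cross R `|`
             xshift 2 (collared (Defs.radius (diag_join G T)) (tlink (diag_join G T))))).
Proof.
move=> bG bT Kll; set a := Defs.radius G; set b := Defs.radius T.
set x : R := a%:R; set y : R := b%:R.
have x1 : 1 <= x by rewrite /x ler1n; case/andP: bG.
have y1 : 1 <= y by rewrite /y ler1n; case/andP: bT.
pose at2 u v w u' v' w' := level (lf u v w) (lf u' v' w').
have at2E u v w u' v' w' : evp x y (at2 u v w u' v' w') =
    (zr R u + zr R v * x + zr R w * y, zr R u' + zr R v' * x + zr R w' * y, 0).
  by congr (_, _, _); rewrite ?ev_l0// ev_lf.
have ea : ev x y (lf 0 1 0) = a%:R by rewrite ev_lf !zrE -/x; ring.
have eb : ev x y (lf 0 0 1) = b%:R by rewrite ev_lf !zrE -/y; ring.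
have e1 : ev x y (fconst 48) = 1%:R by apply: ev_k; rewrite mul1r.
have e3 : ev x y (lf 3 1 0) = (1 + a + 2)%:R by rewrite ev_lf !zrE !natrD -/x; ring.
have es : ev x y (lf 5 1 1) = (1 + a + 2 + b + 2)%:R.
  by rewrite ev_lf !zrE !natrD -/x -/y; ring.
have et : ev x y (lf 2 1 1) = (a + b + 2)%:R.
  by rewrite ev_lf !zrE !natrD -/x -/y; ring.
pose p1 := at2 6 0 0 2 1 1; pose p2 := at2 7 1 0 1 0 1; pose p3 := at2 8 1 1 0 0 0.
pose q1 := at2 7 1 1 0 0 0.
pose g := at2 9 1 0 (-1) 0 1; pose t := at2 12 2 1 (-4) (-1) 0.
pose g' := at2 6 1 0 1 0 1; pose t' := at2 8 2 1 (-1) (-1) 0.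
have e2 : evp x y (pt 96 0 0) = (2, 0, 0).
  by congr (_, _, _); [apply: ev_k; rewrite -natrM|exact: ev_l0|exact: ev_l0].
apply: (@content_relation x y x1 y1 (fconst 0) join2_script Kl [:: tlink G; tlink T]
  (collar_sym (lf 5 1 1) ++ emap (padd p1) (of_diagram (arcs one_crossing)) ++
   emap (padd p2) (join_sym (fconst 48) (lf 0 1 0)) ++
   emap (padd p3) (join_sym (lf 3 1 0) (lf 0 0 1)))
  (cross_edges ++ emap (fmove 96) (collar_sym (lf 2 1 1)) ++
   emap (padd q1) (join_sym (lf 0 1 0) (lf 0 0 1)))); [| | | |by vm_compute].
- by move=> z /Kll; rewrite ev_const /zr /= mul0r.
- split=> // -[c bx] [<-|[<-|//]]; rewrite ?ea ?eb; exact: tangle_in_box.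
- rewrite /collared !join_link !movedU !xshiftU !moved_moved !xshift_moved.
  rewrite (flink_cat _ _ (collar_sym _)) (flink_cat _ _ (emap (padd p1) _)).
  rewrite (flink_cat _ _ (emap (padd p2) _)) (collar_symE es).
  rewrite -(moved_flink _ _ p1) -link_flink -(moved_flink _ _ p2) (join_symE e1 ea).
  rewrite -(moved_flink _ _ p3) (join_symE e3 eb).
  rewrite [place _ _ _ _](_ : _ =
    moved (evp x y g) (tlink G) `|` moved (evp x y t) (tlink T)); last first.
    by rewrite /place /= setU0.
  have -> (A B C D E F : set V) : A `|` (B `|` C `|` D `|` E `|` F) =
      A `|` (B `|` (D `|` F)) `|` (C `|` E).
    by apply/seteqP; split=> z; rewrite /setU /=; tauto.
  congr (_ `|` (_ `|` (_ `|` _)) `|` (_ `|` _));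
    rewrite /xshift ?/p1 ?/p2 ?/p3 ?/g ?/t at2E; apply: moved_eq;
    rewrite ?zrE /= -/a -/b -?natr1 ?natrD -/x -/y //; ring.
- rewrite /collared join_link !xshiftU !xshift_moved (flink_cat _ _ cross_edges).
  rewrite (flink_cat _ _ (emap (fmove 96) _)) -(moved_flink _ _ (pt 96 0 0)) (collar_symE et) e2.
  rewrite -(moved_flink _ _ q1) (join_symE ea eb).
  rewrite [place _ _ _ _](_ : _ =
    moved (evp x y g') (tlink G) `|` moved (evp x y t') (tlink T)); last first.
    by rewrite /place /= setU0.
  have -> (A B C D E : set V) : A `|` (B `|` (C `|` D `|` E)) =
      A `|` (B `|` E) `|` (C `|` D).
    by apply/seteqP; split=> z; rewrite /setU /=; tauto.
  rewrite !moved_moved /cross -(@flink_const x y)//.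
  congr (_ `|` (_ `|` _) `|` (_ `|` _));
    rewrite /xshift ?/q1 ?/g' ?/t' ?at2E; apply: moved_eq;
    rewrite ?zrE /= -/a -/b -?natr1 ?natrD -/x -/y //; ring.
Qed.

End TangleMoves.

(** * Sweeping the crossings of the tangle into the collar *)

Section Sweep.
Variable R : realType.
Notation V := (R3 R).
Local Notation link := (link_of R).
Local Notation tlink := (@tlink R).
Local Notation pad := (@pad R).
Local Notation cross := (@cross R).
Local Notation caps := (@caps R).

(** Equivalence by isotopies that can be carried out with anything on the left. *)
Definition sim (A B : set V) : Prop :=
  forall Kl, leftward Kl -> equivalent (Kl `|` A) (Kl `|` B).

Lemma sim_refl A : sim A A.
Proof. by move=> Kl _; exact: equivalent_refl. Qed.
Lemma sim_sym A B : sim A B -> sim B A.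
Proof. by move=> AB Kl Kll; apply/equivalent_sym/AB. Qed.
Lemma sim_trans A B C : sim A B -> sim B C -> sim A C.
Proof. by move=> AB BC Kl Kll; apply: equivalent_trans (AB _ Kll) (BC _ Kll). Qed.

Lemma homeomorphism_shift (v : V) : homeomorphism (fun p : V => p + v).
Proof.
exists (fun p => p - v); split=> [p|p|p|p]; rewrite ?addrK ?subrK//.
- by apply: cvgD; [exact: cvg_id|exact: cvg_cst].
- by apply: cvgB; [exact: cvg_id|exact: cvg_cst].
Qed.

Lemma homeomorphism_yflip : homeomorphism (@yflip R).
Proof.
have yK : cancel (@yflip R) (@yflip R) by move=> [[p q] r]; rewrite /yflip /= opprK.
have cy : continuous (@yflip R).
  apply: continuous_pair; last exact: continuous_snd.
  apply: continuous_pair.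
    by apply: continuous_o; [exact: continuous_fst|exact: continuous_fst].
  have c12 : continuous (fun p : V => p.1.2).
    by apply: continuous_o; [exact: continuous_fst|exact: continuous_snd].
  by move=> p; apply: cvgN; exact: c12.
by exists (@yflip R).
Qed.

Lemma sim_slab (K A B : set V) : (forall p, K p -> p.1.1 <= 2) -> sim A B ->
  sim (K `|` xshift 2 A) (K `|` xshift 2 B).
Proof.
move=> K2 AB Kl Kll.
have E C : Kl `|` (K `|` xshift 2 C) = xshift 2 (xshift (-2) (Kl `|` K) `|` C).
  rewrite xshiftU xshift_xshift ?addNr ?subrr /xshift /moved setUA.
  by rewrite (_ : (fun p => p + (0, 0, 0)) = id) ?image_id//; apply/funext => p; rewrite addr0.
rewrite !E; apply: equivalent_homeomorphism; first exact: homeomorphism_shift.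
apply: AB => _ [p [/Kll|/K2] + <-] /=; lra.
Qed.

Lemma sim_mirror A B : sim A B -> sim (mirror A) (mirror B).
Proof.
move=> AB Kl Kll; rewrite -(mirrorK Kl) -!mirrorU.
apply: equivalent_homeomorphism; first exact: homeomorphism_yflip.
by apply: AB => _ [p /Kll p0 <-].
Qed.

Lemma flink_le (d : Z) E : all (fun e => fnneg (fsub (fconst d) e.1.1.1) && fnneg (fsub (fconst d) e.2.1.1)) E ->
  forall p, flink 1 1 E p -> p.1.1 <= zr R d / 48.
Proof.
move=> /allP Ed p /flinkP[e /Ed /andP[/(ev_ge0 (lexx (1 : R)) (lexx 1)) + /(ev_ge0 (lexx (1 : R)) (lexx 1))]].
rewrite !evB !ev_const => e1 e2 [t /andP[t0 t1] ->] /=.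
have t' : 0 <= 1 - t by lra.
have := mulr_ge0 t' e1; have := mulr_ge0 t0 e2; rewrite /evp /=; lra.
Qed.

Lemma link_rightward D : all (fun e => (0 <= e.1.1.1) && (0 <= e.2.1.1)) D -> rightward (link D).
Proof.
move=> /allP D0 p [e /D0 /andP[e1 e2] [t /andP[t0 t1] ->]] /=.
by rewrite addr_ge0// mulr_ge0 ?ler0z// subr_ge0.
Qed.

Lemma rightwardU (A B : set V) : rightward A -> rightward B -> rightward (A `|` B).
Proof. by move=> hA hB p [/hA|/hB]. Qed.
Lemma rightward_shift d (A : set V) : 0 <= d -> rightward A -> rightward (xshift d A).
Proof. by move=> d0 hA _ [p /hA p0 <-]; rewrite addr_ge0. Qed.
Lemma rightward_mirror (A : set V) : rightward A -> rightward (mirror A).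
Proof. by move=> hA _ [p /hA p0 <-]. Qed.

Definition standard (T : tangle) : set V := collared (Defs.radius T) (tlink T).

Lemma mirror_collar s : mirror (link (collar s)) = link (collar s).
Proof.
rewrite -link_flip /collar /map_diagram !map_cat !link_cat /flip /= ?oppr0 !opprK.
by rewrite setUA [X in X `|` _]setUC -setUA.
Qed.

Lemma standard_flip T : standard (tangleR T) = mirror (standard T).
Proof.
by rewrite /standard /collared mirrorU mirror_collar mirror_xshift -link_flip.
Qed.

Lemma cross_le p : cross p -> p.1.1 <= 2.
Proof.
have e2 : zr R 96 = 2 * 48 by rewrite -natrM.
by move=> /(@flink_le 96 cross_edges isT); rewrite e2 mulfK ?pnatr_eq0.
Qed.

Lemma join_sim T : bounded_tangle T ->
  sim (standard (diag_join one_crossing T)) (cross `|` xshift 2 (standard T)).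
Proof. by move=> bT Kl; exact: join_relation. Qed.

Lemma join2_sim G T : bounded_tangle G -> bounded_tangle T ->
  sim (standard (diag_join (diag_join one_crossing G) T))
      (cross `|` xshift 2 (standard (diag_join G T))).
Proof. by move=> bG bT Kl; exact: join2_relation. Qed.

(** X is the part of a flattened diagram to the right of a cut. *)
Definition realizes (X : set V) (T : tangle) : Prop :=
  [/\ rightward X, bounded_tangle T & sim (pad `|` xshift 2 X) (standard T)].

Lemma realizes_gamma X T : realizes X T ->
  realizes (link gamma `|` xshift 6 X) (diag_join one_crossing T).
Proof.
move=> [Xr bT XT]; split; last 1 first.
- apply: sim_trans (_ : sim _ (cross `|` xshift 2 (pad `|` xshift 2 X))) _.
    by move=> Kl Kll; exact: gamma_relation.
  apply: sim_trans (sim_slab cross_le XT) _.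
  exact/sim_sym/join_sim.
- by apply: rightwardU; [exact: link_rightward|exact: rightward_shift].
- exact: bounded_join bounded_crossing bT.
Qed.

Lemma realizes_junction X T : realizes X T ->
  realizes (link junction `|` xshift 2 (mirror X)) (tangleR (diag_join one_crossing T)).
Proof.
move=> [Xr bT XT]; split; last 1 first.
- apply: sim_trans (_ : sim _ (mirror (cross `|` xshift 2 (pad `|` xshift 2 X)))) _.
    rewrite (mirrorU cross) mirror_xshift (mirrorU pad) mirror_xshift => Kl Kll.
    by apply: junction_relation => //; exact: rightward_mirror.
  rewrite standard_flip; apply: sim_mirror.
  apply: sim_trans (sim_slab cross_le XT) _.
  exact/sim_sym/join_sim.
- by apply: rightwardU; [exact: link_rightward|apply/rightward_shift/rightward_mirror].
- exact/bounded_flip/bounded_join.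
Qed.

Lemma standard_crossing : standard one_crossing = @lone R.
Proof. by []. Qed.

Lemma realizes_gamma_end : realizes (link gamma_end) one_crossing.
Proof.
split; [exact: link_rightward|exact: bounded_crossing|].
by move=> Kl Kll; rewrite standard_crossing; exact: gamma_end_relation.
Qed.

Lemma realizes_junction_end : realizes (link junction_end) (tangleR one_crossing).
Proof.
split; [exact: link_rightward|exact/bounded_flip/bounded_crossing|].
by move=> Kl Kll; rewrite standard_flip standard_crossing mirror_lone; exact: junction_end_relation.
Qed.

Lemma crossingsS m : crossings m.+2 = diag_join one_crossing (crossings m.+1).
Proof. by []. Qed.

(** Both sides are unwound to the same word in [cross]. *)
Lemma join_crossings m T T' : (0 < m)%N -> bounded_tangle T -> bounded_tangle T' ->
  sim (standard T) (standard T') ->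
  sim (standard (ssrnat.iter m (diag_join one_crossing) T)) (standard (diag_join (crossings m) T')).
Proof.
case: m => // m _ bT bT' TT'.
have bI k : bounded_tangle (ssrnat.iter k (diag_join one_crossing) T).
  by elim: k => //= k; exact: bounded_join bounded_crossing.
elim: m => [|m IH] /=.
  apply: sim_trans (join_sim bT) _; apply: sim_trans (sim_slab cross_le TT') _.
  exact/sim_sym/join_sim.
apply: sim_trans (join_sim (bI m.+1)) _; apply: sim_trans (sim_slab cross_le IH) _.
rewrite crossingsS; apply/sim_sym/join2_sim => //; exact: bounded_crossings.
Qed.

(** The slabs of the flattened T(x_1, ..., x_k, m) but the first one, where s lists
    the x_i backwards: m chairs, of which the last one is special if nothing
    follows, then a junction, special as well if nothing follows, and the mirror
    image of the slabs that remain. *)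
Fixpoint slabs (s : seq nat) (m : nat) : set V :=
  let gammas := ssrnat.iter (if s is [::] then m.-1 else m) (fun A => link gamma `|` xshift 6 A) in
  match s with
  | [::] => gammas (link gamma_end)
  | x :: s' =>
      gammas (if (s' == [::]) && (x == 1)%N then link junction_end
              else link junction `|` xshift 2 (mirror (slabs s' x.-1)))
  end.

(** What the slabs produce: each of them adds one crossing on the upper left. *)
Fixpoint nested_tangle (s : seq nat) (m : nat) : tangle :=
  if s is x :: s' then
    ssrnat.iter m (diag_join one_crossing) (tangleR (nested_tangle s' x))
  else crossings m.

Lemma nested_tangleS s m : (s != [::]) || (0 < m)%N ->
  nested_tangle s m.+1 = diag_join one_crossing (nested_tangle s m).
Proof. by case: s => //=; case: m. Qed.

Lemma realizes_iter k X T : realizes X T ->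
  realizes (ssrnat.iter k (fun A => link gamma `|` xshift 6 A) X) (ssrnat.iter k (diag_join one_crossing) T).
Proof. by move=> XT; elim: k => //= k; exact: realizes_gamma. Qed.

Lemma realizes_slabs s m : all (leq 1) s -> (s != [::]) || (0 < m)%N ->
  realizes (slabs s m) (nested_tangle s m).
Proof.
elim: s m => [|x s IH] m /=; first by move=> _ _; exact/realizes_iter/realizes_gamma_end.
move=> /andP[x1 s1] _; apply: realizes_iter.
case: ifP => [/andP[/eqP -> /eqP ->]|sx]; first exact: realizes_junction_end.
have sx' : (s != [::]) || (0 < x.-1)%N.
  by case: (s) sx => //=; case: x x1 => [|[]].
have := realizes_junction (IH x.-1 s1 sx').
by rewrite -nested_tangleS// prednK.
Qed.

(** The tangle product, by recursion on the last factor. *)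
Fixpoint right_product (s : seq nat) (m : nat) : tangle :=
  if s is x :: s' then diag_join (crossings m) (tangleR (right_product s' x)) else crossings m.

Lemma right_productE m s : right_product s m = tangle_product (rev (m :: s)).
Proof.
elim: s m => [|x s IH] m //; rewrite rev_cons /= IH.
have : rev (x :: s) != [::] by rewrite -size_eq0 size_rev.
by case: (rev (x :: s)) => //= y t _; rewrite -cats1 foldl_cat.
Qed.

Lemma bounded_nested s m : bounded_tangle (nested_tangle s m).
Proof.
elim: s m => [|x s IH] m /=; first exact: bounded_crossings.
by elim: m => [|m IHm] /=; [exact: bounded_flip|exact: bounded_join bounded_crossing _].
Qed.

Lemma bounded_product s m : bounded_tangle (right_product s m).
Proof.
elim: s m => [|x s IH] m /=; first exact: bounded_crossings.
by apply: bounded_join; [exact: bounded_crossings|exact: bounded_flip].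
Qed.

Lemma nested_product s m : all (leq 1) s -> (1 <= m)%N ->
  sim (standard (nested_tangle s m)) (standard (right_product s m)).
Proof.
elim: s m => [|x s IH] m /=; first by move=> _ _; exact: sim_refl.
move=> /andP[x1 s1] m1; apply: join_crossings => //.
- exact/bounded_flip/bounded_nested.
- exact/bounded_flip/bounded_product.
- by rewrite !standard_flip; apply/sim_mirror/IH.
Qed.

Lemma caps_leftward : leftward caps.
Proof. by move=> p /(@flink_le 0 caps_edges isT); rewrite /zr /= mul0r. Qed.

Lemma equivalent_moved (v : V) A : equivalent A (moved v A).
Proof. by have := equivalent_good (good_rigid A v); rewrite rigid_fst rigid_snd. Qed.

(** Sweep the slabs into nested crossings from right to left, then reassociate. *)
Theorem slabs_closure s m : all (leq 1) s -> (1 <= m)%N ->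
  equivalent (link start `|` xshift 2 (slabs s m))
             (link (closure_of (tangle_product (rev (m :: s))))).
Proof.
move=> s1 m1; have [Xr bN XN] := @realizes_slabs s m s1 ltac:(by rewrite m1 orbT).
apply: equivalent_trans (start_relation Xr) _.
apply: equivalent_trans (XN _ caps_leftward) _.
apply: equivalent_trans (nested_product s1 m1 caps_leftward) _.
rewrite -right_productE.
apply: equivalent_trans (equivalent_sym (closure_relation _ (bounded_product s m))) _.
exact/equivalent_sym/equivalent_moved.
Qed.

End Sweep.

(** * Flattening the drawing of a tree *)

Section Flattening.
Variable R : realType.
Notation V := (R3 R).
Implicit Types (g O U : V * V) (E F : seq ((V * V) * (V * V))).

(** The motion of a list of edges whose ends move. *)
Definition hset E : set (V * V) := foldr (fun e X => hseg e.1 e.2 `|` X) set0 E.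

Definition every (P : V * V -> Prop) E : Prop := foldr (fun e Q => [/\ P e.1, P e.2 & Q]) True E.

Lemma hset_cat E F : hset (E ++ F) = hset E `|` hset F.
Proof. by elim: E => [|e E IH] /=; rewrite ?set0U// IH setUA. Qed.

Lemma every_cat P E F : every P (E ++ F) <-> every P E /\ every P F.
Proof.
elim: E => [|e E IH] /=; first by split=> // -[].
by split=> [[p q /IH[]]|[[p q ?] ?]]; do ?split=> //; apply/IH.
Qed.

Lemma every_impl (P Q : V * V -> Prop) E : (forall g, P g -> Q g) -> every P E -> every Q E.
Proof. by move=> PQ; elim: E => //= e E IH [/PQ ? /PQ ? /IH]. Qed.

Lemma sep_every (P Q : V * V -> Prop) l E F : every P E -> every Q F ->
  (forall g h, P g -> Q h -> ok l g h) -> sep (hset E) (hset F).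
Proof.
move=> + + PQ; elim: E => [_ _|e E IH /= [e1 e2 PE] QF]; first exact: sep0l.
apply: sepUl; last exact: IH.
elim: F QF {IH PE} => [_|f F IH /= [f1 f2 QF]]; first exact/sep_sym/sep0l.
apply: sepUr; last exact: IH.
apply: (sep_spanned (l := l) (spanned_hseg (g := _) (h := _)) (spanned_hseg (g := _) (h := _))).
by move=> _ _ [<-|[<-|//]] [<-|[<-|//]]; exact: PQ.
Qed.

Lemma okI (a b c : R) (x y z x' y' z' u v w u' v' w' : R) :
  (0 < a * (u - x) + b * (v - y) + c * (w - z) /\
   0 < a * (u' - x') + b * (v' - y') + c * (w' - z')) ->
  ok (a, b, c) ((x, y, z), (x', y', z')) ((u, v, w), (u', v', w')).
Proof. by move=> H; left. Qed.

Lemma ok_refl l g : ok l g g.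
Proof. by right; rewrite !subrr /dot /= !mulr0 !addr0; split. Qed.

(** What the certificates need to know about the vertices of a flattened
    subtree: they start in a rectangle of height h, and end either at ordinate 1
    and at height at least H, or, for the leaves and the feet of the verticals,
    where they were. *)
Definition low (a b h H : R) g : Prop :=
  let: ((x, y, z), (x', y', z')) := g in
  [/\ a <= x <= b, x' = x, 0 <= y <= h, -1 <= z <= 1 &
      (y' = 1 /\ H <= z' /\ 0 < y) \/ [/\ y' = 0, y = 0 & z' = z]].

Lemma low_impl (a b h H a' b' h' H' : R) g : a' <= a -> b <= b' -> h <= h' -> H' <= H ->
  low a b h H g -> low a' b' h' H' g.
Proof.
case: g => [[[x y] z] [[x' y'] z']] aa bb hh HH [/andP[? ?] ? /andP[? ?] ? c].
split=> //; first by apply/andP; split; lra.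
  by apply/andP; split; lra.
by case: c => [[? [? ?]]|?]; [left; do ?split => //; lra|right].
Qed.

(** The vertices, other than the lower end, of a strand that comes down to the
    crossing at xc, from the left if s = 1 and from the right if s = -1. *)
Definition upper (s N xc hc Hc m : R) g : Prop :=
  let: ((x, y, z), (x', y', z')) := g in
  [/\ s * (xc - x) <= N /\ s * (xc - x') <= N, hc <= y,
      (1 <= s * (xc - x) /\ z <= 1) \/ [/\ 0 <= s * (xc - x), hc + 1 <= y & z <= 0],
      y' = 1 /\ 1 <= s * (xc - x') &
      z' <= Hc \/ (z' <= Hc + 1 /\ s * x' <= m - 1)].

Definition lower_point (xc hc Hc : R) : V * V := ((xc, hc, -1), (xc, 1, Hc)).
Definition upper_point (xc hc Hc : R) : V * V := ((xc, hc, 1), (xc, 1, Hc + 1)).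
Definition base (xc : R) : V * V := ((xc, 0, -1), (xc, 0, -1)).

Section Child.
Variables (s N xc hc Hc m : R).

Local Notation strand := (fun g => g = lower_point xc hc Hc \/ upper s N xc hc Hc m g).

Lemma strand_leg E : 1 <= hc -> every strand E ->
  sep (hset [:: (lower_point xc hc Hc, base xc)]) (hset E).
Proof.
move=> hc1 sE; apply: (@sep_every (fun g => g = lower_point xc hc Hc \/ g = base xc) strand (- s, 1, 0)) => //.
  by split=> //; [left|right].
move=> g h [->|->] [->|].
- exact: ok_refl.
- case: h => [[[x y] z] [[x' y'] z']] [_ ? h1 [-> ?] _]; apply: okI.
  by case: h1 => [[? ?]|[? ? ?]]; split; lra.
- by apply: okI; split; lra.
- case: h => [[[x y] z] [[x' y'] z']] [_ ? h1 [-> ?] _]; apply: okI.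
  by case: h1 => [[? ?]|[? ? ?]]; split; lra.
Qed.

Lemma strand_far E F : every strand E ->
  every (fun g => s * xc < s * g.1.1.1 /\ g.2.1.1 = g.1.1.1) F -> sep (hset E) (hset F).
Proof.
move=> sE fF; apply: (sep_every (l := (s, 0, 0)) sE fF) => g [[[u v] w] [[u' v'] w']] /= + [uf ->].
case=> [->|]; first by apply: okI; split; lra.
case: g => [[[x y] z] [[x' y'] z']] [_ _ h1 [_ ?] _]; apply: okI.
by case: h1 => [[? ?]|[? ? ?]]; split; lra.
Qed.

(** The strand ends below the point from which the branches of the child start, and
    there only the third coordinate tells them apart. *)
Lemma strand_far_branch E F : 0 <= Hc -> every strand E ->
  every (fun g => g = upper_point xc hc Hc \/
    [/\ s * xc + 1 <= s * g.1.1.1, g.2.1.1 = g.1.1.1, -1 <= g.1.2 & 0 <= g.2.2]) F ->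
  sep (hset F) (hset E).
Proof.
move=> Hc0 sE fF; set M := Hc + 3.
apply: (sep_every (l := (- (M * s), 0, -1)) fF sE) => g h.
have M0 (t : R) : 1 <= t -> M <= M * t by move=> t1; rewrite ler_peMr// /M; lra.
case=> [->|].
  case=> [->|]; first by apply: okI; rewrite /M; split; lra.
  case: h => [[[x y] z] [[x' y'] z']] [_ _ h1 [_ /M0 x1] h2]; apply: okI.
  have z2 : z' <= Hc + 1 by case: h2 => [|[]]; lra.
  have M3 : 3 <= M by rewrite /M; lra.
  have Mx : 0 < M * (s * (xc - x)) - z + 1.
    case: h1 => [[/M0 ? ?]|[x0 ? ?]]; first lra.
    have : 0 <= M * (s * (xc - x)) by rewrite mulr_ge0//; lra.
    lra.
  by rewrite /= in x1 *; split; lra.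
case: g => [[[u v] w] [[u' v'] w']] /= [uf -> w1 w0].
have u1 : 1 <= s * (u - xc) by lra.
case=> [->|].
  have := M0 _ u1 => {}u1; apply: okI; rewrite -/M in u1 *; have : M = Hc + 3 by [].
  by split; lra.
case: h => [[[x y] z] [[x' y'] z']] [_ _ h1 [_ x1] h2]; apply: okI.
have z2 : z' <= Hc + 1 by case: h2 => [|[]]; lra.
have z1 : z <= 1 by case: h1 => [[]|[]]; lra.
have x0 : 0 <= s * (xc - x) by case: h1 => [[]|[]]; lra.
have := M0 _ u1; have := M0 _ x1; have : 0 <= M * (s * (xc - x)) by rewrite mulr_ge0// /M; lra.
have : M = Hc + 3 by [].
by split; lra.
Qed.

(** What hangs from the child on the side of the strand is below it in the plane, at
    first, and in front of it, in the end; the linear form combines both. *)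
Lemma strand_near E F : 0 <= N -> 1 <= hc -> 0 <= Hc -> every strand E ->
  every (fun g => g = upper_point xc hc Hc \/
    [/\ m <= s * g.1.1.1, s * xc - N <= s * g.1.1.1, s * g.1.1.1 <= s * xc &
       exists a b, low a b (hc - 1) (Hc + 1) g]) F ->
  sep (hset F) (hset E).
Proof.
move=> N0 hc1 Hc0 sE fF; set B := N + 1; set A := N + B * (Hc + 3) + 2.
apply: (sep_every (l := (- s, A, - B)) fF sE) => g h.
have B0 : 0 <= B by rewrite /B; lra.
have BH : 0 <= B * Hc by rewrite mulr_ge0.
have AE : A = N + B * Hc + 3 * B + 2 by rewrite /A; ring.
have BE : B = N + 1 by [].
have A0 : 0 <= A by lra.
case=> [->|].
  case=> [->|]; first by apply: okI; rewrite /B; split; lra.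
  case: h => [[[x y] z] [[x' y'] z']] [_ hy h1 [-> x1] h2]; apply: okI; split.
    case: h1 => [[x0 z1]|[x0 y1 z0]].
      have : 0 <= A * (y - hc) by rewrite mulr_ge0//; lra.
      have : 0 <= B * (1 - z) by rewrite mulr_ge0//; lra.
      lra.
    have : 0 <= A * (y - hc - 1) by rewrite mulr_ge0//; lra.
    have : 0 <= B * (1 - z) by rewrite mulr_ge0//; lra.
    have : 1 <= A by lra.
    lra.
  have : 0 <= B * (Hc + 1 - z') by rewrite mulr_ge0//; case: h2 => [|[]]; lra.
  lra.
case: g => [[[u v] w] [[u' v'] w']] /= [mu Nu ux [a [b [_ -> /andP[v0 v1] /andP[w1 w2] c]]]].
have key x y z : s * (xc - x) <= N -> 0 <= s * (xc - x) -> hc <= y -> z <= 1 ->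
    0 < - s * (x - u) + A * (y - v) + - B * (z - w).
  move=> xN x0 hy z1.
  have : 0 <= A * (y - v - 1) by rewrite mulr_ge0//; lra.
  have : 0 <= B * (2 - (z - w)) by rewrite mulr_ge0//; lra.
  have : N + 2 * B < A by lra.
  lra.
have key' x z : s * (xc - x) <= N -> 0 <= s * (xc - x) ->
    z <= Hc \/ (z <= Hc + 1 /\ s * x <= m - 1) ->
    0 < - s * (x - u) + A * (1 - v') + - B * (z - w').
  move=> xN x0 zc; case: c => [[-> [Hw _]]|[-> _ ->]].
    case: zc => [zH|[zH xm]].
      have : 0 <= B * (w' - z - 1) by rewrite mulr_ge0//; lra.
      lra.
    have : 0 <= B * (w' - z) by rewrite mulr_ge0//; lra.
    lra.
  have : 0 <= B * (Hc + 3 - (z - w)) by rewrite mulr_ge0//; case: zc => [|[]]; lra.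
  lra.
case=> [->|].
  by apply: okI; split; [apply: key; lra|apply: key'; [lra|lra|left]].
case: h => [[[x y] z] [[x' y'] z']] [[xN x'N] hy h1 [-> x1] h2]; apply: okI.
by split; [apply: key|apply: key'] => //; case: h1 => [[]|[]]; lra.
Qed.

End Child.

End Flattening.

Section Flattening.
Variable R : realType.
Notation V := (R3 R).
Implicit Types (g O U : V * V) (E F : seq ((V * V) * (V * V))).

(** A vertical is passed in front by the two branches that start at its top. *)
Lemma leg_branch (s xv hv H : R) E : 0 <= H ->
  every (fun g => g = upper_point xv hv H \/
    [/\ 1 <= s * (g.1.1.1 - xv), g.2.1.1 = g.1.1.1, -1 <= g.1.2 & 0 <= g.2.2]) E ->
  sep (hset [:: (lower_point xv hv H, base xv)]) (hset E).
Proof.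
move=> H0 sE; set M := H + 3; have ME : M = H + 3 by [].
apply: (sep_every (P := fun g => g = lower_point xv hv H \/ g = base xv) (l := (M * s, 0, 1)) _ sE).
  by split=> //; [left|right].
move=> g h [->|->] [->|].
- by apply: okI; split; lra.
- case: h => [[[x y] z] [[x' y'] z']] /= [x1 -> z1 z0]; apply: okI.
  have : M <= M * (s * (x - xv)) by rewrite ler_peMr//; lra.
  by split; lra.
- by apply: okI; split; lra.
- case: h => [[[x y] z] [[x' y'] z']] /= [x1 -> z1 z0]; apply: okI.
  have : M <= M * (s * (x - xv)) by rewrite ler_peMr//; lra.
  by split; lra.
Qed.

Local Notation size t := ((leaves t)%:R : R).

Lemma size_ge1 t : 1 <= size t.
Proof. by rewrite ler1n leaves_gt0. Qed.

Definition middle (i : nat) (l : tree) : R := 2 * i%:R + 2 * size l - 1.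

Lemma middle_eq i l : middle i l = 2 * i%:R + 2 * size l - 1.
Proof. by []. Qed.

(** The lower end of the edge that comes down to t. The final heights H are chosen
    so that whatever a strand passes above in the plane ends up in front of it. *)
Definition foot (i H : nat) (t : tree) : V * V :=
  match t with
  | Leaf => ((2 * i%:R, 0, 0), (2 * i%:R, 0, 0))
  | Node l r => lower_point (middle i l) (size t - 1) H%:R
  end.

(** The point of the edge from O to U at distance 1 from O, abscissae compared. It
    comes to lie at the level of U, next to O. *)
Definition bend (s : R) O U : V * V :=
  (comb (s * (U.1.1.1 - O.1.1.1))^-1 O.1 U.1, (O.2.1.1 + s, U.2.1.2, U.2.2)).

(** The edge to the child on the side of the parent remains a segment, whereas the
    other one acquires a bend. *)
Definition branch (far : bool) (s : R) O U : seq ((V * V) * (V * V)) :=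
  if far then [:: (O, bend s O U); (bend s O U, U)] else [:: (O, U)].

(** [d] tells that the parent is on the right. *)
Fixpoint tree_moves (d : bool) (i H : nat) (t : tree) : seq ((V * V) * (V * V)) :=
  match t with
  | Leaf => [::]
  | Node l r =>
      let O := upper_point (middle i l) (size t - 1) H%:R in
      let Hl := if d then H else H.+1 in
      let Hr := if d then H.+1 else H in
      branch d (-1) O (foot i Hl l) ++ branch (~~ d) 1 O (foot (i + leaves l) Hr r) ++
      (foot i H t, base (middle i l)) :: tree_moves true i Hl l ++ tree_moves false (i + leaves l) Hr r
  end.

Definition shadow (i H : nat) (t : tree) : V * V -> Prop :=
  low (2 * i%:R) (2 * i%:R + 2 * size t - 2) (size t - 1) H%:R.

Lemma shadow_foot i H t : shadow i H t (foot i H t).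
Proof.
case: t => [|l r]; rewrite /shadow /low /=.
  by split=> //; [|apply/andP; split..|right]; rewrite ?mulr1n; try lra.
rewrite /middle natrD; have := size_ge1 l; have := size_ge1 r => l1 r1.
by split=> //; [apply/andP; split..|left; do ?split]; try lra.
Qed.

Lemma shadow_base i H l r : shadow i H (Node l r) (base (middle i l)).
Proof.
rewrite /shadow /low /= /middle natrD; have := size_ge1 l; have := size_ge1 r => l1 r1.
by split=> //; [apply/andP; split..|right]; try lra.
Qed.

(** The end of a branch from the crossing of abscissa X on the side s: a leaf,
    right next to it, or the lower point of another crossing. *)
Definition attached (far : bool) (s X hv H : R) U : Prop :=
  U = ((X + s, 0, 0), (X + s, 0, 0)) \/
  exists xc hc, [/\ U = lower_point xc hc (if far then H else H + 1),
    2 <= s * (xc - X), 1 <= hc & hc + 1 <= hv].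

Lemma attached_left d i H l r : attached d (-1) (middle i l) (size (Node l r) - 1) H%:R
  (foot i (if d then H else H.+1) l).
Proof.
case: l => [|l l'] /=; [left|right]; rewrite /middle /=.
  by congr (_, _, _, (_, _, _)); lra.
exists (middle i l), (size (Node l l') - 1); rewrite !natrD /middle.
have := size_ge1 l; have := size_ge1 l'; have := size_ge1 r => r1 l1 l2.
split; [by case: d; rewrite /= -?natr1|lra..].
Qed.

Lemma attached_right d i H l r : attached (~~ d) 1 (middle i l) (size (Node l r) - 1) H%:R
  (foot (i + leaves l) (if d then H.+1 else H) r).
Proof.
case: r => [|r r'] /=; [left|right]; rewrite /middle /=.
  by congr (_, _, _, (_, _, _)); rewrite natrD; lra.
exists (middle (i + leaves l) r), (size (Node r r') - 1); rewrite !natrD /middle natrD.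
have := size_ge1 l; have := size_ge1 r'; have := size_ge1 r => r1 l1 l2.
split; [by case: d; rewrite /= -?natr1|lra..].
Qed.

Section Branch.
Variables (far : bool) (s X hv H : R) (U : V * V).

Lemma bend_leaf : s = 1 \/ s = -1 -> U = ((X + s, 0, 0), (X + s, 0, 0)) ->
  bend s (upper_point X hv H) U = U.
Proof.
move=> s1 ->; rewrite /bend /comb /= addrAC subrr add0r.
have -> : s * s = 1 by case: s1 => ->; ring.
by congr (_, _, _, (_, _, _)); lra.
Qed.

Lemma bend_node xc hc Hc : s = 1 \/ s = -1 -> U = lower_point xc hc Hc ->
  2 <= s * (xc - X) -> hc <= hv ->
  exists y z, [/\ bend s (upper_point X hv H) U = ((X + s, y, z), (X + s, 1, Hc)),
    hc <= y <= hv & -1 <= z <= 1].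
Proof.
move=> s1 -> D1 hh; rewrite /bend /comb /=; set t := (_ * _)^-1.
have D0 : 0 < s * (xc - X) by lra.
have t0 : 0 < t by rewrite /t invr_gt0.
have t1 : t <= 1 by rewrite /t invf_le1//; lra.
exists ((1 - t) * hv + t * hc), ((1 - t) * 1 + t * -1); split.
- congr (_, _, _, _); have e : t * (s * (xc - X)) = 1 by rewrite /t mulVf// gt_eqF.
  have e' : t * (xc - X) = s.
    have -> : t * (xc - X) = s * s * (t * (xc - X)) by case: s1 => ->; ring.
    by rewrite -[RHS]mulr1 -e; ring.
  by rewrite -e'; ring.
- have : 0 <= t * (hv - hc) by rewrite mulr_ge0//; lra.
  have : 0 <= (1 - t) * (hv - hc) by rewrite mulr_ge0//; lra.
  by move=> *; apply/andP; split; lra.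
- by apply/andP; split; lra.
Qed.

Hypothesis s1 : s = 1 \/ s = -1.

Lemma branch_beside : 0 <= H -> attached far s X hv H U ->
  every (fun g => g = upper_point X hv H \/
    [/\ 1 <= s * (g.1.1.1 - X), g.2.1.1 = g.1.1.1, -1 <= g.1.2 & 0 <= g.2.2])
  (branch far s (upper_point X hv H) U).
Proof.
move=> H0 aU; have ss : s * s = 1 by case: s1 => ->; ring.
have e : s * (X + s - X) = 1 by rewrite -[RHS]ss; ring.
have PU : [/\ 1 <= s * (U.1.1.1 - X), U.2.1.1 = U.1.1.1, -1 <= U.1.2 & 0 <= U.2.2].
  clear s1; case: aU => [->|[xc [hc [-> x2 _ _]]]] /=.
    by rewrite e; split; [| |lra|].
  by split; [lra| |lra|case: (far); lra].
rewrite /branch; case: far aU => [aU|aU]; last by do ?split=> //; [left|right].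
suff PB : let g := bend s (upper_point X hv H) U in
    [/\ 1 <= s * (g.1.1.1 - X), g.2.1.1 = g.1.1.1, -1 <= g.1.2 & 0 <= g.2.2].
  by do ?split=> //; [left|right|right|right].
case: aU => [U1|[xc [hc [U1 x2 hc1 hc2]]]]; first by rewrite bend_leaf.
have [|y [z [-> /andP[y1 y2] /andP[z1 z2]]]] := bend_node s1 U1 x2; first lra.
by rewrite /= e; split.
Qed.

Lemma branch_low a b : 0 <= H -> a <= X <= b -> a <= U.1.1.1 <= b -> 1 <= hv ->
  attached far s X hv H U ->
  every (low a b hv H) (branch far s (upper_point X hv H) U).
Proof.
move=> H0 /andP[aX Xb] /andP[aU bU] hv1 atU.
have PO : low a b hv H (upper_point X hv H).
  by split=> //; [apply/andP; split..|left; do ?split]; try lra.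
have PU : low a b hv H U.
  case: atU aU bU => [->|[xc [hc [-> x2 hc1 hc2]]]] /= aU bU.
    by split=> //; [apply/andP; split..|right]; try lra.
  by split=> //; [apply/andP; split..|left; do ?split]; try lra; case: (far); lra.
rewrite /branch; case: far atU => [atU|_]; last by [].
suff PB : low a b hv H (bend s (upper_point X hv H) U) by [].
case: atU aU bU => [U1|[xc [hc [U1 x2 hc1 hc2]]]] aU bU; first by rewrite bend_leaf.
have [|y [z [-> /andP[y1 y2] /andP[z1 z2]]]] := bend_node s1 U1 x2; first lra.
rewrite U1 /= in aU bU.
split=> //; [apply/andP; split..|left; do ?split]; try lra; case: s1 x2 => ->; lra.
Qed.

Lemma branch_upper xc hc Hc N m : U = lower_point xc hc Hc ->
  Hc = (if far then H else H + 1) -> 2 <= s * (xc - X) <= N -> hc + 1 <= hv ->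
  (far -> s * X <= m - 1) ->
  every (fun g => g = lower_point xc hc Hc \/ upper s N xc hc Hc m g)
    (branch far s (upper_point X hv H) U).
Proof.
move=> U1 HcE /andP[x2 xN] hh Xm.
have ss : s * s = 1 by case: s1 => ->; ring.
have PO : upper s N xc hc Hc m (upper_point X hv H).
  clear s1 U1; rewrite /upper /=; split; [split; lra|lra|left; split; lra|split=> //; lra|].
  by rewrite HcE; case: (far) Xm => [/(_ isT)|_] *; [right; split|left]; lra.
rewrite /branch; case: far => /=; last by do ?split=> //; [right|left].
suff PB : upper s N xc hc Hc m (bend s (upper_point X hv H) U).
  by do ?split=> //; [right|right|right|left].
have [|y [z [-> /andP[y1 y2] /andP[z1 z2]]]] := bend_node s1 U1 x2; first lra.
have e : s * (xc - (X + s)) = s * (xc - X) - 1 by rewrite -ss; ring.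
by rewrite /upper e; split; [split; lra|lra|left; split; lra|split=> //; lra|left].
Qed.

Lemma good_branch : attached far s X hv H U -> good (hset (branch far s (upper_point X hv H) U)).
Proof.
move=> aU; have ss : s * s = 1 by case: s1 => ->; ring.
have okOU : ok (s, 0, 0) (upper_point X hv H) U.
  have e : s * (X + s - X) = 1 by rewrite -[RHS]ss; ring.
  by case: aU => [->|[xc [hc [-> x2 _ _]]]]; apply: okI; rewrite ?e; split; lra.
rewrite /branch; case: far aU => [aU|_] /=; last first.
  by rewrite setU0; exact: good_hseg okOU.
rewrite setU0.
suff [o1 o2] : ok (s, 0, 0) (upper_point X hv H) (bend s (upper_point X hv H) U) /\
    ok (s, 0, 0) (bend s (upper_point X hv H) U) U.
  apply: goodU; [exact: good_hseg o1|exact: good_hseg o2|].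
  apply: sep_spanned (spanned_hseg (g := _) (h := _)) (spanned_hseg (g := _) (h := _)) _.
  move=> _ _ [<-|[<-|[]]] [<-|[<-|[]]]; [exact: o1|exact: okOU|exact: ok_refl|exact: o2].
case: aU => [U1|[xc [hc [U1 x2 hc1 hc2]]]]; first by rewrite bend_leaf//; split=> //; exact: ok_refl.
have [|y [z [-> /andP[y1 y2] /andP[z1 z2]]]] := bend_node s1 U1 x2; first lra.
have e : s * (xc - (X + s)) = s * (xc - X) - 1 by rewrite -ss; ring.
have e' : s * (X + s - X) = 1 by rewrite -[RHS]ss; ring.
by rewrite U1; split; apply: okI; rewrite ?e ?e'; split; lra.
Qed.

End Branch.

End Flattening.

Section Flattening.
Variable R : realType.
Notation V := (R3 R).
Implicit Types (g O U : V * V) (E F : seq ((V * V) * (V * V))).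

Local Notation size t := ((leaves t)%:R : R).
Local Notation middle := (@middle R).
Local Notation foot := (@foot R).
Local Notation tree_moves := (@tree_moves R).

Lemma sep0r X : sep X (set0 : set (V * V)).
Proof. exact/sep_sym/sep0l. Qed.

Lemma tree_moves_node d i H l r : tree_moves d i H (Node l r) =
  branch d (-1) (upper_point (middle i l) (size (Node l r) - 1) H%:R)
    (foot i (if d then H else H.+1) l) ++
  branch (~~ d) 1 (upper_point (middle i l) (size (Node l r) - 1) H%:R)
    (foot (i + leaves l) (if d then H.+1 else H) r) ++
  [:: (lower_point (middle i l) (size (Node l r) - 1) H%:R, base (middle i l))] ++
  tree_moves true i (if d then H else H.+1) l ++
  tree_moves false (i + leaves l) (if d then H.+1 else H) r.
Proof. by []. Qed.

Lemma tree_moves_low d i H t : every (@shadow R i H t) (tree_moves d i H t).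
Proof.
elim: t d i H => [//|l IHl r IHr] d i H.
have := size_ge1 R l; have := size_ge1 R r => r1 l1.
have hl := shadow_foot R i (if d then H else H.+1) l.
have hr := shadow_foot R (i + leaves l) (if d then H.+1 else H) r.
have Hl : H%:R <= (if d then H else H.+1)%:R :> R by rewrite ler_nat; case: (d).
have Hr : H%:R <= (if d then H.+1 else H)%:R :> R by rewrite ler_nat; case: (d).
have hv1 : 1 <= size (Node l r) - 1 by rewrite /= natrD; lra.
have X1 : 2 * i%:R <= middle i l <= 2 * i%:R + 2 * size (Node l r) - 2.
  by rewrite ?middle_eq /= natrD; apply/andP; split; lra.
have H0 : 0 <= H%:R :> R by [].
rewrite tree_moves_node; apply/every_cat; split.
  apply: (branch_low _ H0 X1 _ hv1 (attached_left R d i H l r)); first by right.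
  move: hl; rewrite /shadow /low /= natrD; case: (foot _ _ _) => [[[x y] z] [[x' y'] z']].
  by move=> [/andP[? ?] _ _ _ _]; apply/andP; split=> /=; lra.
apply/every_cat; split.
  apply: (branch_low _ H0 X1 _ hv1 (attached_right R d i H l r)); first by left.
  move: hr; rewrite /shadow /low /= !natrD; case: (foot _ _ _) => [[[x y] z] [[x' y'] z']].
  by move=> [/andP[? ?] _ _ _ _]; apply/andP; split=> /=; lra.
apply/every_cat; split.
  by split=> //; [exact: (shadow_foot R i H (Node l r))|exact: shadow_base].
apply/every_cat; split.
  apply: every_impl (IHl _ _ _) => g; apply: low_impl => //; rewrite /= natrD; lra.
by apply: every_impl (IHr _ _ _) => g; apply: low_impl => //; rewrite /= !natrD; lra.
Qed.

Lemma sep_sides X O E F :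
  every (fun g => g = O \/ 1 <= -1 * (g.1.1.1 - X) /\ g.2.1.1 = g.1.1.1) E ->
  every (fun g => g = O \/ 1 <= 1 * (g.1.1.1 - X) /\ g.2.1.1 = g.1.1.1) F ->
  O.1.1.1 = X -> O.2.1.1 = X -> sep (hset E) (hset F).
Proof.
move=> eE eF O1 O2; apply: (sep_every (l := (1, 0, 0)) eE eF) => g h.
case: O O1 O2 {eE eF} => [[[x y] z] [[x' y'] z']] /= -> ->.
case: g => [[[u v] w] [[u' v'] w']]; case: h => [[[p q] k] [[p' q'] k']] /=.
case=> [[-> -> -> -> -> ->]|[u1 ->]] [[-> -> -> -> -> ->]|[p1 ->]].
- exact: ok_refl.
- by apply: okI; split; lra.
- by apply: okI; split; lra.
- by apply: okI; split; lra.
Qed.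

Lemma sep_leg_side (s X hv H : R) E : every (fun g => 1 <= s * (g.1.1.1 - X) /\ g.2.1.1 = g.1.1.1) E ->
  sep (hset [:: (lower_point X hv H, base X)]) (hset E).
Proof.
move=> eE; apply: (sep_every (P := fun g => g = lower_point X hv H \/ g = base X)
    (l := (s, 0, 0)) _ eE); first by split=> //; [left|right].
move=> g [[[u v] w] [[u' v'] w']] /= gX [u1 ->].
by case: gX => ->; apply: okI; split; lra.
Qed.

(** The certificates for the edge to a child and the subtree of that child, part by
    part. *)
Lemma branch_child_left d i H l r :
  let O := upper_point (middle i l) (size (Node l r) - 1) H%:R in
  let Hl := if d then H else H.+1 in
  sep (hset (branch d (-1) O (foot i Hl l))) (hset (tree_moves true i Hl l)).
Proof.
move=> O Hl; case: l @O => [|ll lr] O; first exact: sep0r.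
set xc := middle i ll; set hc := size (Node ll lr) - 1; set Hc : R := Hl%:R.
(* N exceeds the differences of abscissae, and m is a lower bound for the opposites of
   the abscissae in the subtree. *)
pose N : R := 2 * size (Node (Node ll lr) r); pose m := -1 * middle i (Node ll lr) + 1.
have := size_ge1 R ll; have := size_ge1 R lr; have := size_ge1 R r => r1 lr1 ll1.
have HcE : Hc = (if d then H%:R else H%:R + 1) by rewrite /Hc /Hl; case: (d); rewrite // -natr1.
have m1 : (-1 : R) = 1 \/ (-1 : R) = -1 by right.
have Hc0 : 0 <= Hc by rewrite /Hc.
have N0 : 0 <= N by rewrite /N; have := size_ge1 R (Node (Node ll lr) r); lra.
have nE : size (Node ll lr) = size ll + size lr by rewrite -natrD.
have hc1 : 1 <= hc by rewrite /hc nE; lra.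
have sE : every (fun g => g = lower_point xc hc Hc \/ upper (-1) N xc hc Hc m g)
    (branch d (-1) O (foot i Hl (Node ll lr))).
  apply: branch_upper => //.
  - by rewrite /xc ?middle_eq /N /= !natrD; apply/andP; split; lra.
  - by rewrite /hc [size (Node _ r)]natrD nE; lra.
  - by rewrite /m; lra.
have farP := branch_beside m1 Hc0 (attached_left R true i Hl ll lr).
rewrite tree_moves_node -/xc -/hc -/Hc !hset_cat;
apply: sepUr; [|apply: sepUr; [|apply: sepUr; [|apply: sepUr]]].
- apply/sep_sym; apply: (strand_far_branch Hc0 sE).
  by apply: every_impl farP => g [->|[g1 g2 g3 g4]]; [left|right; rewrite -/xc in g1; split=> //; lra].
- apply/sep_sym; apply: (strand_near N0 hc1 Hc0 sE) => /=; split=> //; first by left.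
  right; have := shadow_foot R (i + leaves ll) Hl.+1 lr; rewrite /shadow.
  case: (foot _ _ _) => [[[x y] z] [[x' y'] z']] sh.
  have [/andP[x1 x2] _ _ _ _] := sh; rewrite natrD in x1 x2; split=> /=.
  + by rewrite /m ?middle_eq /= natrD; lra.
  + by rewrite /xc ?middle_eq /N /= !natrD; lra.
  + by rewrite /xc ?middle_eq; lra.
  + exists (2 * (i + leaves ll)%:R), (2 * (i + leaves ll)%:R + 2 * size lr - 2).
    apply: low_impl sh => //; rewrite /hc /Hc /= ?natrD -?natr1; lra.
- exact/sep_sym/(strand_leg hc1 sE).
- apply: (strand_far sE); apply: every_impl (tree_moves_low true i Hl ll) => g.
  case: g => [[[x y] z] [[x' y'] z']] [/andP[x1 x2] -> _ _ _] /=; split=> //.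
  by rewrite /xc ?middle_eq; lra.
- apply/sep_sym; apply: (strand_near N0 hc1 Hc0 sE).
  apply: every_impl (tree_moves_low false (i + leaves ll) Hl.+1 lr) => g sh; right.
  case: g sh => [[[x y] z] [[x' y'] z']] sh.
  have [/andP[x1 x2] _ _ _ _] := sh; rewrite natrD in x1 x2; split=> /=.
  + by rewrite /m ?middle_eq /= natrD; lra.
  + by rewrite /xc ?middle_eq /N /= !natrD; lra.
  + by rewrite /xc ?middle_eq; lra.
  + exists (2 * (i + leaves ll)%:R), (2 * (i + leaves ll)%:R + 2 * size lr - 2).
    apply: low_impl sh => //; rewrite /hc /Hc /= ?natrD -?natr1; lra.
Qed.

Lemma strand_right ic Hc rl rr (N m : R) E :
  2 * size (Node rl rr) <= N -> m <= 2 * ic%:R ->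
  every (fun g => g = foot ic Hc (Node rl rr) \/
    upper 1 N (middle ic rl) (size (Node rl rr) - 1) Hc%:R m g) E ->
  sep (hset E) (hset (tree_moves false ic Hc (Node rl rr))).
Proof.
move=> Nge mle sE.
set xc := middle ic rl in sE *; set hc := size (Node rl rr) - 1 in sE *.
have := size_ge1 R rl; have := size_ge1 R rr => rr1 rl1.
have p1 : (1 : R) = 1 \/ (1 : R) = -1 by left.
have Hc0 : 0 <= Hc%:R :> R by [].
have nE : size (Node rl rr) = size rl + size rr by rewrite -natrD.
have N0 : 0 <= N by rewrite nE in Nge; lra.
have hc1 : 1 <= hc by rewrite /hc nE; lra.
have farP := branch_beside p1 Hc0 (attached_right R false ic Hc rl rr).
have near_low g : shadow ic Hc.+1 rl g -> [/\ m <= 1 * g.1.1.1, 1 * xc - N <= 1 * g.1.1.1,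
    1 * g.1.1.1 <= 1 * xc & exists a b, low a b (hc - 1) (Hc%:R + 1) g].
  case: g => [[[x y] z] [[x' y'] z']] sh; rewrite nE in Nge.
  have [/andP[x1 x2] _ _ _ _] := sh; split=> /=; try lra.
  + by rewrite /xc ?middle_eq; lra.
  + by rewrite /xc ?middle_eq; lra.
  + exists (2 * ic%:R), (2 * ic%:R + 2 * size rl - 2).
    by apply: low_impl sh => //; rewrite /hc ?nE -?natr1; lra.
rewrite tree_moves_node -/xc -/hc !hset_cat.
apply: sepUr; [|apply: sepUr; [|apply: sepUr; [|apply: sepUr]]].
- apply/sep_sym; apply: (strand_near N0 hc1 Hc0 sE) => /=; split=> //; first by left.
  by right; apply: near_low; exact: shadow_foot.
- apply/sep_sym; apply: (strand_far_branch Hc0 sE).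
  apply: every_impl farP => g [->|[g1 g2 g3 g4]]; [by left|right].
  by split=> //; lra.
- exact/sep_sym/(strand_leg hc1 sE).
- apply/sep_sym; apply: (strand_near N0 hc1 Hc0 sE).
  by apply: every_impl (tree_moves_low true ic Hc.+1 rl) => g sh; right; exact: near_low.
- apply: (strand_far sE); apply: every_impl (tree_moves_low false (ic + leaves rl) Hc rr) => g.
  case: g => [[[x y] z] [[x' y'] z']] [/andP[x1 x2] -> _ _ _] /=; split=> //.
  by rewrite natrD in x1; rewrite /xc ?middle_eq; lra.
Qed.

Lemma branch_child_right d i H l r :
  let O := upper_point (middle i l) (size (Node l r) - 1) H%:R in
  let Hr := if d then H.+1 else H in
  sep (hset (branch (~~ d) 1 O (foot (i + leaves l) Hr r)))
      (hset (tree_moves false (i + leaves l) Hr r)).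
Proof.
move=> O Hr; case: r @O => [|rl rr] O; first exact: sep0r.
have := size_ge1 R rl; have := size_ge1 R rr; have := size_ge1 R l => l1 rr1 rl1.
have nE : size (Node rl rr) = size rl + size rr by rewrite -natrD.
have nE' : size (Node l (Node rl rr)) = size l + size (Node rl rr) by rewrite -natrD.
have p1 : (1 : R) = 1 \/ (1 : R) = -1 by left.
apply: (@strand_right _ _ _ _ (2 * size (Node l (Node rl rr))) (1 * middle i l + 1)).
- by rewrite nE'; lra.
- by rewrite ?middle_eq natrD; lra.
apply: branch_upper => //.
- by rewrite /Hr; case: (d); rewrite /= -?natr1.
- by rewrite ?middle_eq nE' nE natrD; apply/andP; split; lra.
- by rewrite nE' nE; lra.
- by move=> _; lra.
Qed.

(** The left subtree, the right subtree and the vertical below the root are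
    separated by the first coordinate. *)
Lemma good_tree_moves d i H t : good (hset (tree_moves d i H t)).
Proof.
elim: t d i H => [|l IHl r IHr] d i H; first exact: good0.
rewrite tree_moves_node; set X := middle i l; set hv := _ - 1; set O := upper_point _ _ _.
set Hl := if d then H else H.+1; set Hr := if d then H.+1 else H.
have H0 : 0 <= H%:R :> R by [].
have m1 : (-1 : R) = 1 \/ (-1 : R) = -1 by right.
have p1 : (1 : R) = 1 \/ (1 : R) = -1 by left.
have aL := attached_left R d i H l r; have aR := attached_right R d i H l r.
have bL := branch_beside m1 H0 aL; have bR := branch_beside p1 H0 aR.
have hv1 : 1 <= hv.
  by rewrite /hv /= natrD; have := size_ge1 R l; have := size_ge1 R r => r1 l1; lra.
have mL : every (fun g => 1 <= -1 * (g.1.1.1 - X) /\ g.2.1.1 = g.1.1.1) (tree_moves true i Hl l).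
  apply: every_impl (tree_moves_low true i Hl l) => -[[[x y] z] [[x' y'] z']].
  by move=> [/andP[x1 x2] -> _ _ _] /=; split=> //; rewrite /X ?middle_eq; lra.
have mR : every (fun g => 1 <= 1 * (g.1.1.1 - X) /\ g.2.1.1 = g.1.1.1)
    (tree_moves false (i + leaves l) Hr r).
  apply: every_impl (tree_moves_low false (i + leaves l) Hr r) => -[[[x y] z] [[x' y'] z']].
  move=> [/andP[x1 x2] -> _ _ _] /=; split=> //; rewrite natrD in x1.
  by rewrite /X ?middle_eq; lra.
have bL' := every_impl (Q := fun g => g = O \/ 1 <= -1 * (g.1.1.1 - X) /\ g.2.1.1 = g.1.1.1) _ bL.
have bR' := every_impl (Q := fun g => g = O \/ 1 <= 1 * (g.1.1.1 - X) /\ g.2.1.1 = g.1.1.1) _ bR.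
have {}bL' := bL' (fun g h => or_ind (fun e => or_introl e) (fun '(And4 a b _ _) => or_intror (conj a b)) h).
have {}bR' := bR' (fun g h => or_ind (fun e => or_introl e) (fun '(And4 a b _ _) => or_intror (conj a b)) h).
have mL' := every_impl (Q := fun g => g = O \/ 1 <= -1 * (g.1.1.1 - X) /\ g.2.1.1 = g.1.1.1) (fun g h => or_intror h) mL.
have mR' := every_impl (Q := fun g => g = O \/ 1 <= 1 * (g.1.1.1 - X) /\ g.2.1.1 = g.1.1.1) (fun g h => or_intror h) mR.
have sides E F := @sep_sides X O E F.
rewrite !hset_cat; apply: goodU; first exact: good_branch m1 aL.
  apply: goodU; first exact: good_branch p1 aR.
    apply: goodU.
    - rewrite /= setU0; apply: (good_hseg (l := (0, -1, 0))); apply: okI; split; lra.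
    - apply: goodU => //; apply: sides => //.
    - by apply: sepUr; [exact: sep_leg_side mL|exact: sep_leg_side mR].
  apply: sepUr; first exact/sep_sym/(leg_branch H0 bR).
  apply: sepUr; last exact: branch_child_right.
  by apply/sep_sym/sides.
apply: sepUr; first by apply: sides.
apply: sepUr; first exact/sep_sym/(leg_branch H0 bL).
by apply: sepUr; [exact: branch_child_left|apply: sides].
Qed.

End Flattening.

(** * The flattened diagram *)

(** The upper point of a crossing. *)
Definition crown (H i : nat) (l : tree) : vertex := ((2 * (i + leaves l)).-1%:Z, 1, H.+1%:Z).

Definition flat_foot (i H : nat) (t : tree) : vertex :=
  match t with
  | Leaf => ((2 * i)%N%:Z, 0, 0)
  | Node l r => ((2 * (i + leaves l)).-1%:Z, 1, H%:Z)
  end.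

Definition flat_branch (far : bool) (s : int) (O U : vertex) : diagram :=
  let B := (O.1.1 + s, U.1.2, U.2) in
  if far then [:: (O, B); (B, U)] else [:: (O, U)].

(** With [op], the edge to the first leaf stops short, at ordinate 1. *)
Fixpoint flat_edges (op d : bool) (i H : nat) (t : tree) : diagram :=
  match t with
  | Leaf => [::]
  | Node l r =>
      let O := crown H i l in
      let Hl := if d then H else H.+1 in
      let Hr := if d then H.+1 else H in
      (if op && (leaves l == 1)%N then [:: (O, (O.1.1 - 1, 1, Hl%:Z))]
       else flat_branch d (-1) O (flat_foot i Hl l)) ++
      flat_branch (~~ d) 1 O (flat_foot (i + leaves l) Hr r) ++
      [:: (flat_foot i H t, ((2 * (i + leaves l)).-1%:Z, 0, -1))] ++
      flat_edges op true i Hl l ++ flat_edges false false (i + leaves l) Hr r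
  end.

(** The upper halves of the vertical segments between the two trees. *)
Fixpoint legs (i : nat) (t : tree) : diagram :=
  match t with
  | Leaf => [::]
  | Node l r =>
      (apex (-1) 1 i t, ((2 * (i + leaves l)).-1%:Z, 0, -1)) ::
      legs i l ++ legs (i + leaves l) r
  end.

Definition tall_trunk (t : tree) : diagram :=
  let x := (apex (-1) 1 0 t).1.1 in let n := (leaves t)%:Z in
  chain [:: apex (-1) 1 0 t; (x, n, 0); (-1, n, 0); (-1, 0, 0)].

Definition flat_trunk (t : tree) : diagram :=
  let x := (apex (-1) 1 0 t).1.1 in
  chain [:: (x, 1, 0); (x - 1, 1, 0); (-1, 1, 0); (-1, 0, 0)].

Definition tall (t : tree) : diagram := tall_trunk t ++ edges 1 0 t ++ legs 0 t.
Definition flattened (t : tree) : diagram := flat_trunk t ++ flat_edges false false 0 0 t.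

Section Psi.
Variable R : realType.
Notation V := (R3 R).
Implicit Types (g O U : V * V) (E F : seq ((V * V) * (V * V))).
Local Notation size t := ((leaves t)%:R : R).
Local Notation middle := (@middle R).
Local Notation foot := (@foot R).
Local Notation tree_moves := (@tree_moves R).
Local Notation link := (link_of R).
Local Notation point := (point_of R).

Lemma middleE i l : ((2 * (i + leaves l)).-1%:Z)%:~R = middle i l.
Proof.
have e : (2 * (i + leaves l)).-1.+1 = (2 * (i + leaves l))%N.
  by rewrite prednK// muln_gt0 addn_gt0 leaves_gt0 orbT.
have := congr1 (fun n => n%:R : R) e; rewrite -natr1 natrM natrD ?middle_eq -pmulrn; lra.
Qed.

Lemma heightE t : ((leaves t).-1%:Z)%:~R = size t - 1.
Proof.
have := congr1 (fun n => n%:R : R) (prednK (leaves_gt0 t)); rewrite -natr1 -pmulrn; lra.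
Qed.

Lemma point_apex i H t : point (apex (-1) 1 i t) = (foot i H t).1.
Proof.
case: t => [|l r]; first by congr (_, _, _); rewrite /= -pmulrn natrM.
by congr (_, _, _); rewrite /= ?middleE ?mul1r -?(heightE (Node l r)).
Qed.

Lemma point_top i H l r : point (apex 1 1 i (Node l r)) =
  (upper_point (middle i l) (size (Node l r) - 1) H).1.
Proof. by congr (_, _, _); rewrite /= ?middleE ?mul1r -?(heightE (Node l r)). Qed.

Lemma point_flat_foot i H t : point (flat_foot i H t) = (foot i H t).2.
Proof.
case: t => [|l r]; first by congr (_, _, _); rewrite /= -pmulrn natrM.
by congr (_, _, _); rewrite ?middleE.
Qed.

Lemma point_crown H i l h : point (crown H i l) = (upper_point (middle i l) h H%:R).2.
Proof. by congr (_, _, _); rewrite ?middleE//= -pmulrn -natr1. Qed.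

Lemma link_step p q D : link ((p, q) :: D) = segment (point p) (point q) `|` link D.
Proof. exact: link_cons. Qed.

Lemma branch_fst far s X hv H U : s = 1 \/ s = -1 -> attached far s X hv H U ->
  fst @` hset (branch far s (upper_point X hv H) U) = segment (upper_point X hv H).1 U.1.
Proof.
move=> s1 aU; have ss : s * s = 1 by case: s1 => ->; ring.
have U2 : 1 <= s * (U.1.1.1 - X).
  have e : s * (X + s - X) = 1 by rewrite -[RHS]ss; ring.
  by case: aU => [->|[xc [hc [-> x2 _ _]]]] /=; rewrite ?e//; lra.
rewrite /branch; case: far aU => _ /=; last by rewrite setU0 hseg_fst.
rewrite setU0 image_setU !hseg_fst /= -segment_split//.
by rewrite invr_ge0 invf_le1; [apply/andP; split; lra|lra].
Qed.

Lemma tree_moves_fst d i H t : fst @` hset (tree_moves d i H t) = link (edges 1 i t ++ legs i t).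
Proof.
elim: t d i H => [|l IHl r IHr] d i H; first by rewrite /= image_set0 link_nil.
rewrite tree_moves_node !hset_cat !image_setU IHl IHr.
rewrite (branch_fst _ (attached_left R d i H l r)); last by right.
rewrite (branch_fst _ (attached_right R d i H l r)); last by left.
have -> : link (edges 1 i (Node l r) ++ legs i (Node l r)) =
    segment (point (apex 1 1 i (Node l r))) (point (apex (-1) 1 i l)) `|`
    (segment (point (apex 1 1 i (Node l r))) (point (apex (-1) 1 (i + leaves l) r)) `|`
     (segment (point (apex (-1) 1 i (Node l r))) (point ((2 * (i + leaves l)).-1%:Z, 0, -1)) `|`
      (link (edges 1 i l ++ legs i l) `|`
       link (edges 1 (i + leaves l) r ++ legs (i + leaves l) r)))).
  have -> : edges 1 i (Node l r) = [:: (apex 1 1 i (Node l r), apex (-1) 1 i l);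
    (apex 1 1 i (Node l r), apex (-1) 1 (i + leaves l) r)]
    ++ edges 1 i l ++ edges 1 (i + leaves l) r by [].
  have -> : legs i (Node l r) = (apex (-1) 1 i (Node l r), ((2 * (i + leaves l)).-1%:Z, 0, -1)) ::
    legs i l ++ legs (i + leaves l) r by [].
  rewrite !(link_cat, link_step) link_nil.
  by apply/seteqP; split=> z; rewrite /setU /=; tauto.
rewrite (point_top i H%:R) (point_apex i (if d then H else H.+1)).
rewrite (point_apex _ (if d then H.+1 else H)) (point_apex i H).
rewrite image_set0 setU0 hseg_fst; congr (_ `|` (_ `|` (segment _ _ `|` _))).
by congr (_, _, _); rewrite ?middleE.
Qed.

Lemma branch_snd far (s : int) O U o u : point o = O.2 -> point u = U.2 ->
  snd @` hset (branch far s%:~R O U) = link (flat_branch far s o u).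
Proof.
move=> oO uU; rewrite /branch /flat_branch; case: far => /=.
  rewrite setU0 image_setU !hseg_snd !link_cons link_nil setU0 /= oO uU.
  by congr (segment _ _ `|` segment _ _); rewrite /bend /= -oO -uU; congr (_, _, _); rewrite /= intrD.
by rewrite setU0 hseg_snd link_cons link_nil setU0 oO uU.
Qed.

Lemma tree_moves_snd d i H t : snd @` hset (tree_moves d i H t) = link (flat_edges false d i H t).
Proof.
elim: t d i H => [|l IHl r IHr] d i H; first by rewrite /= image_set0 link_nil.
rewrite tree_moves_node !hset_cat !image_setU IHl IHr.
have -> : (-1 : R) = (-1)%:~R by [].
have -> : (1 : R) = 1%:~R by [].
rewrite !(branch_snd _ _ (point_crown _ _ _ _) (point_flat_foot _ _ _)).
rewrite [flat_edges _ _ _ _ _]/= !(link_cat) /= ?image_set0 setU0 hseg_snd link_cons link_nil setU0.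
by congr (_ `|` (_ `|` (segment _ _ `|` _))); congr (_, _, _); rewrite ?middleE.
Qed.

(** The trunk behaves like an edge that comes from a parent on the left. *)
Definition trunk (t : tree) : seq ((V * V) * (V * V)) :=
  let X := (foot 0 0 t).1.1.1 in
  let W : V * V := ((X, size t, 0), (X - 1, 1, 0)) in
  let Z : V * V := ((-1, size t, 0), (-1, 1, 0)) in
  [:: (foot 0 0 t, W); (W, Z)] ++ [:: (Z, ((-1, 0, 0), (-1, 0, 0)))].

Lemma trunk_fst l r : fst @` hset (trunk (Node l r)) = link (tall_trunk (Node l r)).
Proof.
set t := Node l r; pose x := (apex (-1) 1 0 t).1.1.
have -> : tall_trunk t = [:: (apex (-1) 1 0 t, (x, (leaves t)%:Z, 0));
  ((x, (leaves t)%:Z, 0), (-1, (leaves t)%:Z, 0)); ((-1, (leaves t)%:Z, 0), (-1, 0, 0))] by [].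
rewrite /trunk !image_setU image_set0 !hseg_fst !link_step link_nil (point_apex 0 0).
by congr (segment _ _ `|` (segment _ _ `|` (segment _ _ `|` _)));
  congr (_, _, _); rewrite ?middleE//= -pmulrn.
Qed.

Lemma trunk_snd l r : snd @` hset (trunk (Node l r)) = link (flat_trunk (Node l r)).
Proof.
set t := Node l r; pose x := (apex (-1) 1 0 t).1.1.
have -> : flat_trunk t = [:: ((x, 1, 0), (x - 1, 1, 0)); ((x - 1, 1, 0), (-1, 1, 0));
  ((-1, 1, 0), (-1, 0, 0))] by [].
rewrite /trunk !image_setU image_set0 !hseg_snd !link_step link_nil.
by congr (segment _ _ `|` (segment _ _ `|` (segment _ _ `|` _)));
  congr (_, _, _); rewrite ?intrB ?middleE.
Qed.

Lemma good_trunk l r : good (hset (trunk (Node l r) ++ tree_moves false 0 0 (Node l r))).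
Proof.
have := size_ge1 R l; have := size_ge1 R r => r1 l1.
have nE : size (Node l r) = size l + size r by rewrite -natrD.
set t := Node l r; rewrite /trunk -/t; set X := (foot 0 0 t).1.1.1.
have XE : X = 2 * size l - 1 by rewrite /X /= ?middle_eq; lra.
set W : V * V := ((X, size t, 0), _); set Z : V * V := ((-1, size t, 0), _).
set B : V * V := ((-1, 0, 0), _).
have UE : foot 0 0 t = ((X, size t - 1, -1), (X, 1, 0)) by [].
have sE : every (fun g => g = foot 0 0 t \/
    upper 1 (2 * size t) (middle 0 l) (size t - 1) 0%:R 0 g) [:: (foot 0 0 t, W); (W, Z)].
  have XE' : middle 0 l = X by [].
  rewrite XE'; split; [by left| |split; [| |by []]]; right; rewrite /upper /W /Z /t nE.
  - split; [split; lra|lra|by right; split; lra|split=> //; lra|by left].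
  - split; [split; lra|lra|by right; split; lra|split=> //; lra|by left].
  - split; [split; lra|lra|by left; split; lra|split=> //; lra|by left].
rewrite -catA hset_cat; apply: goodU.
- apply: goodU; [|apply: goodU; [|exact: good0|exact/sep_sym/sep0l]|].
  + apply: (good_hseg (l := (-1, 1, 0))); rewrite UE; apply: okI; split; lra.
  + apply: (good_hseg (l := (-1, 0, 0))); apply: okI; split; lra.
  + apply: sepUr; last exact/sep_sym/sep0l.
    apply: (sep_spanned (l := (-2, 1, 0)) (spanned_hseg (g := foot 0 0 t) (h := W))
      (spanned_hseg (g := W) (h := Z))).
    rewrite UE => _ _ [<-|[<-|[]]] [<-|[<-|[]]]; try exact: ok_refl; apply: okI; split; lra.
- rewrite hset_cat; apply: goodU; [|exact: good_tree_moves|].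
    rewrite /= setU0; apply: (good_hseg (l := (0, -1, 0))); rewrite /Z /t nE; apply: okI; split; lra.
  have mE : every (fun g => 0 <= g.1.1.1 /\ g.2.1.1 = g.1.1.1) (tree_moves false 0 0 t).
    apply: every_impl (tree_moves_low R false 0 0 t) => -[[[x y] z] [[x' y'] z']].
    by move=> [/andP[x1 x2] -> _ _ _] /=; split=> //; lra.
  apply: (sep_every (P := fun g => g = Z \/ g = B) (l := (1, 0, 0)) _ mE).
    by split=> //; [left|right].
  move=> g [[[x y] z] [[x' y'] z']] /= gE [x0 ->].
  by case: gE => ->; apply: okI; split; lra.
- rewrite hset_cat; apply: sepUr; last first.
    by apply: (@strand_right R 0 0 l r (2 * size t) 0) => //; rewrite mulr0.
  apply: (sep_every (P := fun g => g = foot 0 0 t \/ g = W \/ g = Z)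
    (Q := fun g => g = Z \/ g = B) (l := (-1, -1, 0))).
  + by do ?split; rewrite ?UE; [left|right; left|right; left|right; right].
  + by split=> //; [left|right].
  move=> g h [->|[->|->]] [->|->]; try exact: ok_refl; rewrite ?UE /W /Z /B /t nE; apply: okI; split; lra.
Qed.

(** What lies below the axis stays in place while the top is flattened, as the
    moving vertices stay above the axis or do not move. *)
Lemma sep_ground (K : set V) E : (forall p, K p -> p.1.2 <= 0) ->
  every (fun g => (0 < g.1.1.2 /\ 0 < g.2.1.2) \/ (g.2 = g.1 /\ g.1.1.2 = 0)) E ->
  sep (rigid K 0) (hset E).
Proof.
move=> K0; elim: E => [_|e E IH /= [e1 e2 /IH sE]]; first exact/sep_sym/sep0l.
apply: sepUr => //.
have dE (p : V) : dot (0, 1, 0) p = p.1.2 by rewrite /dot /= !mul0r mul1r addr0 add0r.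
apply: (sep_rigid_spanned (l := (0, 1, 0)) (c := 0) (spanned_hseg (g := _) (h := _))).
  by move=> p /K0; rewrite dE.
have ground (g : V * V) : (0 < g.1.1.2 /\ 0 < g.2.1.2) \/ (g.2 = g.1 /\ g.1.1.2 = 0) ->
    (0 < dot (0, 1, 0) g.1 /\ 0 + dot (0, 1, 0) 0 < dot (0, 1, 0) g.2) \/
    [/\ g.2 - g.1 = 0, 0 <= dot (0, 1, 0) g.1 & 0 + dot (0, 1, 0) 0 <= dot (0, 1, 0) g.2].
  rewrite !dE /= addr0; case=> [[g1 g2]|[-> g1]]; first by left.
  by right; rewrite subrr g1.
by move=> g [<-|[<-|//]]; exact: ground.
Qed.

Lemma flatten_top (K : set V) l r : (forall p, K p -> p.1.2 <= 0) ->
  equivalent (K `|` link (tall (Node l r))) (K `|` link (flattened (Node l r))).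
Proof.
move=> K0; have := size_ge1 R l; have := size_ge1 R r => r1 l1.
have nE : size (Node l r) = size l + size r by rewrite -natrD.
have gr : every (fun g => (0 < g.1.1.2 /\ 0 < g.2.1.2) \/ (g.2 = g.1 /\ g.1.1.2 = 0))
    (trunk (Node l r) ++ tree_moves false 0 0 (Node l r)).
  apply/every_cat; split.
    by rewrite /trunk nE /=; do ?split; try (by right); left; split; rewrite /= ?nE //; lra.
  apply: every_impl (tree_moves_low R false 0 0 (Node l r)) => -[[[x y] z] [[x' y'] z']].
  move=> [_ -> _ _ [[-> [_ y0]]|[-> -> ->]]] /=; first by left.
  by right.
have := equivalent_good (goodU (good_rigid K 0) (good_trunk l r) (sep_ground K0 gr)).
rewrite hset_cat.
rewrite (image_setU fst (rigid _ _)) (image_setU fst (hset (trunk _))) rigid_fst.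
rewrite (image_setU snd (rigid _ _)) (image_setU snd (hset (trunk _))) rigid_snd.
rewrite trunk_fst trunk_snd tree_moves_fst tree_moves_snd /tall /flattened !link_cat.
by rewrite (_ : (fun p => p + 0) = id) ?image_id//; apply/funext => p; rewrite addr0.
Qed.

End Psi.

(** * The two halves of the link *)

Section PsiDecomposition.
Variable R : realType.
Notation V := (R3 R).
Local Notation link := (link_of R).
Local Notation point := (point_of R).

Lemma apex_flip z i t : apex z (-1) i t = flip (apex z 1 i t).
Proof. by case: t => [|l r]; rewrite /flip /= ?oppr0// mulN1r mul1r. Qed.

Lemma edges_flip i t : edges (-1) i t = map_diagram flip (edges 1 i t).
Proof.
elim: t i => // l IHl r IHr i.
have E e : edges e i (Node l r) = [:: (apex 1 e i (Node l r), apex (-1) e i l);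
    (apex 1 e i (Node l r), apex (-1) e (i + leaves l) r)]
    ++ edges e i l ++ edges e (i + leaves l) r by [].
by rewrite !E IHl IHr /map_diagram !map_cat [in RHS]/map !(apex_flip _ _ _).
Qed.

(** The numbers of edges from the axis to the crossings, from left to right. *)
Fixpoint gaps (t : tree) : seq nat :=
  if t is Node l r then gaps l ++ (leaves t).-1 :: gaps r else [::].

Fixpoint row (e : int) (k : nat) (s : seq nat) : seq vertex :=
  if s is n :: s' then ((2 * k).+1%:Z, e * n%:Z, -1) :: row e k.+1 s' else [::].

Fixpoint row_legs (k : nat) (s : seq nat) : diagram :=
  if s is n :: s' then
    (((2 * k).+1%:Z, n%:Z, -1), ((2 * k).+1%:Z, 0, -1)) :: row_legs k.+1 s' else [::].

Lemma size_gaps t : (size (gaps t)).+1 = leaves t.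
Proof. by elim: t => //= l IHl r IHr; rewrite size_cat -IHl -IHr addSn. Qed.

Lemma gaps_gt0 t : all (leq 1) (gaps t).
Proof.
elim: t => //= l IHl r IHr; rewrite all_cat IHl /= IHr andbT.
by have := leaves_gt0 l; have := leaves_gt0 r; lia.
Qed.

Lemma row_cat e k s s' : row e k (s ++ s') = row e k s ++ row e (k + size s) s'.
Proof. by elim: s k => [|n s IH] k /=; rewrite ?addn0// IH addnS. Qed.

Lemma row_legs_cat k s s' : row_legs k (s ++ s') = row_legs k s ++ row_legs (k + size s) s'.
Proof. by elim: s k => [|n s IH] k /=; rewrite ?addn0// IH addnS. Qed.

Lemma middle_gap i l : (2 * (i + size (gaps l))).+1 = (2 * (i + leaves l)).-1.
Proof. by rewrite -size_gaps; lia. Qed.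

Lemma undersE e i t : unders e i t = row e i (gaps t).
Proof.
elim: t i => //= l IHl r IHr i; rewrite row_cat IHl IHr /= middle_gap.
by rewrite -addnS size_gaps.
Qed.

Lemma legsE i t : link (legs i t) = link (row_legs i (gaps t)).
Proof.
elim: t i => // l IHl r IHr i.
have -> : legs i (Node l r) = (apex (-1) 1 i (Node l r), ((2 * (i + leaves l)).-1%:Z, 0, -1)) ::
    legs i l ++ legs (i + leaves l) r by [].
rewrite [gaps _]/= row_legs_cat /= middle_gap -addnS size_gaps link_step !link_cat link_step IHl IHr.
by rewrite /= mul1r setUCA.
Qed.

(** The vertical segments are cut by the axis. *)
Lemma zip_row k s s' : size s = size s' -> all (leq 1) s -> all (leq 1) s' ->
  link (zip (row 1 k s) (row (-1) k s')) =
  link (row_legs k s) `|` mirror (link (row_legs k s')).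
Proof.
rewrite -link_flip; elim: s s' k => [|n s IH] [|n' s'] k //=; first by rewrite !link_nil setU0.
move=> [ss] /andP[n1 s1] /andP[n1' s1']; rewrite mul1r mulN1r !link_step IH//.
have h : 0 < (n%:R + n'%:R : R) by rewrite -natrD ltr0n addn_gt0 n1.
rewrite (@segment_split R (n%:R / (n%:R + n'%:R))); last first.
  by rewrite divr_ge0 ?ler0n ?(ltW h)//= ler_pdivrMr// mul1r lerDl ler0n.
have -> : comb (n%:R / (n%:R + n'%:R)) (point ((2 * k).+1%:Z, n%:Z, -1))
    (point ((2 * k).+1%:Z, - n'%:Z, -1)) = point ((2 * k).+1%:Z, 0, -1).
  by congr (_, _, _); rewrite /= ?intrN -?pmulrn; field; rewrite gt_eqF.
rewrite [segment _ (point (_, - n'%:Z, _))]segment_sym /flip /= oppr0.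
by apply/seteqP; split=> z; rewrite /setU /=; tauto.
Qed.

Lemma trunk_halves t b : leaves t = leaves b ->
  let n := (leaves t)%:Z in
  link (polyline (apex (-1) 1 0 t) [:: ((apex (-1) 1 0 t).1.1, n, 0); (-1, n, 0); (-1, - n, 0);
    ((apex (-1) (-1) 0 b).1.1, - n, 0); apex (-1) (-1) 0 b]) =
  link (tall_trunk t) `|` mirror (link (tall_trunk b)).
Proof.
move=> tb n; set x := (apex (-1) 1 0 t).1.1; set y := (apex _ _ 0 b).1.1.
have -> : link (tall_trunk t) =
   segment (point (apex (-1) 1 0 t)) (point (x, n, 0)) `|`
   (segment (point (x, n, 0)) (point (-1, n, 0)) `|`
    segment (point (-1, n, 0)) (point (-1, 0, 0))).
  by rewrite !link_step link_nil setU0.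
have -> : mirror (link (tall_trunk b)) =
   segment (point (apex (-1) (-1) 0 b)) (point (y, - n, 0)) `|`
   (segment (point (y, - n, 0)) (point (-1, - n, 0)) `|`
    segment (point (-1, - n, 0)) (point (-1, 0, 0))).
  have e : map_diagram flip (tall_trunk b) = [:: (apex (-1) (-1) 0 b, (y, - n, 0));
      ((y, - n, 0), (-1, - n, 0)); ((-1, - n, 0), (-1, 0, 0))].
    by rewrite /y apex_flip /n tb /map_diagram /= /flip /= !oppr0.
  by rewrite -link_flip e !link_step link_nil setU0.
have -> : polyline (apex (-1) 1 0 t) [:: (x, n, 0); (-1, n, 0); (-1, - n, 0);
    (y, - n, 0); apex (-1) (-1) 0 b] = [:: (apex (-1) 1 0 t, (x, n, 0));
    ((x, n, 0), (-1, n, 0)); ((-1, n, 0), (-1, - n, 0)); ((-1, - n, 0), (y, - n, 0));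
    ((y, - n, 0), apex (-1) (-1) 0 b)] by [].
rewrite !link_step link_nil (@segment_split R (1 / 2) (point (-1, n, 0))); last first.
  by apply/andP; split; lra.
have -> : comb (1 / 2) (point (-1, n, 0)) (point (-1, - n, 0)) = point (-1, 0, 0).
  by congr (_, _, _); rewrite /= ?intrN; lra.
rewrite [segment (point (-1, 0, 0)) _]segment_sym.
rewrite [segment (point (-1, - n, 0)) (point (y, _, _))]segment_sym.
rewrite [segment (point (y, _, _)) (point (apex _ _ _ _))]segment_sym.
by apply/seteqP; split=> z; rewrite /setU /set0 /=; tauto.
Qed.

Lemma psi_halves t b : leaves t = leaves b ->
  link (psi (t, b)) = link (tall t) `|` mirror (link (tall b)).
Proof.
move=> tb; set n := (leaves t)%:Z.
have tallE u : link (tall u) = link (tall_trunk u) `|` (link (edges 1 0 u) `|`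
    link (row_legs 0 (gaps u))).
  by rewrite -legsE -!link_cat.
have -> : psi (t, b) = edges 1 0 t ++ edges (-1) 0 b ++ zip (unders 1 0 t) (unders (-1) 0 b) ++
  polyline (apex (-1) 1 0 t) [:: ((apex (-1) 1 0 t).1.1, n, 0); (-1, n, 0); (-1, - n, 0);
    ((apex (-1) (-1) 0 b).1.1, - n, 0); apex (-1) (-1) 0 b] by [].
rewrite !tallE !mirrorU !(link_cat R (edges _ _ _)) (link_cat R (zip _ _)) edges_flip link_flip.
rewrite !undersE zip_row ?gaps_gt0// ?trunk_halves//; last by apply: succn_inj; rewrite !size_gaps.
by apply/seteqP; split=> z; rewrite /setU /=; tauto.
Qed.

Lemma link_above D : all (fun e => (0 <= e.1.1.2) && (0 <= e.2.1.2)) D ->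
  forall p, mirror (link D) p -> p.1.2 <= 0.
Proof.
move=> /allP D0 _ [p [e /D0 /andP[e1 e2] [t /andP[t0 t1] ->]] <-] /=.
by rewrite oppr_le0 addr_ge0// mulr_ge0 ?ler0z// subr_ge0.
Qed.

Lemma edges_above i t :
  all (fun e => (0 <= e.1.1.2) && (0 <= e.2.1.2)) (edges 1 i t ++ legs i t).
Proof.
have apex_ge0 z j u : 0 <= (apex z 1 j u).1.2 by case: u => //= l r; rewrite mul1r.
elim: t i => // l IHl r IHr i; have := IHl i; have := IHr (i + leaves l)%N.
rewrite /= !all_cat /= !all_cat !apex_ge0 ?mul1r => /andP[-> ->] /andP[-> ->].
by [].
Qed.

Lemma tall_above l r : all (fun e => (0 <= e.1.1.2) && (0 <= e.2.1.2)) (tall (Node l r)).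
Proof. by rewrite /tall all_cat edges_above andbT /= ?mul1r. Qed.

Lemma flat_above op d i H t : all (fun e => (0 <= e.1.1.2) && (0 <= e.2.1.2)) (flat_edges op d i H t).
Proof.
elim: t op d i H => // l IHl r IHr op d i H; rewrite /= !all_cat /= !all_cat IHl IHr !andbT.
have above (far : bool) s O U : 0 <= O.1.2 -> 0 <= U.1.2 ->
    all (fun e => (0 <= e.1.1.2) && (0 <= e.2.1.2)) (flat_branch far s O U).
  by move=> O0 U0; rewrite /flat_branch; case: far; rewrite /= O0 U0.
have foot0 j K u : 0 <= (flat_foot j K u).1.2 by case: u.
by case: ifP => _; rewrite !above.
Qed.

Lemma flattened_above l r : all (fun e => (0 <= e.1.1.2) && (0 <= e.2.1.2)) (flattened (Node l r)).
Proof. by rewrite /flattened all_cat flat_above. Qed.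

(** The two halves of the diagram are flattened one after the other. *)
Lemma psi_flattened l r l' r' : leaves (Node l r) = leaves (Node l' r') ->
  equivalent (link (psi (Node l r, Node l' r')))
             (link (flattened (Node l r)) `|` mirror (link (flattened (Node l' r')))).
Proof.
move=> e; rewrite psi_halves// setUC; set t := Node l r; set b := Node l' r'.
apply: equivalent_trans (@flatten_top R _ l r (link_above (tall_above l' r'))) _.
have h := @flatten_top R _ l' r' (link_above (flattened_above l r)).
have := equivalent_homeomorphism (@homeomorphism_yflip R) h.
by rewrite -!/(mirror _) !mirrorU !mirrorK ![_ `|` mirror _]setUC ![mirror _ `|` _]setUC.
Qed.

End PsiDecomposition.

(** * The slabs of the flattened diagram *)

(** Up to the orientation of the edges and to degenerate ones. *)
Definition covered (D D' : diagram) : bool :=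
  all (fun e => [|| e \in D', (e.2, e.1) \in D' |
                  (e.1 == e.2) && has (fun f => (f.1 == e.1) || (f.2 == e.1)) D']) D.

(** A tree hanging from a trunk that comes from the left. *)
Definition stem (op : bool) (t : tree) : diagram :=
  ((0, 1, 0), flat_foot 0 0 t) :: flat_edges op false 0 0 t.

Section Slabs.
Variable R : realType.
Notation V := (R3 R).
Local Notation link := (link_of R).
Local Notation point := (point_of R).

Lemma segment_start (p q : V) : segment p q p.
Proof. by exists 0; rewrite ?lexx ?ler01//; case: p => [[x y] z]; congr (_, _, _) => /=; ring. Qed.

Lemma covered_link D D' : covered D D' -> link D `<=` link D'.
Proof.
move=> /allP DD r [e /DD /or3P[eD er|eD er|/andP[/eqP ee /hasP[f fD fe]]]].
- by exists e.
- by exists (e.2, e.1) => //=; rewrite segment_sym.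
rewrite -ee => -[t _ ->]; rewrite -/(comb _ _ _).
have -> : comb t (point e.1) (point e.1) = point e.1 by congr (_, _, _); rewrite /=; ring.
exists f => //; case/orP: fe => /eqP <-; first exact: segment_start.
by rewrite segment_sym; exact: segment_start.
Qed.

Lemma link_same D D' : covered D D' -> covered D' D -> link D = link D'.
Proof. by move=> h h'; apply/seteqP; split; exact: covered_link. Qed.

Lemma link_slab D1 D2 G : covered (D1 ++ map_diagram flip D2) G ->
  covered G (D1 ++ map_diagram flip D2) -> link D1 `|` mirror (link D2) = link G.
Proof. by move=> h h'; rewrite -link_flip -link_cat; exact: link_same. Qed.

Lemma flat_foot_shift k i H t : flat_foot (k + i) H t = translate (2 * k)%N%:Z 0 (flat_foot i H t).
Proof.
case: t => [|l r]; rewrite /translate /= ?addr0; congr (_, _, _); first by lia.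
by have := leaves_gt0 l; lia.
Qed.

Lemma crown_shift k H i l : crown H (k + i) l = translate (2 * k)%N%:Z 0 (crown H i l).
Proof. by rewrite /translate /crown /= ?addr0; congr (_, _, _); have := leaves_gt0 l; lia. Qed.

Lemma flat_node op d j H l r : flat_edges op d j H (Node l r) =
    (if op && (leaves l == 1)%N
     then [:: (crown H j l, ((crown H j l).1.1 - 1, 1, (if d then H else H.+1)%:Z))]
     else flat_branch d (-1) (crown H j l) (flat_foot j (if d then H else H.+1) l)) ++
    flat_branch (~~ d) 1 (crown H j l) (flat_foot (j + leaves l) (if d then H.+1 else H) r) ++
    [:: (flat_foot j H (Node l r), ((2 * (j + leaves l)).-1%:Z, 0, -1))] ++
    flat_edges op true j (if d then H else H.+1) l ++
    flat_edges false false (j + leaves l) (if d then H.+1 else H) r.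
Proof. by []. Qed.

Lemma flat_shift k op d i H t :
  flat_edges op d (k + i) H t = map_diagram (translate (2 * k)%N%:Z 0) (flat_edges op d i H t).
Proof.
elim: t op d i H => // l IHl r IHr op d i H.
have branchE far s O U : flat_branch far s (translate (2 * k)%N%:Z 0 O) (translate (2 * k)%N%:Z 0 U)
    = map_diagram (translate (2 * k)%N%:Z 0) (flat_branch far s O U).
  by rewrite /flat_branch /translate /map_diagram; case: far; rewrite //= addr0 addrAC.
rewrite !flat_node -!(addnA k) !(crown_shift k) !(flat_foot_shift k) IHl IHr !branchE.
rewrite /map_diagram !map_cat -!/(map_diagram _ _); congr (_ ++ _ ++ _ ++ _).
  case: ifP => // _; rewrite /map_diagram /= /translate /= addr0; congr [:: (_, (_, _, _))].
  by rewrite addrAC.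
rewrite /map_diagram /= /translate /= !addr0; congr [:: (_, (_, _, _))].
by have := leaves_gt0 l; lia.
Qed.

Lemma leaves_graft v u : (0 < leaves u)%N -> leaves (graft_left v u) = ((leaves u).-1 + leaves v)%N.
Proof. by move=> u0; have := leaves_graft_left v u; lia. Qed.

(** The crossings on the left spine, but for the root, get the same final height,
    and a tree grafted there is separated from the rest by a plane. *)
Lemma flat_graft op d i H v1 v2 u1 u2 (v := Node v1 v2) (u := Node u1 u2) k :
  k = (leaves u).-1 -> (d = false /\ H = 0%N) \/ (d = true /\ H = 1%N) ->
  link (flat_edges op d i H (graft_left v u)) = link (flat_edges true d (k + i) H v) `|`
    (segment (point ((2 * (k + i))%N%:Z, 1, 1)) (point (flat_foot i 1 u)) `|`
     link (flat_edges op true i 1 u)).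
Proof.
rewrite {}/v => ku; elim: v1 v2 d H => [|l IHl r _] v2 d H dH.
all: have H1 : (if d then H else H.+1) = 1%N by case: dH => -[-> ->].
all: have un : (2 <= leaves u)%N by rewrite /= -(addn1 1) leq_add ?leaves_gt0.
- have e2 : (i + leaves u = k + i + leaves Leaf)%N by rewrite ku [leaves Leaf]/=; lia.
  have e1 : crown H i u = crown H (k + i) Leaf by rewrite /crown e2.
  have e3 : flat_foot i H (Node u v2) = flat_foot (k + i) H (Node Leaf v2) by rewrite /= -e2.
  rewrite [graft_left _ _]/= !flat_node H1 e1 e2 e3 (gtn_eqF un) andbF.
  rewrite !link_cat link_nil set0U.
  have e4 : (crown H (k + i) Leaf).1.1 - 1 = (2 * (k + i))%N%:Z by rewrite /=; lia.
  have -> : link (flat_branch d (-1) (crown H (k + i) Leaf) (flat_foot i 1 u)) =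
      link [:: (crown H (k + i) Leaf, ((crown H (k + i) Leaf).1.1 - 1, 1, 1%:Z))] `|`
      segment (point ((2 * (k + i))%N%:Z, 1, 1)) (point (flat_foot i 1 u)).
    rewrite link_step link_nil setU0 e4 /flat_branch; case: dH => -[-> HE].
      rewrite link_step link_nil setU0 HE.
      pose w : R := 2 * (leaves u2)%:R.
      have w1 : 1 <= w by rewrite /w; have := size_ge1 R u2; lra.
      rewrite (@segment_split R w^-1); last first.
        by rewrite invr_ge0 invf_le1; [apply/andP; split; lra|lra].
      suff -> : comb w^-1 (point (crown 0 (k + i) Leaf)) (point (flat_foot i 1 u)) =
          point ((2 * (k + i))%N%:Z, 1, 1) by [].
      have e5 : point (flat_foot i 1 u) = (2 * (k + i)%:R + 1 - w, 1, 1).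
        congr (_, _, _); rewrite middleE ?middle_eq /w ku natrD.
        have := congr1 (fun n => n%:R : R) (prednK (ltnW un)); rewrite /= -natr1 natrD; lra.
      have e6 : point (crown 0 (k + i) Leaf) = (2 * (k + i)%:R + 1, 1, 1).
        congr (_, _, _); rewrite middleE ?middle_eq /=; lra.
      have ww : w^-1 * w = 1 by rewrite mulVf// gt_eqF//; lra.
      rewrite e5 e6; congr (_, _, _); rewrite /= ?pmulrn -?natrM; try lra.
    by rewrite !link_step link_nil setU0 e4.
  by apply/seteqP; split=> z; rewrite /setU /=; tauto.
- set v1 := Node l r.
  have e2 : (i + leaves (graft_left v1 u) = k + i + leaves v1)%N.
    by rewrite leaves_graft ?ku ?(ltnW un)//; lia.
  have e1 : crown H i (graft_left v1 u) = crown H (k + i) v1 by rewrite /crown e2.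
  have e3 : flat_foot i H (Node (graft_left v1 u) v2) = flat_foot (k + i) H (Node v1 v2).
    by rewrite [LHS]/= [RHS]/= -/v1 e2.
  have e4 : flat_foot i 1 (graft_left v1 u) = flat_foot (k + i) 1 v1.
    rewrite /= leaves_graft ?(ltnW un)//; congr (_, _, _); rewrite -?ku; lia.
  have n1 : (1 < leaves v1)%N by rewrite /= -(addn1 1) leq_add ?leaves_gt0.
  have n2 : (1 < leaves (graft_left v1 u))%N by rewrite leaves_graft ?(ltnW un)//; lia.
  rewrite -[graft_left (Node v1 v2) u]/(Node (graft_left v1 u) v2).
  rewrite (flat_node op d i H (graft_left v1 u)) (flat_node true d (k + i) H v1) H1 e1 e2 e3 e4.
  rewrite (gtn_eqF n1) (gtn_eqF n2) !andbF.
  have := IHl r true 1%N (or_intror (conj erefl erefl)); rewrite -/v1.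
  move: (flat_edges op true i 1 (graft_left v1 u)) (flat_edges true true (k + i) 1 v1) (flat_edges op true i 1 u).
  move=> F G G' IH.
  rewrite !link_cat IH.
  by apply/seteqP; split=> z; rewrite /setU /=; tauto.
Qed.

End Slabs.

(** * Cutting off the slabs *)

Section Towers.
Variable R : realType.
Notation V := (R3 R).
Local Notation link := (link_of R).
Local Notation point := (point_of R).

(** The part of a flattened diagram to the right of a cut. U is what remains of the
    top tree; what remains of the bottom tree is V, whose first leaf stands for the
    strand that has been cut. *)
Definition tower (U V : tree) : set (R3 R) :=
  link (stem false U) `|` mirror (link (stem true V)).

Lemma segment_between (a b c y z : int) : a <= b -> b <= c ->
  segment (point (a, y, z)) (point (c, y, z)) =
  segment (point (a, y, z)) (point (b, y, z)) `|` segment (point (b, y, z)) (point (c, y, z)).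
Proof.
move=> ab bc; have [ac|/eqP ac] := eqVneq a c.
  have -> : b = a by lia.
  by rewrite ac setUid.
have h : 0 < c%:~R - a%:~R :> R by rewrite subr_gt0 ltr_int; lia.
have h1 : 0 <= b%:~R - a%:~R :> R by rewrite subr_ge0 ler_int.
have h2 : b%:~R - a%:~R <= c%:~R - a%:~R :> R by rewrite lerD2r ler_int.
rewrite (@segment_split R ((b%:~R - a%:~R) / (c%:~R - a%:~R))); last first.
  by rewrite divr_ge0// ?(ltW h)//= ler_pdivrMr// mul1r.
have -> // : comb ((b%:~R - a%:~R) / (c%:~R - a%:~R)) (point (a, y, z)) (point (c, y, z)) =
  point (b, y, z).
by congr (_, _, _); rewrite /=; field; rewrite gt_eqF.
Qed.

Lemma stem_shift op k t : xshift (2 * k)%:R (link (stem op t)) =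
  segment (point ((2 * k)%N%:Z, 1, 0)) (point (flat_foot k 0 t)) `|` link (flat_edges op false k 0 t).
Proof.
have := link_translate R (2 * k)%N%:Z 0 (stem op t).
rewrite /stem /map_diagram /= -/(map_diagram _ _) -flat_shift -flat_foot_shift addn0 link_step.
by rewrite /translate /= add0r addr0 -pmulrn => ->.
Qed.

Lemma stem_graft op v1 v2 u1 u2 (v := Node v1 v2) (u := Node u1 u2) k : k = (leaves u).-1 ->
  link (stem op (graft_left v u)) =
  link [:: ((0, 1, 0), ((2 * k)%N%:Z, 1, 0)); (((2 * k)%N%:Z, 1, 1), flat_foot 0 1 u)] `|`
  link (flat_edges op true 0 1 u) `|` xshift (2 * k)%:R (link (stem true v)).
Proof.
move=> ku; rewrite stem_shift /stem link_step (flat_graft _ _ _ _ _ ku); last by left.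
have -> : flat_foot 0 0 (graft_left v u) = flat_foot k 0 v.
  rewrite /v /= leaves_graft ?leaves_gt0// -/u -ku; congr (_, _, _); lia.
have foot_v : flat_foot k 0 v = ((2 * (k + leaves v1)).-1%:Z, 1, 0) by [].
rewrite addn0 foot_v (@segment_between _ (2 * k)%N%:Z); [|by []|]; last first.
  by have := leaves_gt0 v1; lia.
move: (flat_edges true false k 0 v) (flat_edges op true 0 1 u) => F G.
rewrite !link_step link_nil.
by apply/seteqP; split=> z; rewrite /setU /set0 /=; tauto.
Qed.

Definition gamma_top : diagram :=
  [:: ((0, 1, 0), (5, 1, 0)); ((5, 1, 1), (1, 1, 1)); ((5, 1, 1), (6, 1, 0));
      ((5, 1, 0), (5, 0, -1))] ++ flat_edges false true 0 1 chair.

Lemma stem_chair u1 u2 (u := Node u1 u2) :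
  link (stem false (Node chair u)) = link gamma_top `|` xshift 6 (link (stem false u)).
Proof.
have -> : (6 : R) = (2 * 3)%:R by [].
rewrite stem_shift.
have -> : stem false (Node chair u) = [:: ((0, 1, 0), (5, 1, 0)); ((5, 1, 1), (1, 1, 1));
   ((5, 1, 1), (6, 1, 0)); ((6, 1, 0), flat_foot 3 0 u); ((5, 1, 0), (5, 0, -1))] ++
   flat_edges false true 0 1 chair ++ flat_edges false false 3 0 u by [].
rewrite /gamma_top; move: (flat_edges _ _ _ _ chair) (flat_edges _ _ _ _ u) => F G.
rewrite !link_cat !link_step link_nil.
by apply/seteqP; split=> z; rewrite /setU /set0 /=; tauto.
Qed.

Lemma tower_gamma u1 u2 v1 v2 (u := Node u1 u2) (v := Node v1 v2) :
  tower (Node chair u) (graft_left v (left_comb 3)) = link gamma `|` xshift 6 (tower u v).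
Proof.
rewrite /tower stem_chair.
have -> : left_comb 3 = Node (left_comb 2) Leaf by [].
rewrite (stem_graft _ _ _ (k := 3))// -link_cat.
set D2 := _ ++ _.
rewrite -(@link_slab R gamma_top D2 gamma)//.
rewrite mirrorU mirror_xshift xshiftU (_ : (2 * 3)%:R = 6 :> R)//.
by apply/seteqP; split=> z; rewrite /setU /=; tauto.
Qed.

Lemma tower_junction u1 u2 v1 v2 (u := Node u1 u2) (v := Node v1 v2) :
  tower (graft_left v (left_comb 1)) (Node Leaf u) =
  link junction `|` xshift 2 (mirror (tower u v)).
Proof.
rewrite /tower.
have -> : left_comb 1 = Node Leaf Leaf by [].
rewrite (stem_graft _ _ _ (k := 1))// -link_cat; set D1 := _ ++ _.
pose D2 : diagram := [:: ((0, 1, 0), (1, 1, 0)); ((1, 1, 1), (0, 1, 1)); ((1, 1, 1), (2, 1, 0));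
  ((1, 1, 0), (1, 0, -1))].
have -> : link (stem true (Node Leaf u)) = link D2 `|` xshift (2 * 1)%:R (link (stem false u)).
  rewrite stem_shift.
  have -> : stem true (Node Leaf u) = [:: ((0, 1, 0), (1, 1, 0)); ((1, 1, 1), (0, 1, 1));
    ((1, 1, 1), (2, 1, 0)); ((2, 1, 0), flat_foot 1 0 u); ((1, 1, 0), (1, 0, -1))] ++
    flat_edges false false 1 0 u by [].
  move: (flat_edges _ _ _ _ u) => F; rewrite /D2 !link_cat !link_step link_nil.
  by apply/seteqP; split=> z; rewrite /setU /set0 /=; tauto.
rewrite -(@link_slab R D1 D2 junction)//.
rewrite !mirrorU mirror_xshift xshiftU (_ : (2 * 1)%:R = 2 :> R)// mirrorK.
by apply/seteqP; split=> z; rewrite /setU /=; tauto.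
Qed.

Lemma tower_gamma_end : tower (Node chair Leaf) (left_comb 3) = link gamma_end.
Proof. by apply: link_slab; vm_compute. Qed.

Lemma tower_junction_end : tower (left_comb 1) (Node Leaf Leaf) = link junction_end.
Proof. by apply: link_slab; vm_compute. Qed.

Lemma flat_trunkE l r : link (flat_trunk (Node l r)) =
  segment (point (-1, 1, 0)) (point ((2 * leaves l).-1%:Z, 1, 0)) `|`
  segment (point (-1, 1, 0)) (point (-1, 0, 0)).
Proof.
set x := (2 * leaves l).-1%:Z.
have -> : flat_trunk (Node l r) = [:: ((x, 1, 0), (x - 1, 1, 0)); ((x - 1, 1, 0), (-1, 1, 0));
  ((-1, 1, 0), (-1, 0, 0))] by [].
rewrite !link_step link_nil setU0 (@segment_between (-1) (x - 1) x); first last.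
- by lia.
- by rewrite /x; lia.
rewrite [segment (point (x, _, _)) _]segment_sym [segment (point (x - 1, _, _)) (point (-1, _, _))]segment_sym.
by rewrite setUA [X in X `|` _]setUC.
Qed.

Definition start_top : diagram :=
  [:: ((-1, 1, 0), (1, 1, 0)); ((-1, 1, 0), (-1, 0, 0)); ((1, 1, 1), (0, 0, 0));
      ((1, 1, 1), (2, 1, 0)); ((1, 1, 0), (1, 0, -1))].
Definition start_bottom : diagram :=
  [:: ((-1, 1, 0), (2, 1, 0)); ((-1, 1, 0), (-1, 0, 0)); ((2, 1, 1), (1, 1, 1))] ++
  flat_edges false true 0 1 (Node Leaf Leaf).

Lemma flattened_start u1 u2 v1 v2 (u := Node u1 u2) (v := Node v1 v2) :
  link (flattened (Node Leaf u)) `|` mirror (link (flattened (graft_left v (left_comb 1)))) =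
  link start `|` xshift 2 (tower u v).
Proof.
rewrite /tower xshiftU (_ : 2 = (2 * 1)%:R :> R)// -mirror_xshift !stem_shift.
have -> : link (flattened (Node Leaf u)) = link start_top `|`
    (segment (point ((2 * 1)%N%:Z, 1, 0)) (point (flat_foot 1 0 u)) `|`
     link (flat_edges false false 1 0 u)).
  rewrite /flattened link_cat flat_trunkE.
  have -> : flat_edges false false 0 0 (Node Leaf u) = [:: ((1, 1, 1), (0, 0, 0));
    ((1, 1, 1), (2, 1, 0)); ((2, 1, 0), flat_foot 1 0 u); ((1, 1, 0), (1, 0, -1))] ++
    flat_edges false false 1 0 u by [].
  move: (flat_edges _ _ _ _ u) => F; rewrite /start_top !link_cat !link_step link_nil.
  by apply/seteqP; split=> z; rewrite /setU /set0 /=; tauto.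
have -> : link (flattened (graft_left v (left_comb 1))) = link start_bottom `|`
    (segment (point ((2 * 1)%N%:Z, 1, 0)) (point (flat_foot 1 0 v)) `|`
     link (flat_edges true false 1 0 v)).
  have -> : left_comb 1 = Node Leaf Leaf by [].
  rewrite /flattened link_cat -[graft_left v _]/(Node (graft_left v1 (Node Leaf Leaf)) v2).
  rewrite flat_trunkE -[Node (graft_left v1 _) v2]/(graft_left v (Node Leaf Leaf)).
  rewrite (flat_graft _ _ _ _ _ (k := 1))//; last by left.
  have foot_v : flat_foot 1 0 v = ((2 * (1 + leaves v1)).-1%:Z, 1, 0) by [].
  rewrite leaves_graft// foot_v (@segment_between (-1) (2 * 1)%N%:Z); [|by []|]; last first.
    by have := leaves_gt0 v1; rewrite [leaves (Node _ _)]/=; lia.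
  rewrite -[(leaves (Node Leaf Leaf)).-1]/1%N addn0 /start_bottom.
  move: (flat_edges true false _ 0 v) (flat_edges _ _ _ _ (Node Leaf Leaf)) => F G.
  rewrite !link_cat !link_step link_nil.
  by apply/seteqP; split=> z; rewrite /setU /set0 /=; tauto.
rewrite -(@link_slab R start_top start_bottom start)// mirrorU.
by apply/seteqP; split=> z; rewrite /setU /=; tauto.
Qed.

End Towers.

(** * The diagrams T *)

Lemma left_combD a b : left_comb (a + b) = graft_left (left_comb a) (left_comb b).
Proof. by elim: a => //= a ->. Qed.

Lemma graft_leftA t u w : graft_left (graft_left t u) w = graft_left t (graft_left u w).
Proof. by elim: t => //= l ->. Qed.

Definition inner (t : tree) : bool := if t is Node _ _ then true else false.

(** The trees of T without what is the same in all cases: a leaf at the left of the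
    top tree, and a caret at the first leaf of the bottom tree. *)
Definition core (s : seq nat) (m : nat) : tree * tree :=
  if s is x :: s' then
    let D := Tdiag_rec s' x.-1 in
    (ssrnat.iter m (Node chair) D.2, graft_left D.1 (left_comb (3 * m)))
  else (ssrnat.iter m (Node chair) Leaf, left_comb (3 * m)).

Lemma Tdiag_core s m :
  Tdiag_rec s m = (Node Leaf (core s m).1, graft_left (core s m).2 (left_comb 1)).
Proof.
have combE : left_comb (3 * m).+1 = graft_left (left_comb (3 * m)) (left_comb 1).
  by rewrite -left_combD addn1.
case: s => [|x s]; first by rewrite /= /Tdiag1 combE.
have -> : Tdiag_rec (x :: s) m =
    (graft_right (Node Leaf (ssrnat.iter m (Node chair) Leaf)) (Tdiag_rec s x.-1).2,
     graft_left (Tdiag_rec s x.-1).1 (left_comb (3 * m).+1)) by [].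
rewrite combE [(core _ _).2]/= graft_leftA; congr (Node Leaf _, _).
by elim: m {combE} => //= m ->.
Qed.

Lemma core_inner s m : (s != [::]) || (0 < m)%N -> inner (core s m).1 && inner (core s m).2.
Proof.
case: s m => [|x s] [|m] // _.
  by rewrite /core Tdiag_core /=; case: (core s _).2.
by rewrite /core Tdiag_core.
Qed.

Section Towers.
Variable R : realType.
Local Notation link := (link_of R).
Local Notation tower := (@tower R).

Lemma tower_gammas m u v : inner u -> inner v ->
  tower (ssrnat.iter m (Node chair) u) (graft_left v (left_comb (3 * m))) =
  ssrnat.iter m (fun A => link gamma `|` xshift 6 A) (tower u v).
Proof.
case: u v => // u1 u2 [//|v1 v2] _ _; elim: m => [|m IH].
  by rewrite [ssrnat.iter 0 _ _]/= -[left_comb _]/Leaf; congr tower; elim: (Node v1 v2) => //= l ->.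
rewrite mulnS addnC left_combD -graft_leftA.
rewrite -[RHS]/(link gamma `|` xshift 6 (ssrnat.iter m _ (tower _ _))) -IH.
rewrite -[LHS]/(tower (Node chair (ssrnat.iter m (Node chair) (Node u1 u2))) _).
by case: m {IH} => [|m]; rewrite -tower_gamma.
Qed.

Lemma tower_core s m : all (leq 1) s -> (s != [::]) || (0 < m)%N ->
  tower (core s m).1 (core s m).2 = @slabs R s m.
Proof.
elim: s m => [|x s IH] m.
  case: m => // m _ _; elim: m => [|m IHm]; first exact: tower_gamma_end.
  have -> : core [::] m.+2 =
      (Node chair (core [::] m.+1).1, graft_left (core [::] m.+1).2 (left_comb 3)).
    by rewrite /core -left_combD addnC -mulnS.
  rewrite -[RHS]/(link gamma `|` xshift 6 (@slabs R [::] m.+1)) -IHm.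
  have := @core_inner [::] m.+1 isT.
  by case: (core [::] m.+1) => -[//|u1 u2] [//|v1 v2] _; rewrite -tower_gamma.
move=> /andP[x1 s1] _; rewrite /core Tdiag_core -/core.
set U := (core s x.-1).1; set W := (core s x.-1).2.
rewrite tower_gammas//; last by rewrite /=; case: W.
rewrite [RHS]/=; congr (ssrnat.iter m _ _).
case: ifP => [/andP[/eqP s0 /eqP x0]|sx].
  by rewrite /U /W s0 x0 -tower_junction_end.
have sx' : (s != [::]) || (0 < x.-1)%N.
  by move: sx; case: (s == [::]) => //= /negbT; lia.
rewrite -IH// -/U -/W; have := core_inner sx'; rewrite -/U -/W.
by case: U W => [//|? ?] [//|? ?] _; rewrite -tower_junction.
Qed.

End Towers.

Theorem mainTheorem1 (R : realType) (n : nat) (x : n.-tuple nat)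
    (hn : (1 <= n)%N) (hx : forall i : 'I_n, (1 <= tnth x i)%N) :
  ambient_isotopic (link_of R (psi (Tdiag x)))
                   (link_of R (closure_of (tangle_product x))).
Proof.
have : all (leq 1) x by apply/allP => _ /tnthP[i ->].
have : (0 < size x)%N by rewrite size_tuple.
move: (tval x) => s {hn hx x}; rewrite -[s]revK size_rev all_rev.
case: (rev s) => // m t _ /= /andP[m1 t1]; rewrite /Tdiag revK.
apply: isotopic_ambient; suff [] : equivalent (link_of R (psi (Tdiag_rec t m)))
  (link_of R (closure_of (tangle_product (rev (m :: t))))) by [].
apply: equivalent_trans (slabs_closure R t1 m1).
have c1 : (t != [::]) || (0 < m)%N by rewrite m1 orbT.
rewrite -tower_core//; have /andP[iU iW] := core_inner c1.
have := Tdiag_is_thompson (rev (m :: t)); rewrite /Tdiag revK => /andP[/eqP e _].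
rewrite Tdiag_core in e *.
case: (core t m) iU iW e => -[//|u1 u2] [//|w1 w2] _ _ e.
by rewrite -flattened_start; exact: (@psi_flattened R Leaf (Node u1 u2) (graft_left w1 (left_comb 1)) w2 e).
Qed.
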